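(* Let $(M,J)$ be an almost Hermitian manifold. For all $q\geq 0$ and all $\alpha\in\mathcal{A}^{0,q}$, $$\Lambda\,\partial\alpha=i\,\bar\partial^*\alpha+i\,[\Lambda,\bar\partial^*]\,L\alpha .$$
   Context: An almost Hermitian manifold is a smooth manifold $M$ of real dimension $2n$ with an almost complex structure $J$ (not assumed integrable) and a $J$-compatible Riemannian metric $g$, i.e. $g(J\cdot,J\cdot)=g$. Its fundamental $(1,1)$-form is $\omega(X,Y)=g(JX,Y)$; it is not assumed closed. $\mathcal{A}^{p,q}$ denotes the smooth complex-valued forms of bidegree $(p,q)$ with respect to $J$. The exterior differential decomposes as $d=\bar\mu+\bar\partial+\partial+\mu$, with components of bidegrees $|\bar\mu|=(-1,2)$, $|\bar\partial|=(0,1)$, $|\partial|=(1,0)$, $|\mu|=(2,-1)$. The Hodge star $\star:\mathcal{A}^{p,q}\to\mathcal{A}^{n-q,n-p}$ is the $\mathbb{C}$-linear operator defined by $\beta\wedge\star\bar\eta=\langle\beta,\eta\rangle\,\mathrm{vol}$, where $\langle\cdot,\cdot\rangle$ is the pointwise Hermitian inner product on forms induced by $g$ and $\mathrm{vol}=\omega^n/n!$. Put $\bar\partial^*=-\star\partial\star$, an operator of bidegree $(0,-1)$ (the formal adjoint of $\bar\partial$). $L$ is the operator $L\eta=\omega\wedge\eta$, and $\Lambda=L^*=\star^{-1}L\star$. The commutator is $[\Lambda,\bar\partial^*]=\Lambda\bar\partial^*-\bar\partial^*\Lambda$. *)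

(* Defs.v *)
From HB Require Import structures.
From mathcomp Require Import all_boot all_order all_algebra all_fingroup.
From mathcomp Require Import complex.
From mathcomp Require Import all_classical all_reals all_analysis.

Set Implicit Arguments.
Unset Strict Implicit.
Unset Printing Implicit Defensive.

Import Order.TTheory GRing.Theory Num.Theory.
Import numFieldNormedType.Exports.

Local Open Scope classical_set_scope.
Local Open Scope ring_scope.
Local Open Scope complex_scope.

(** * Complex-valued exterior algebra of a real vector space

The real vector space is 'rV[R]_m (row vectors; endomorphisms act by right
multiplication).  A complex-valued multilinear form of degree k takes k
vectors; an inhomogeneous form is a family with one form in each degree.  Both
are functions on sequences of vectors: the restriction of such a function to
the sequences of size k is its component of degree k.  This avoids casts
between degrees such as (k + l) + j and k + (l + j). *)

Definition cform (R : realType) (m : nat) := seq 'rV[R]_m -> R[i].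

Definition multilinear (R : realType) (m : nat) (a : cform R m) :=
  forall (s t : seq 'rV[R]_m) (r : R) (u v : 'rV[R]_m),
    a (s ++ (r *: u + v) :: t) = r%:C * a (s ++ u :: t) + a (s ++ v :: t).

Definition alternating (R : realType) (m : nat) (a : cform R m) :=
  forall (s t w : seq 'rV[R]_m) (u : 'rV[R]_m),
    a (s ++ u :: t ++ u :: w) = 0.

Definition exterior (R : realType) (m : nat) : set (cform R m) :=
  [set a | multilinear a /\ alternating a].

Definition homogeneous (R : realType) (m k : nat) (a : cform R m) :=
  forall s : seq 'rV[R]_m, size s != k -> a s = 0.

Definition exterior_deg (R : realType) (m k : nat) : set (cform R m) :=
  [set a | exterior a /\ homogeneous k a].

Definition component (R : realType) (m k : nat) (a : cform R m) : cform R m :=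
  fun s => if size s == k then a s else 0.

Definition conj_form (R : realType) (m : nat) (a : cform R m) : cform R m :=
  fun s => (a s)^*%C.

(* Wedge product normalised so that (dx /\ dy)(u, v) = dx u dy v - dx v dy u:
   for a, b of degrees k, l the coefficient is 1 / (k! l!). *)
Definition wedge (R : realType) (m : nat) (a b : cform R m) : cform R m :=
  fun s =>
    \sum_(k < (size s).+1)
      ((k`! * (size s - k)`!)%:R)^-1 *
      \sum_(sg : 'S_(size s))
        let t := [seq s`_(sg i) | i : 'I_(size s)] in
        (-1) ^+ sg * a (take k t) * b (drop k t).

Definition one_form0 (R : realType) (m : nat) : cform R m :=
  fun s => (nilp s)%:R.

Definition wedge_exp (R : realType) (m : nat) (a : cform R m) (k : nat) :
  cform R m := iter k (wedge a) (@one_form0 R m).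

(* The Hermitian inner product induced on forms of degree k by the inner product
   with Gram matrix G in the standard basis e_0, ..., e_(m-1):
     1/k! \sum G^(i_1 j_1) ... G^(i_k j_k) a(e_i1, ..., e_ik) b(e_j1, ..., e_jk)^*
   where (G^(i j)) is the inverse of G. *)
Definition inner (R : realType) (m k : nat) (G : 'M[R]_m) (a b : cform R m) :
    R[i] :=
  let e (i : 'I_m) : 'rV[R]_m := delta_mx 0 i in
  (k`!%:R)^-1 *
  \sum_(I : {ffun 'I_k -> 'I_m}) \sum_(K : {ffun 'I_k -> 'I_m})
    (\prod_(l < k) invmx G (I l) (K l))%:C *
    a [seq e (I l) | l : 'I_k] * (b [seq e (K l) | l : 'I_k])^*%C.

(* z = *h b, for b of degree k: since *h is C-linear and defined by
   a /\ *h (conj b) = <a, b> vol, it is characterised by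
   a /\ *h b = <a, conj b> vol. *)
Definition hodge_spec (R : realType) (m k : nat) (G : 'M[R]_m) (vol b : cform R m) :
    set (cform R m) :=
  [set z | exterior_deg (m - k) z /\
     forall a, exterior_deg k a ->
       wedge a z = inner k G a (conj_form b) *: vol].

(* The component of degree m - k of *h b is *h applied to the component of
   degree k of b. *)
Definition hodge (R : realType) (m : nat) (G : 'M[R]_m) (vol b : cform R m) :
    cform R m :=
  fun s => let k := (m - size s)%N in
    xget 0 (hodge_spec k G vol (component k b)) s.

Definition hodge_inv (R : realType) (m : nat) (G : 'M[R]_m) (vol z : cform R m) :
    cform R m :=
  xget 0 [set b | exterior b /\ hodge G vol b = z].

(** * Bidegree on a vector space with a complex structure

The complexification of 'rV[R]_m is 'rV[R[i]]_m. *)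

(* C-multilinear extension. *)
Fixpoint cext (R : realType) (m : nat) (a : cform R m) (s : seq 'rV[R[i]]_m) :
    R[i] :=
  if s is z :: s' then
    cext (fun t => a (map_mx (@complex.Re R) z :: t)) s' +
    'i%R * cext (fun t => a (map_mx (@complex.Im R) z :: t)) s'
  else a [::].

Definition T10 (R : realType) (m : nat) (J : 'M[R]_m) : set 'rV[R[i]]_m :=
  [set z | z *m map_mx (real_complex R) J = 'i%R *: z].

Definition T01 (R : realType) (m : nat) (J : 'M[R]_m) : set 'rV[R[i]]_m :=
  [set z | z *m map_mx (real_complex R) J = - 'i%R *: z].

Definition pure_form (R : realType) (m : nat) (J : 'M[R]_m) (p q : nat) :
    set (cform R m) :=
  [set a | exterior_deg (p + q) a /\
     forall s t : seq 'rV[R[i]]_m,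
       (forall z, z \in s -> T10 J z) -> (forall z, z \in t -> T01 J z) ->
       (size s, size t) != (p, q) -> cext a (s ++ t) = 0].

(* The projections u |-> (u -/+ i J u) / 2 onto T10 (b = true), T01 (b = false). *)
Definition type_proj (R : realType) (m : nat) (J : 'M[R]_m) (b : bool)
    (u : 'rV[R]_m) : 'rV[R[i]]_m :=
  2^-1 *: (map_mx (real_complex R) u
           - (if b then 'i%R else - 'i%R) *: map_mx (real_complex R) (u *m J)).

(* The component of bidegree (p, q): B is the set of positions at which the
   argument is projected to T10. *)
Definition bidegree_part (R : realType) (m : nat) (J : 'M[R]_m) (p q : nat)
    (a : cform R m) : cform R m :=
  fun s =>
    if size s == (p + q)%N then
      \sum_(B : {set 'I_(size s)} | #|B| == p)
        cext a [seq type_proj J (i \in B) s`_i | i : 'I_(size s)]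
    else 0.

(** * Smooth manifolds *)

Definition iter_partial (R : realType) (m : nat) (f : 'rV[R]_m -> R)
    (s : seq 'I_m) : 'rV[R]_m -> R :=
  foldr (fun i h => 'D_(delta_mx 0 i : 'rV[R]_m) h) f s.

(* C^infinity on U, for U open. *)
Definition smooth_on (R : realType) (m : nat) (U : set 'rV[R]_m)
    (f : 'rV[R]_m -> R) :=
  forall (s : seq 'I_m) (x : 'rV[R]_m), U x -> differentiable (iter_partial f s) x.

Definition smooth_onC (R : realType) (m : nat) (U : set 'rV[R]_m)
    (f : 'rV[R]_m -> R[i]) :=
  smooth_on U (fun x => complex.Re (f x)) /\
  smooth_on U (fun x => complex.Im (f x)).

Definition deriveC (R : realType) (m : nat) (f : 'rV[R]_m -> R[i])
    (x v : 'rV[R]_m) : R[i] :=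
  ('D_v (fun y => complex.Re (f y)) x) +i* ('D_v (fun y => complex.Im (f y)) x).

Record chart (R : realType) (m : nat) (M : topologicalType) := Chart {
  cdom : set M;
  cmap : M -> 'rV[R]_m;
  cinv : 'rV[R]_m -> M;
  cdom_open : open cdom;
  cimg_open : open (cmap @` cdom);
  cmapK : forall p, cdom p -> cinv (cmap p) = p;
  cmap_continuous : {within cdom, continuous cmap};
  cinv_continuous : {within cmap @` cdom, continuous cinv} }.

Definition cimg (R : realType) (m : nat) (M : topologicalType)
  (c : chart R m M) : set 'rV[R]_m := cmap c @` cdom c.

(* chart_at selects, for each point p, a chart around p; the tangent space at p
   is identified with 'rV[R]_m by means of this chart. *)
Record smooth_manifold (R : realType) (m : nat) := SmoothManifold {
  mspace :> topologicalType;
  mspace_hausdorff : hausdorff_space mspace;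
  mspace_second_countable : @second_countable mspace;
  atlas : set (chart R m mspace);
  chart_at : mspace -> chart R m mspace;
  chart_at_atlas : forall p, atlas (chart_at p);
  chart_at_dom : forall p, cdom (chart_at p) p;
  atlas_smooth : forall c c', atlas c -> atlas c' -> forall j : 'I_m,
    smooth_on (cmap c @` (cdom c `&` cdom c'))
              (fun x => cmap c' (cinv c x) 0 j) }.

(* The tangent vector at p with coordinates v in the chart c has coordinates
   tchange c c' p v in the chart c'. *)
Definition tchange (R : realType) (m : nat) (M : topologicalType)
    (c c' : chart R m M) (p : M) (v : 'rV[R]_m) : 'rV[R]_m :=
  'D_v (cmap c' \o cinv c) (cmap c p).

Definition of_coord (R : realType) (m : nat) (M : smooth_manifold R m)
    (c : chart R m M) (p : M) : 'rV[R]_m -> 'rV[R]_m :=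
  tchange c (chart_at p) p.

Definition to_coord (R : realType) (m : nat) (M : smooth_manifold R m)
    (c : chart R m M) (p : M) : 'rV[R]_m -> 'rV[R]_m :=
  tchange (chart_at p) c p.

(** * Differential forms *)

Definition dform (R : realType) (m : nat) (M : smooth_manifold R m) :=
  M -> cform R m.

(* x |-> a(X_1, ..., X_k) in the chart c, the X_j being the vector fields with
   constant coordinates s in this chart. *)
Definition local_coef (R : realType) (m : nat) (M : smooth_manifold R m)
    (a : dform M) (c : chart R m M) (s : seq 'rV[R]_m) (x : 'rV[R]_m) : R[i] :=
  let p := cinv c x in a p (map (of_coord c p) s).

Definition smooth_form (R : realType) (m : nat) (M : smooth_manifold R m)
    (a : dform M) :=
  forall c, atlas c -> forall s, smooth_onC (cimg c) (local_coef a c s).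

(* d a (X_0, ..., X_k) = \sum_i (-1)^i X_i (a (X_0, ..., ^X_i, ..., X_k)) for the
   (commuting) vector fields with constant coordinates in the chart chart_at p. *)
Definition dext (R : realType) (m : nat) (M : smooth_manifold R m)
    (a : dform M) : dform M :=
  fun p s => let c := chart_at p in
    \sum_(i < size s)
      (-1) ^+ i *
      deriveC (local_coef a c (take i s ++ drop i.+1 s)) (cmap c p) s`_i.

(** * Almost Hermitian manifolds *)

Record almost_hermitian (R : realType) (n : nat) := AlmostHermitian {
  ah_manifold :> smooth_manifold R (2 * n);
  ahJ : ah_manifold -> 'M[R]_(2 * n);
  ahG : ah_manifold -> 'M[R]_(2 * n);
  ahJ_square : forall p, ahJ p *m ahJ p = - 1%:M;
  ahJ_smooth : forall c, atlas c -> forall (v : 'rV[R]_(2 * n)) j,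
    smooth_on (cimg c)
      (fun x => let p := cinv c x in to_coord c p (of_coord c p v *m ahJ p) 0 j);
  ahG_sym : forall p, (ahG p)^T = ahG p;
  ahG_pos : forall p (u : 'rV[R]_(2 * n)), u != 0 -> 0 < (u *m ahG p *m u^T) 0 0;
  ahG_smooth : forall c, atlas c -> forall u v : 'rV[R]_(2 * n),
    smooth_on (cimg c)
      (fun x => let p := cinv c x in
                (of_coord c p u *m ahG p *m (of_coord c p v)^T) 0 0);
  ahG_compat : forall p (u v : 'rV[R]_(2 * n)),
    ((u *m ahJ p) *m ahG p *m (v *m ahJ p)^T) 0 0 = (u *m ahG p *m v^T) 0 0 }.

(* omega(X, Y) = g(J X, Y) *)
Definition omega (R : realType) (n : nat) (M : almost_hermitian R n) : dform M :=
  fun p s =>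
    if s is [:: u; v] then ((u *m ahJ p *m ahG p *m v^T) 0 0)%:C else 0.
Arguments omega {R n} M p _.

Definition volume (R : realType) (n : nat) (M : almost_hermitian R n) : dform M :=
  fun p => (n`!%:R)^-1 *: wedge_exp (omega M p) n.
Arguments volume {R n} M p _.

(* The space of smooth forms of bidegree (p, q). *)
Definition Apq (R : realType) (n : nat) (M : almost_hermitian R n) (p q : nat) :
    set (dform M) :=
  [set a | smooth_form a /\ forall x, pure_form (ahJ x) p q (a x)].
Arguments Apq {R n} M p q _.

Definition form_part (R : realType) (n : nat) (M : almost_hermitian R n)
  (p q : nat) (a : dform M) : dform M := fun x => bidegree_part (ahJ x) p q (a x).

(* The component of bidegree (1, 0) of d: in degree k it is the sum over
   p + 1 + q = k of the (p + 1, q)-parts of d of the (p, q)-parts. *)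
Definition del (R : realType) (n : nat) (M : almost_hermitian R n) (a : dform M) :
    dform M :=
  fun x s =>
    \sum_(p < size s)
      let q := (size s - p.+1)%N in form_part p.+1 q (dext (form_part p q a)) x s.

Definition star (R : realType) (n : nat) (M : almost_hermitian R n) (a : dform M) :
    dform M := fun x => hodge (ahG x) (volume M x) (a x).

Definition star_inv (R : realType) (n : nat) (M : almost_hermitian R n)
    (a : dform M) : dform M :=
  fun x => hodge_inv (ahG x) (volume M x) (a x).

Definition delbar_adj (R : realType) (n : nat) (M : almost_hermitian R n)
    (a : dform M) : dform M := - star (del (star a)).

Definition Lop (R : realType) (n : nat) (M : almost_hermitian R n) (a : dform M) :
    dform M := fun x => wedge (omega M x) (a x).

Definition Lambda (R : realType) (n : nat) (M : almost_hermitian R n)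
    (a : dform M) : dform M := star_inv (Lop (star a)).

Definition commutator (R : realType) (n : nat) (M : almost_hermitian R n)
    (A B : dform M -> dform M) (a : dform M) : dform M := A (B a) - B (A a).

Arguments delbar_adj {R n M} a.
Arguments Lambda {R n M} a.

(* Main.v *)
(** Interior products satisfy [iota_v (a /\ b) = iota_v a /\ b + (-1)^deg(a) a /\ iota_v b],
    so identities between forms can be proved by recursion on the list of arguments.
    The Hodge star exchanges [u^flat /\ _] and [iota_u] up to sign. Hence it conjugates
    [L] into an explicit contraction Lambda, which satisfies [[Lambda, L] = n - k] in
    degree k, and on a form alpha of bidegree (0,q) it is given by
    [star alpha = c_q L^N alpha / N!] with [N = n - q] and a unit [c_q].

    The right-hand side of the identity is then [-i c_q / N!] times the star of the
    bidegree (N + 1, n) part of [(1 - N) d (L^N alpha) + N L d (L^(N-1) alpha)]. Since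
    [d (L^j alpha) = j d omega /\ L^(j-1) alpha + L^j d alpha], the terms in [d omega]
    cancel and the star of [L^N del alpha] remains. Finally, the decomposition of
    [del alpha] into a primitive form and a multiple of omega shows that
    [-i c_q / N! star (L^N del alpha) = Lambda del alpha]. *)

From HB Require Import structures.
From mathcomp Require Import all_fingroup.
Require Import Defs.
From mathcomp Require Import all_boot all_order all_algebra.
From mathcomp Require Import complex.
From mathcomp Require Import all_classical all_reals all_analysis.
From mathcomp Require Import zify ring.

Set Implicit Arguments.
Unset Strict Implicit.
Unset Printing Implicit Defensive.

Import Order.TTheory GRing.Theory Num.Theory.
Import numFieldNormedType.Exports.

Local Open Scope classical_set_scope.
Local Open Scope ring_scope.
Local Open Scope complex_scope.

(** * Interior products and the wedge product *)

(** The weights 1 - N and N have the following origin. Since [star (L alpha)] is Lambda of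
    [star alpha], it is N times the unnormalised L^(N-1) alpha, and Lambda L alpha = N alpha. So the
    three terms delbar^* alpha, Lambda delbar^* L alpha and - delbar^* Lambda L alpha bring the
    factors 1, N and -N; the first and third involve del (L^N alpha), the second L del (L^(N-1)
    alpha). No unitary frame is chosen: sums over an orthonormal basis become contractions with the
    inverse Gram matrix in the standard basis. All of this is pointwise; derivatives enter only
    through the Leibniz rule for L^j alpha. The components mu and mubar never appear, because L^j
    alpha has the single bidegree (j, q + j) and its del is one projection of d. No Lefschetz
    decomposition is constructed. It is enough that Lambda del alpha is of type (0, q - 1), hence
    killed by Lambda, and that Lambda is injective above the middle degree. The case q > n stands
    apart, as N = n - q is then truncated; alpha vanishes there. *)

Section RecursiveWedge.
Context {R : realType} {m : nat}.
Implicit Types (a b c : cform R m) (s : seq 'rV[R]_m) (u v x : 'rV[R]_m).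

Lemma form_addE a b s : (a + b) s = a s + b s. Proof. by []. Qed.

Lemma form_oppE a s : (- a) s = - a s. Proof. by []. Qed.

Lemma form_scaleE (k : R[i]) a s : (k *: a) s = k * a s. Proof. by []. Qed.

Lemma form_zeroE s : (0 : cform R m) s = 0. Proof. by []. Qed.

Definition iota_form v a : cform R m := fun s => a (v :: s).

Lemma iota_form_is_linear v : linear (iota_form v).
Proof. by []. Qed.

HB.instance Definition _ v :=
  GRing.isLinear.Build R[i] (cform R m) (cform R m) *:%R (iota_form v)
    (iota_form_is_linear v).

Lemma iota_formD v a b : iota_form v (a + b) = iota_form v a + iota_form v b.
Proof. by []. Qed.

Lemma iota_formN v a : iota_form v (- a) = - iota_form v a.
Proof. by []. Qed.

Lemma iota_formZ v (k : R[i]) a : iota_form v (k *: a) = k *: iota_form v a.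
Proof. by []. Qed.

(** The grading involution: it carries the sign of the antiderivation rule without asking [a] to be
    homogeneous. *)
Definition degree_sign a : cform R m := fun s => (-1) ^+ size s * a s.

Lemma degree_sign_is_linear : linear degree_sign.
Proof. by move=> k a b; apply/funext => s; rewrite /degree_sign /= mulrDr mulrCA. Qed.

HB.instance Definition _ :=
  GRing.isLinear.Build R[i] (cform R m) (cform R m) *:%R degree_sign
    degree_sign_is_linear.

Lemma iota_degree_sign v a :
  iota_form v (degree_sign a) = - degree_sign (iota_form v a).
Proof. by apply/funext => s; rewrite /iota_form /degree_sign /= exprS -mulrA mulN1r. Qed.

Lemma degree_signK a : degree_sign (degree_sign a) = a.
Proof. by apply/funext => s; rewrite /degree_sign signrMK. Qed.

Lemma degree_sign_homogeneous k a :
  homogeneous k a -> degree_sign a = (-1) ^+ k *: a.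
Proof.
move=> ha; apply/funext => s; rewrite /degree_sign /=.
by rewrite form_scaleE; have [<-//|/ha ->] := eqVneq (size s) k; rewrite !mulr0.
Qed.

(* The antiderivation property of interior products, taken as a definition;
   [wedgeE] identifies this with [wedge] on exterior forms. *)
Fixpoint rwedge a b s : R[i] :=
  if s is v :: s' then
    rwedge (iota_form v a) b s' + rwedge (degree_sign a) (iota_form v b) s'
  else a [::] * b [::].

Lemma iota_rwedge v a b :
  iota_form v (rwedge a b) =
  rwedge (iota_form v a) b + rwedge (degree_sign a) (iota_form v b).
Proof. by []. Qed.

Lemma rwedge_is_linear a : linear (rwedge a).
Proof.
move=> k b c; apply/funext => s /=; rewrite -[RHS]/(k * rwedge a b s + rwedge a c s).
elim: s a b c => [|v s IH] a b c /=.
  by rewrite form_addE form_scaleE mulrDr mulrCA.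
by rewrite linearP !IH mulrDr addrACA.
Qed.

HB.instance Definition _ a :=
  GRing.isLinear.Build R[i] (cform R m) (cform R m) *:%R (rwedge a)
    (rwedge_is_linear a).

Lemma rwedge_linearl b : linear (rwedge^~ b).
Proof.
move=> k a c; apply/funext => s; rewrite -[RHS]/(k * rwedge a b s + rwedge c b s).
elim: s a b c => [|v s IH] a b c /=.
  by rewrite form_addE form_scaleE mulrDl mulrA.
by rewrite !linearP !IH mulrDr addrACA.
Qed.

(** Makes the left factor the variable, so that lemmas on linear maps apply to it. *)
Definition rwedge_by b a := rwedge a b.

HB.instance Definition _ b :=
  GRing.isLinear.Build R[i] (cform R m) (cform R m) *:%R (rwedge_by b)
    (rwedge_linearl b).

Lemma rwedgeDl a b c : rwedge (a + b) c = rwedge a c + rwedge b c.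
Proof. exact: (linearD (rwedge_by c)). Qed.

Lemma rwedgeNl a b : rwedge (- a) b = - rwedge a b.
Proof. exact: (linearN (rwedge_by b)). Qed.

Lemma rwedgeZl k a b : rwedge (k *: a) b = k *: rwedge a b.
Proof. exact: (linearZ_LR (rwedge_by b)). Qed.

Lemma rwedge0l b : rwedge 0 b = 0.
Proof. exact: (linear0 (rwedge_by b)). Qed.

Lemma rwedgeDr a b c : rwedge a (b + c) = rwedge a b + rwedge a c.
Proof. exact: linearD. Qed.

Lemma rwedgeNr a b : rwedge a (- b) = - rwedge a b.
Proof. exact: linearN. Qed.

Lemma rwedgeZr k a b : rwedge a (k *: b) = k *: rwedge a b.
Proof. exact: linearZ_LR. Qed.

Lemma rwedge0r a : rwedge a 0 = 0.
Proof. exact: linear0. Qed.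

Lemma degree_sign_rwedge a b :
  degree_sign (rwedge a b) = rwedge (degree_sign a) (degree_sign b).
Proof.
apply/funext => s; rewrite /degree_sign.
elim: s a b => [|v s IH] a b; first by rewrite /= !expr0 !mul1r.
rewrite -[RHS]/((rwedge (iota_form v (degree_sign a)) (degree_sign b)
  + rwedge (degree_sign (degree_sign a)) (iota_form v (degree_sign b))) s).
rewrite !iota_degree_sign rwedgeNl linearN -opprD.
rewrite -[RHS]/(- (rwedge _ _ s + rwedge _ _ s)).
by rewrite /degree_sign -!IH /= exprS -mulrA mulN1r mulrDr.
Qed.

Lemma rwedgeA a b c : rwedge (rwedge a b) c = rwedge a (rwedge b c).
Proof.
apply/funext => s; elim: s a b c => [|v s IH] a b c /=; first by rewrite mulrA.
by rewrite !iota_rwedge rwedgeDl rwedgeDr degree_sign_rwedge !form_addE !IH addrA.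
Qed.

Lemma iota_homogeneous k v a : homogeneous k.+1 a -> homogeneous k (iota_form v a).
Proof. by move=> ha s hs; apply: ha. Qed.

Lemma iota_homogeneous0 v a : homogeneous 0 a -> iota_form v a = 0.
Proof. by move=> ha; apply/funext => s; apply: ha. Qed.

Lemma homogeneousZ k r a : homogeneous k a -> homogeneous k (r *: a).
Proof.
by move=> ha s hs; rewrite -[LHS]/(r * a s) ha ?mulr0.
Qed.

Lemma homogeneousD k a b :
  homogeneous k a -> homogeneous k b -> homogeneous k (a + b).
Proof. by move=> ha hb s hs; rewrite -[LHS]/(a s + b s) ha ?hb ?addr0. Qed.

Lemma homogeneous_zero k : homogeneous k (0 : cform R m).
Proof. by []. Qed.

Lemma homogeneous_sum k (I : Type) (r : seq I) (P : pred I) (F : I -> cform R m) :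
  (forall i, P i -> homogeneous k (F i)) -> homogeneous k (\sum_(i <- r | P i) F i).
Proof. by move=> h; apply: (big_ind (homogeneous k)) => //; apply: homogeneousD. Qed.

Lemma degree_sign_deg k a : homogeneous k a -> homogeneous k (degree_sign a).
Proof. by move=> ha; rewrite (degree_sign_homogeneous ha); apply: homogeneousZ. Qed.

Lemma rwedge_homogeneous k l a b :
  homogeneous k a -> homogeneous l b -> homogeneous (k + l) (rwedge a b).
Proof.
move=> + + s; elim: s k l a b => [|v s IH] k l a b ha hb.
  case: k ha => [|k] ha; last by move=> _ /=; rewrite ha ?mul0r.
  by case: l hb => // l hb _ /=; rewrite hb ?mulr0.
move=> hs /=.
have -> : rwedge (iota_form v a) b s = 0.
  case: k ha hs => [|k] ha hs; first by rewrite iota_homogeneous0 // rwedge0l.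
  by apply: (IH k l) => //; apply: iota_homogeneous.
have -> : rwedge (degree_sign a) (iota_form v b) s = 0; last by rewrite addr0.
case: l hb hs => [|l] hb hs; first by rewrite (iota_homogeneous0 _ hb) linear0.
apply: (IH k l); [exact: degree_sign_deg | exact: iota_homogeneous |].
by move: hs; rewrite addnS.
Qed.

Local Notation one := (@one_form0 R m).

Lemma iota_one v : iota_form v one = 0. Proof. by []. Qed.

Lemma degree_sign_one : degree_sign one = one.
Proof. by apply/funext => -[|x s]; rewrite /degree_sign /one_form0 /= ?mul1r ?mulr0. Qed.

Lemma rwedge1l a : rwedge one a = a.
Proof.
apply/funext => s; elim: s a => [|v s IH] a /=; first by rewrite mul1r.
by rewrite iota_one rwedge0l degree_sign_one IH add0r.
Qed.

Lemma homogeneous_one : homogeneous 0 one.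
Proof. by case. Qed.

Lemma multilinear_cons a :
  (forall r u v, iota_form (r *: u + v) a = r%:C *: iota_form u a + iota_form v a) ->
  (forall v, multilinear (iota_form v a)) -> multilinear a.
Proof.
move=> h hi [|x s] t r u v; last exact: hi.
by have /(congr1 (@^~ t)) := h r u v.
Qed.

Lemma multilinear_iota v a : multilinear a -> multilinear (iota_form v a).
Proof. by move=> ha s t r u w; apply: (ha (v :: s)). Qed.

Lemma iota_linear a r u v : multilinear a ->
  iota_form (r *: u + v) a = r%:C *: iota_form u a + iota_form v a.
Proof. by move=> ha; apply/funext => s; apply: (ha [::]). Qed.

Lemma iota_add a u v : multilinear a ->
  iota_form (u + v) a = iota_form u a + iota_form v a.
Proof. by move=> ha; rewrite -{1}[u]scale1r iota_linear // scale1r. Qed.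

Lemma iota_zero a : multilinear a -> iota_form 0 a = 0.
Proof.
move=> ha; apply: (addrI (iota_form 0 a)).
by rewrite -iota_add // addr0 addr0.
Qed.

Lemma iota_scale a r u : multilinear a ->
  iota_form (r *: u) a = r%:C *: iota_form u a.
Proof. by move=> ha; rewrite -[r *: u]addr0 iota_linear // iota_zero // addr0. Qed.

(** A repetition of neighbours is what a recursion on the list can check; by multilinearity,
    adjacent swaps then bring any two equal arguments together ([exterior_adjacent]). *)
Definition adjacent_alternating a :=
  forall (s t : seq 'rV[R]_m) u, a (s ++ u :: u :: t) = 0.

Lemma adjacent_swap a s t u v : multilinear a -> adjacent_alternating a ->
  a (s ++ u :: v :: t) = - a (s ++ v :: u :: t).
Proof.
move=> ml alt; apply/eqP; rewrite -addr_eq0; apply/eqP.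
have D1 (s' t' : seq 'rV[R]_m) (x y : 'rV[R]_m) :
    a (s' ++ (x + y) :: t') = a (s' ++ x :: t') + a (s' ++ y :: t').
  by rewrite -{1}[x]scale1r ml mul1r.
have := alt s t (u + v); rewrite D1 -[s ++ u :: _]cat_rcons -[s ++ v :: _]cat_rcons.
by rewrite !D1 !cat_rcons !alt add0r addr0.
Qed.

Lemma exterior_adjacent a :
  multilinear a -> adjacent_alternating a -> exterior a.
Proof.
move=> ml alt; split=> // s t w u; elim: t s => [|x t IH] s /=; first exact: alt.
by rewrite adjacent_swap // -cat_rcons IH oppr0.
Qed.

Lemma exterior_multilinear a : exterior a -> multilinear a.
Proof. by case. Qed.

Lemma exterior_alternating a : exterior a -> adjacent_alternating a.
Proof. by move=> [_ h] s t u; apply: (h s [::]). Qed.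

Lemma exterior_iota v a : exterior a -> exterior (iota_form v a).
Proof.
by move=> [ml al]; split; [exact: multilinear_iota | move=> s; apply: (al (v :: s))].
Qed.

Lemma exterior_iota_deg k v a :
  exterior_deg k.+1 a -> exterior_deg k (iota_form v a).
Proof. by case=> ea ha; split; [exact: exterior_iota|exact: iota_homogeneous]. Qed.

Lemma iota_iota a u : exterior a -> iota_form u (iota_form u a) = 0.
Proof. by move=> [_ al]; apply/funext => s; apply: (al [::] [::]). Qed.

Lemma iotaC a u v : exterior a ->
  iota_form u (iota_form v a) = - iota_form v (iota_form u a).
Proof.
move=> ea; apply/funext => s; apply: (@adjacent_swap a [::]).
  exact: exterior_multilinear.
exact: exterior_alternating.
Qed.

Lemma exteriorP a :
  (forall r u v, iota_form (r *: u + v) a = r%:C *: iota_form u a + iota_form v a) ->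
  (forall u, iota_form u (iota_form u a) = 0) ->
  (forall v, exterior (iota_form v a)) -> exterior a.
Proof.
move=> hl h0 hi; apply: exterior_adjacent.
  by apply: multilinear_cons => // v; apply: exterior_multilinear.
move=> [|x s] t u; first by have /(congr1 (@^~ t)) := h0 u.
exact: (exterior_alternating (hi x)).
Qed.

Lemma exterior_zero : exterior (0 : cform R m).
Proof. by split=> // s t r u v; rewrite !mulr0 addr0. Qed.

Lemma exteriorD a b : exterior a -> exterior b -> exterior (a + b).
Proof.
move=> [ma aa] [mb ab]; split=> [s t r u v|s t w u].
  rewrite -[LHS]/(a _ + b _) ma mb -[(a + b) _]/(a _ + b _).
  by rewrite -[(a + b) (s ++ v :: t)]/(a _ + b _) mulrDr addrACA.
by rewrite -[LHS]/(a _ + b _) aa ab addr0.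
Qed.

Lemma exteriorZ k a : exterior a -> exterior (k *: a).
Proof.
move=> [ma aa]; split=> [s t r u v|s t w u].
  rewrite -[LHS]/(k * a _) ma -[(k *: a) _]/(k * a _).
  by rewrite -[(k *: a) (s ++ v :: t)]/(k * a _) mulrDr mulrCA.
by rewrite -[LHS]/(k * a _) aa mulr0.
Qed.

Lemma exteriorN a : exterior a -> exterior (- a).
Proof. by rewrite -scaleN1r; apply: exteriorZ. Qed.

Lemma exterior_sum (I : Type) (r : seq I) (P : pred I) (F : I -> cform R m) :
  (forall i, P i -> exterior (F i)) -> exterior (\sum_(i <- r | P i) F i).
Proof.
by move=> h; apply: (big_ind (@exterior R m)) => //;
  [exact: exterior_zero | exact: exteriorD].
Qed.

Lemma exterior_deg0 k : exterior_deg k (0 : cform R m).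
Proof. by split; [exact: exterior_zero | ]. Qed.

Lemma exterior_degD k a b :
  exterior_deg k a -> exterior_deg k b -> exterior_deg k (a + b).
Proof. by move=> [? ?] [? ?]; split; [exact: exteriorD | exact: homogeneousD]. Qed.

Lemma exterior_degZ k r a : exterior_deg k a -> exterior_deg k (r *: a).
Proof. by move=> [? ?]; split; [exact: exteriorZ | exact: homogeneousZ]. Qed.

Lemma exterior_degN k a : exterior_deg k a -> exterior_deg k (- a).
Proof. by rewrite -scaleN1r; apply: exterior_degZ. Qed.

Lemma exterior_deg_sum k (I : Type) (r : seq I) (P : pred I) (F : I -> cform R m) :
  (forall i, P i -> exterior_deg k (F i)) ->
  exterior_deg k (\sum_(i <- r | P i) F i).
Proof.
move=> h; apply: (big_ind (@exterior_deg R m k)) => //;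
  [exact: exterior_deg0 | exact: exterior_degD].
Qed.

Lemma exterior_degree_sign a : exterior a -> exterior (degree_sign a).
Proof.
move=> [ma aa]; split=> [s t r u v|s t w u]; rewrite /degree_sign.
  by rewrite ma !size_cat /= mulrDr mulrCA.
by rewrite aa mulr0.
Qed.

Lemma exterior_one : exterior one.
Proof.
split=> [s t r u v|s t w u]; rewrite /one_form0 /nilp !size_cat /= !addnS //.
by rewrite mulr0 addr0.
Qed.

Lemma exterior_deg_one : exterior_deg 0 one.
Proof. by split; [exact: exterior_one | exact: homogeneous_one]. Qed.

Lemma exterior_rwedge a b : exterior a -> exterior b -> exterior (rwedge a b).
Proof.
move=> ea eb; apply: exterior_adjacent.
  move=> s; elim: s a b ea eb => [|x s IH] a b ea eb t r u v /=; last first.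
    rewrite !IH; [|exact: exterior_degree_sign|exact: exterior_iota|
      exact: exterior_iota|by []].
    by rewrite mulrDr addrACA.
  rewrite !iota_linear; [|exact: exterior_multilinear..].
  rewrite rwedgeDl rwedgeZl rwedgeDr rwedgeZr !form_addE !form_scaleE.
  by rewrite mulrDr addrACA.
move=> s; elim: s a b ea eb => [|x s IH] a b ea eb t u.
  (* Contracting twice with u leaves two mixed terms; they are opposite because [iota_form]
     anticommutes with [degree_sign]. *)
  rewrite -[LHS]/((rwedge (iota_form u (iota_form u a)) b
    + rwedge (degree_sign (iota_form u a)) (iota_form u b)
    + (rwedge (iota_form u (degree_sign a)) (iota_form u b)
    + rwedge (degree_sign (degree_sign a)) (iota_form u (iota_form u b)))) t).
  by rewrite !iota_iota // rwedge0l rwedge0r iota_degree_sign rwedgeNl add0r addr0 addrN.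
rewrite /= !IH ?addr0 //; try exact: exterior_iota; exact: exterior_degree_sign.
Qed.

Lemma exterior_deg_rwedge k l a b :
  exterior_deg k a -> exterior_deg l b -> exterior_deg (k + l) (rwedge a b).
Proof.
by move=> [? ?] [? ?]; split; [exact: exterior_rwedge | exact: rwedge_homogeneous].
Qed.

End RecursiveWedge.

(** * Agreement of the permutation formula for the wedge product with the antiderivation rule *)

Section WedgeRecursion.
Context {R : realType} {m : nat}.
Implicit Types (a b : cform R m) (s t : seq 'rV[R]_m) (u v : 'rV[R]_m).

Definition permuted s (sg : 'S_(size s)) : seq 'rV[R]_m :=
  [seq s`_(sg i) | i : 'I_(size s)].

Lemma size_permuted s sg : size (@permuted s sg) = size s.
Proof. by rewrite /permuted size_map size_enum_ord. Qed.

Lemma nth_permuted s sg (i : 'I_(size s)) : (@permuted s sg)`_i = s`_(sg i).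
Proof. by rewrite /permuted (nth_map i) ?nth_ord_enum // size_enum_ord. Qed.

Lemma permuted_lift v s (j : 'I_(size s).+1) (tau : 'S_(size s)) :
  @permuted (v :: s) (lift_perm j ord0 tau) =
  take j (permuted tau) ++ v :: drop j (permuted tau).
Proof.
have jle : (j <= size (permuted tau))%N by rewrite size_permuted -ltnS.
apply: (@eq_from_nth _ 0).
  rewrite size_permuted size_cat /= size_takel // size_drop addnS subnKC //.
  by rewrite size_permuted.
rewrite size_permuted => i ilt.
rewrite -[X in _`_X = _]/(val (Ordinal ilt)) (@nth_permuted (v :: s)).
rewrite nth_cat size_takel //.
have: val (Ordinal ilt) = i by [].
case: (unliftP j (Ordinal ilt)) => [i' ->|->] <-; last first.
  by rewrite lift_perm_id ltnn subnn.
rewrite lift_perm_lift /=.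
have [ji|ij] := leqP j i'.
  rewrite /bump ji ltnNge (leq_trans ji) ?leq_addl //= add1n subSn //= nth_drop.
  by rewrite subnKC // nth_permuted.
by rewrite /bump (leqNgt j i') ij !add0n ij nth_take // nth_permuted.
Qed.

Lemma exterior_insert a t v j : exterior a -> (j <= size t)%N ->
  a (take j t ++ v :: drop j t) = (-1) ^+ j * a (v :: t).
Proof.
move=> ea; elim: j t => [|j IH] [|x t] //=; rewrite ?take0 ?mul1r // ltnS => jt.
rewrite -[a _]/(iota_form x a (take j t ++ v :: drop j t)).
elim: j a x t ea jt {IH} => [|j IH] a x t ea jt.
  rewrite take0 drop0 -[LHS]/(iota_form v (iota_form x a) t) iotaC //.
  by rewrite expr1 mulN1r.
case: t jt => [|y t] //; rewrite ltnS => jt.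
rewrite -[LHS]/(iota_form y (iota_form x a) (take j t ++ v :: drop j t)).
rewrite IH //; last exact: exterior_iota.
rewrite -[iota_form x a _]/(iota_form v (iota_form x a) (y :: t)) iotaC //.
by rewrite form_oppE mulrN [in RHS]exprS mulN1r mulNr.
Qed.

Lemma sum_lift_perm (V : nmodType) n (F : 'S_n.+1 -> V) :
  \sum_sg F sg = \sum_(j < n.+1) \sum_(tau : 'S_n) F (lift_perm j ord0 tau).
Proof.
rewrite (partition_big (fun sg : 'S_n.+1 => (sg^-1)%g ord0) predT) //=.
apply: eq_bigr => j _.
rewrite (reindex (lift_perm j ord0)); last first.
  (* [ulsf i sg] is what remains of sg after deleting the index i and its image; it inverts
     [lift_perm]. *)
  pose ulsf i (sg : 'S_n.+1) k := odflt k (unlift (sg i) (sg (lift i k))).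
  have ulsfK i (sg : 'S_n.+1) k : lift (sg i) (ulsf i sg k) = sg (lift i k).
    rewrite /ulsf; have := neq_lift i k.
    by rewrite -(can_eq (permK sg)) => /unlift_some[] j' -> ->.
  have inj_ulsf : injective (ulsf j _).
    move=> sg; apply: can_inj (ulsf (sg j) sg^-1%g) _ => k'.
    by rewrite {1}/ulsf ulsfK !permK liftK.
  exists (fun sg => perm (inj_ulsf sg)) => [sg _ | sg].
    by apply/perm.permP=> k'; rewrite permE /ulsf lift_perm_lift lift_perm_id liftK.
  move/eqP => ej; apply/perm.permP => k'; have [k ->|->] := unliftP j k'.
    have sj : sg j = ord0 by rewrite -ej permKV.
    by rewrite lift_perm_lift permE -[in LHS]sj ulsfK.
  by rewrite lift_perm_id -ej permKV.
by apply: eq_bigl => tau; rewrite lift_permV lift_perm_id eqxx.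
Qed.

Lemma take_insert t v j k : (j <= size t)%N ->
  take k (take j t ++ v :: drop j t) =
  if (j < k)%N then take j (take k.-1 t) ++ v :: drop j (take k.-1 t) else take k t.
Proof.
move=> jt; rewrite take_cat size_takel //; case: ltngtP => [kj|jk|->].
- by rewrite take_takel // ltnW.
- case: k jk => // k; rewrite ltnS => jk.
  by rewrite subSn //= take_takel // take_drop subnK.
- by rewrite subnn cats0.
Qed.

Lemma drop_insert t v j k : (j <= size t)%N ->
  drop k (take j t ++ v :: drop j t) =
  if (j < k)%N then drop k.-1 t
  else take (j - k) (drop k t) ++ v :: drop (j - k) (drop k t).
Proof.
move=> jt; rewrite drop_cat size_takel //; case: ltngtP => [kj|jk|->].
- by rewrite take_drop drop_drop subnK // ltnW.
- case: k jk => // k; rewrite ltnS => jk.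
  by rewrite subSn //= drop_drop subnK.
- by rewrite !subnn take0 !drop0.
Qed.

Lemma sum_threshold (V : nmodType) (x y : V) N k : (k <= N)%N ->
  \sum_(j < N) (if (j < k)%N then x else y) = x *+ k + y *+ (N - k).
Proof.
move=> kN; rewrite -(big_mkord predT (fun j => if (j < k)%N then x else y)).
rewrite (@big_cat_nat _ _ _ k) //=; congr (_ + _).
  rewrite -[in RHS](subn0 k) -sumr_const_nat !big_nat.
  by apply: eq_bigr => i /andP[_ ->].
rewrite -sumr_const_nat !big_nat.
by apply: eq_bigr => i /andP[ki _]; rewrite ltnNge ki.
Qed.

(** Signs are kept as variables for [ring]; the hypothesis has the shape that [signrMK] provides. *)
Lemma sign_cancel_left (e f x y : R[i]) : f * (f * 1) = 1 -> f * e * (f * x) * y = e * x * y.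
Proof. by rewrite mulr1 => ff; ring: ff. Qed.

Lemma sign_cancel_right (e f g x y : R[i]) :
  f * (f * 1) = 1 -> g * f * e * x * (f * y) = e * (g * x) * y.
Proof. by rewrite mulr1 => ff; ring: ff. Qed.

(* The permutations of [v :: s] that put [v] at position [j] are those of the
   form [lift_perm j ord0 tau]; moving [v] to the front of the factor in which it
   falls cancels their sign up to the degree sign of [a]. *)
Lemma wedge_cons a b v s : exterior a -> exterior b ->
  wedge a b (v :: s) =
  wedge (iota_form v a) b s + wedge (degree_sign a) (iota_form v b) s.
Proof.
move=> ea eb; set N := size s.
pose coef k l : R[i] := ((k`! * l`!)%:R)^-1.
pose A k : R[i] := \sum_(tau : 'S_N) (-1) ^+ tau *
  a (v :: take k (permuted tau)) * b (drop k (permuted tau)).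
pose B k : R[i] := \sum_(tau : 'S_N) (-1) ^+ tau *
  ((-1) ^+ k * a (take k (permuted tau))) * b (v :: drop k (permuted tau)).
have -> : wedge (iota_form v a) b s = \sum_(k < N.+1) coef k (N - k)%N * A k by [].
have -> : wedge (degree_sign a) (iota_form v b) s =
    \sum_(k < N.+1) coef k (N - k)%N * B k.
  apply: eq_bigr => k _; congr (_ * _); apply: eq_bigr => tau _.
  by rewrite /degree_sign size_takel // size_permuted -ltnS.
have -> : wedge a b (v :: s) = \sum_(k < N.+2) coef k (N.+1 - k)%N *
    (A k.-1 *+ k + B k *+ (N.+1 - k)%N).
  apply: eq_bigr => k _; congr (_ * _); rewrite sum_lift_perm.
  (* v falls into the first factor for the k positions j < k, and into the second one for the other
     N + 1 - k. *)
  transitivity (\sum_(j < N.+1) if (j < k)%N then A k.-1 else B k); last first.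
    by apply: sum_threshold; rewrite -ltnS.
  apply: eq_bigr => j _.
  transitivity (\sum_(tau : 'S_N) (-1) ^+ lift_perm j ord0 tau *
     a (take k (take j (permuted tau) ++ v :: drop j (permuted tau))) *
     b (drop k (take j (permuted tau) ++ v :: drop j (permuted tau)))).
    by apply: eq_bigr => tau _; rewrite -permuted_lift.
  have jle (tau : 'S_N) : (j <= size (permuted tau))%N.
    by rewrite size_permuted -ltnS.
  have sgE (tau : 'S_N) : (-1) ^+ lift_perm j ord0 tau = (-1) ^+ j * (-1) ^+ tau :> R[i].
    by rewrite odd_lift_perm addbF signr_addb signr_odd.
  case: ltnP => jk; apply: eq_bigr => tau _; rewrite take_insert // drop_insert // sgE.
    rewrite jk exterior_insert //; last first.
      rewrite size_take size_permuted; case: ltnP => // _; last by rewrite -ltnS.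
      by case: (k : nat) jk.
    exact: sign_cancel_left (signrMK j 1).
  rewrite ltnNge jk /= exterior_insert //; last first.
    by rewrite size_drop size_permuted leq_sub2r // -ltnS.
  move: (a _) (b _) => x y; rewrite -{1}(subnKC jk) exprD.
  exact: sign_cancel_right (signrMK (j - k) 1).
rewrite -big_split /=.
transitivity (\sum_(k < N.+2) (coef k (N.+1 - k)%N * (A k.-1 *+ k)
   + coef k (N.+1 - k)%N * (B k *+ (N.+1 - k)))).
  by apply: eq_bigr => k _; rewrite mulrDr.
(* The number of positions for v in a factor of degree k turns 1 / k! into 1 / (k - 1)!, which is
   the normalisation one degree lower; the term with no position for v drops out. *)
rewrite !big_split /=; congr (_ + _).
  rewrite big_ord_recl mulr0n mulr0 add0r; apply: eq_bigr => k _.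
  rewrite lift0 subSS /= -mulr_natl mulrA /coef factS; congr (_ * _).
  rewrite -mulnA natrM invfM mulrAC mulVf ?mul1r // pnatr_eq0 //.
rewrite big_ord_recr /= subnn mulr0n mulr0 addr0; apply: eq_bigr => k _.
have kN : (k <= N)%N by rewrite -ltnS.
rewrite subSn // -mulr_natl mulrA /coef factS; congr (_ * _).
by rewrite mulnCA natrM invfM mulrAC mulVf ?mul1r // pnatr_eq0.
Qed.

Lemma wedgeE a b : exterior a -> exterior b -> wedge a b = rwedge a b.
Proof.
move=> ea eb; apply/funext => s; elim: s a b ea eb => [|v s IH] a b ea eb.
  rewrite /wedge big_ord1 (big_pred1 1%g) => [|sg]; last first.
    by apply/esym/eqP/perm.permP => -[].
  have nilE (t : seq 'rV[R]_m) : size t = 0%N -> a (take 0 t) * b (drop 0 t) = a [::] * b [::].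
    by case: t.
  rewrite /= -mulrA nilE; last exact: (@size_permuted [::] 1%g).
  by rewrite odd_perm1 mul1n invr1 !mul1r.
rewrite wedge_cons //= !IH //; try exact: exterior_iota.
exact: exterior_degree_sign.
Qed.

End WedgeRecursion.

(** * Bidegree *)

Section Bidegree.
Context {R : realType} {m : nat} (J : 'M[R]_m).
Hypothesis JJ : J *m J = - 1%:M.
Implicit Types (a b : cform R m) (u v x : 'rV[R]_m) (z : 'rV[R[i]]_m).

Lemma cext_linear (k : R[i]) a b s : cext (k *: a + b) s = k * cext a s + cext b s.
Proof.
elim: s a b => [//|z s IH] a b /=.
rewrite -[fun t => (k *: a + b) (map_mx (@complex.Re R) z :: t)]/
  (k *: (fun t => a (map_mx (@complex.Re R) z :: t)) +
  (fun t => b (map_mx (@complex.Re R) z :: t))).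
rewrite -[fun t => (k *: a + b) (map_mx (@complex.Im R) z :: t)]/
  (k *: (fun t => a (map_mx (@complex.Im R) z :: t)) +
  (fun t => b (map_mx (@complex.Im R) z :: t))).
by rewrite !IH; ring.
Qed.

(** Interior product with a complex vector, by which [cext] consumes one argument at a time. *)
Definition ciota z a : cform R m :=
  'i%R *: iota_form (map_mx (@complex.Im R) z) a + iota_form (map_mx (@complex.Re R) z) a.

Lemma cext_cons z s a : cext a (z :: s) = cext (ciota z a) s.
Proof. by rewrite /ciota cext_linear addrC. Qed.

Lemma cextN a s : cext (- a) s = - cext a s.
Proof.
have := cext_linear (-1) a 0 s; rewrite scaleN1r addr0 => ->.
have -> : cext (0 : cform R m) s = 0; last by rewrite addr0 mulN1r.
by elim: s => //= z s; rewrite -[fun t => _]/(0 : cform R m) => ->; rewrite mulr0 addr0.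
Qed.

Lemma ciotaC z z' a : exterior a -> ciota z (ciota z' a) = - ciota z' (ciota z a).
Proof.
move=> ea; rewrite /ciota !iota_formD !iota_formZ.
set x := map_mx _ z; set y := map_mx _ z; set x' := map_mx _ z'; set y' := map_mx _ z'.
rewrite (iotaC x x') // (iotaC x y') // (iotaC y x') // (iotaC y y') //.
rewrite !scalerDr !scalerN !opprD !addrA.
by congr (_ + _); rewrite addrAC.
Qed.

Lemma exterior_ciota z a : exterior a -> exterior (ciota z a).
Proof. by move=> ea; apply: exteriorD; [apply: exteriorZ|]; apply: exterior_iota. Qed.

Lemma cext_move z s t a : exterior a ->
  cext a (z :: s ++ t) = (-1) ^+ size s * cext a (s ++ z :: t).
Proof.
elim: s a => [|y s IH] a ea; first by rewrite mul1r.
rewrite !cext_cons ciotaC // cextN -cext_cons -cat_cons.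
rewrite -[cext _ _]/(cext (ciota y a) (z :: s ++ t)).
rewrite IH; last exact: exterior_ciota.
by rewrite [size _]/= exprS mulN1r mulNr.
Qed.

(** On exterior forms, the interior product with [type_proj J c v] ([ciota_type_proj]), written with
    real vectors only. *)
Definition iota_type (c : bool) v a : cform R m :=
  2^-1 *: (iota_form v a - (if c then 'i%R else - 'i%R) *: iota_form (v *m J) a).

Lemma ciota_type_proj c v a : exterior a -> ciota (type_proj J c v) a = iota_type c v a.
Proof.
move=> ea; have ml := exterior_multilinear ea.
have half : (2^-1 : R[i]) = (2^-1)%:C by rewrite fmorphV rmorphMn.
have Re2 : map_mx (@complex.Re R) (type_proj J c v) = 2^-1 *: v.
  apply/rowP => i; rewrite /type_proj half; move: (v *m J) => w; rewrite !mxE.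
  by case: c => /=; ring.
have Im2 : map_mx (@complex.Im R) (type_proj J c v) = (if c then - 2^-1 else 2^-1) *: (v *m J).
  apply/rowP => i; rewrite /type_proj half; move: (v *m J) => w; rewrite !mxE.
  by case: c {Re2} => /=; ring.
rewrite /ciota Re2 Im2 !iota_scale // /iota_type scalerBr addrC half; congr (_ + _).
rewrite !scalerA -scaleNr; congr (_ *: _).
case: c {Re2 Im2}; first by rewrite rmorphN mulrN mulrC.
by rewrite mulrN opprK mulrC.
Qed.

Lemma type_proj_T c v : if c then T10 J (type_proj J c v) else T01 J (type_proj J c v).
Proof.
have i2 : 'i%R * 'i%R = -1 :> R[i] by rewrite -expr2 sqrCi.
have h (e : R[i]) : e * e = -1 ->
    (map_mx (real_complex R) v - e *: map_mx (real_complex R) (v *m J)) *m map_mx (real_complex R) J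
    = e *: (map_mx (real_complex R) v - e *: map_mx (real_complex R) (v *m J)).
  move=> ee; rewrite mulmxBl -scalemxAl -!map_mxM -mulmxA JJ mulmxN mulmx1 map_mxN.
  by rewrite scalerN opprK scalerBr scalerA ee scaleN1r opprK addrC.
have hh (e : R[i]) : e * e = -1 ->
    (2^-1 *: (map_mx (real_complex R) v - e *: map_mx (real_complex R) (v *m J)))
      *m map_mx (real_complex R) J
    = e *: (2^-1 *: (map_mx (real_complex R) v - e *: map_mx (real_complex R) (v *m J))).
  by move=> ee; rewrite -scalemxAl h // !scalerA mulrC.
by case: c; [exact: hh | apply: hh; rewrite mulrNN].
Qed.

Lemma iota_type_linear c v (k : R[i]) a b :
  iota_type c v (k *: a + b) = k *: iota_type c v a + iota_type c v b.
Proof.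
rewrite /iota_type !iota_formD !iota_formZ scalerA (mulrC k) -scalerA -scalerDr.
congr (_ *: _); rewrite scalerDr opprD scalerBr !scalerA (mulrC k) addrACA //.
Qed.

Lemma iota_type_sum v a : iota_form v a = iota_type true v a + iota_type false v a.
Proof.
rewrite /iota_type -scalerDr scaleNr opprK addrACA addNr addr0 -mulr2n -(scaler_nat 2 (iota_form v a)).
by rewrite scalerA mulVf ?scale1r // pnatr_eq0.
Qed.

Lemma iota_typeJ c v a : exterior a ->
  iota_type c (v *m J) a = (if c then 'i%R else - 'i%R) *: iota_type c v a.
Proof.
move=> ea; have ml := exterior_multilinear ea.
rewrite /iota_type -mulmxA JJ mulmxN mulmx1 -(scaleN1r v) iota_scale // rmorphN1 scaleN1r.
rewrite !scalerA (mulrC _ 2^-1) -scalerA; congr (_ *: _).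
have h : (if c then 'i%R else - 'i%R) ^+ 2 = -1 :> R[i].
  by case: c; rewrite ?sqrrN sqrCi.
by rewrite scalerBr scalerA -expr2 h scaleN1r scalerN !opprK addrC.
Qed.

Lemma exterior_iota_type c v a : exterior a -> exterior (iota_type c v a).
Proof.
move=> ea; apply/exteriorZ/exteriorD; first exact: exterior_iota.
exact/exteriorN/exteriorZ/exterior_iota.
Qed.

(** Splitting every real argument into its two types leaves lists of mixed types, which [cext_move]
    sorts at the cost of a sign. *)
Lemma cext_zero a : exterior a ->
  (forall s t, (forall z, z \in s -> T10 J z) -> (forall z, z \in t -> T01 J z) ->
     cext a (s ++ t) = 0) ->
  a = 0.
Proof.
move=> ea h; apply/funext => w; rewrite form_zeroE.
elim: w a ea h => [|v w IH] a ea h; first exact: (h [::] [::]).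
rewrite -[a _]/(iota_form v a w) iota_type_sum form_addE.
rewrite !IH ?addr0 //; try exact: exterior_iota_type.
  move=> s t hs ht; rewrite -ciota_type_proj // -cext_cons -cat_cons.
  rewrite cat_cons cext_move // h ?mulr0 // => z.
  by rewrite inE => /orP[/eqP->|/ht//]; apply: (type_proj_T false).
move=> s t hs ht; rewrite -ciota_type_proj // -cext_cons -cat_cons; apply: h => // z.
by rewrite inE => /orP[/eqP->|/hs//]; apply: (type_proj_T true).
Qed.

(** The condition that vectors of type (1, 0) annihilate [a]. It replaces [pure_form] for bidegree
    (0, q): it mentions no degree and passes to interior products of exterior forms. *)
Definition antiholomorphic a := forall u, iota_form (u *m J) a = - 'i%R *: iota_form u a.

Lemma pure_form_anti q a : pure_form J 0 q a -> exterior_deg q a /\ antiholomorphic a.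
Proof.
rewrite /pure_form add0n => -[ea h]; split=> // u.
have ee : exterior a by case: ea.
have : iota_type true u a = 0.
  apply: cext_zero => [|s t hs ht]; first exact: exterior_iota_type.
  rewrite -ciota_type_proj // -cext_cons -cat_cons; apply: h => // z.
  by rewrite inE => /orP[/eqP->|/hs//]; apply: (type_proj_T true).
move/eqP; rewrite scaler_eq0 invr_eq0 pnatr_eq0 /= subr_eq0 => /eqP ->.
by rewrite scalerA mulNr -expr2 sqrCi opprK scale1r.
Qed.

(** Recursive form of [bidegree_part] ([bidegree_partE]): the head argument uses up one unit of p or
    of q, according to the type it is projected to. *)
Fixpoint bipart (p q : nat) a s : R[i] :=
  if s is v :: s' then
    (if p is p'.+1 then bipart p' q (iota_type true v a) s' else 0) +
    (if q is q'.+1 then bipart p q' (iota_type false v a) s' else 0)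
  else (if (p, q) == (0, 0)%N then a [::] else 0).

(** A set of positions in a list with one more head: the boolean tells whether the head is
    selected. *)
Definition set_cons k (p : bool * {set 'I_k}) : {set 'I_k.+1} :=
  [set l | oapp (fun l' => l' \in p.2) p.1 (unlift ord0 l)].

Lemma mem_set_cons0 k (p : bool * {set 'I_k}) : (ord0 \in set_cons p) = p.1.
Proof. by rewrite inE unlift_none. Qed.

Lemma mem_set_consS k (p : bool * {set 'I_k}) l : (lift ord0 l \in set_cons p) = (l \in p.2).
Proof. by rewrite inE liftK. Qed.

Lemma card_set_cons k (p : bool * {set 'I_k}) : #|set_cons p| = (p.1 + #|p.2|)%N.
Proof.
rewrite -!sum1_card big_mkcond big_ord_recl mem_set_cons0 [in RHS]big_mkcond /=.
congr (_ + _)%N.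
by apply: eq_bigr => l _; rewrite mem_set_consS.
Qed.

Lemma sum_set_cons k (V : nmodType) (P : pred {set 'I_k.+1}) (F : {set 'I_k.+1} -> V) :
  \sum_(B | P B) F B =
  \sum_(B | P (set_cons (true, B))) F (set_cons (true, B)) +
  \sum_(B | P (set_cons (false, B))) F (set_cons (false, B)).
Proof.
rewrite (reindex (@set_cons k)) /=; last first.
  exists (fun B : {set 'I_k.+1} => (ord0 \in B, [set l : 'I_k | lift ord0 l \in B]%SET)) => [[c B] _|B _].
    by rewrite mem_set_cons0; congr pair; apply/setP => l; rewrite inE mem_set_consS.
  apply/setP => l; have [l'|] := unliftP ord0 l => ->.
    by rewrite mem_set_consS inE.
  by rewrite mem_set_cons0.
rewrite big_mkcond /= -(pair_bigA _ (fun c B => if P (set_cons (c, B)) then F (set_cons (c, B)) else 0)).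
by rewrite big_bool /= -!big_mkcond.
Qed.

Lemma bidegree_part_cons p q a v s : exterior a ->
  bidegree_part J p q a (v :: s) =
  (if p is p'.+1 then bidegree_part J p' q (iota_type true v a) s else 0) +
  (if q is q'.+1 then bidegree_part J p q' (iota_type false v a) s else 0).
Proof.
move=> ea; rewrite /bidegree_part.
have mapE c (B : {set 'I_(size s)}) :
    [seq type_proj J (i \in set_cons (c, B)) (v :: s)`_i | i : 'I_(size s).+1] =
    type_proj J c v :: [seq type_proj J (i \in B) s`_i | i : 'I_(size s)].
  rewrite /image_mem !enumT /= -!enumT enum_ordSl /= mem_set_cons0; congr cons.
  by rewrite -map_comp; apply: eq_map => l /=; rewrite mem_set_consS.
have cE c B : cext a [seq type_proj J (i \in set_cons (c, B)) (v :: s)`_i | i : 'I_(size s).+1]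
  = cext (iota_type c v a) [seq type_proj J (i \in B) s`_i | i : 'I_(size s)].
  by rewrite mapE cext_cons ciota_type_proj.
case: eqVneq => [sE|sN]; last first.
  rewrite /= in sN.
  case: p sN => [|p] sN; case: q sN => [|q] sN; rewrite ?ifN ?addr0 //;
    apply/eqP; move/eqP: sN; lia.
rewrite sum_set_cons; congr (_ + _).
  under eq_bigl => B do rewrite card_set_cons /= add1n.
  under eq_bigr => B _ do rewrite cE.
  case: p sE => [|p] sE; first by rewrite big_pred0.
  rewrite ifT; last by move/eqP: sE; rewrite addSn eqSS.
  by apply: eq_bigl => B; rewrite eqSS.
under eq_bigl => B do rewrite card_set_cons /= add0n.
under eq_bigr => B _ do rewrite cE.
case: q sE => [|q] sE.
  (* With q = 0 the set would need p = (size s).+1 elements among the [size s] remaining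
     positions. *)
  rewrite big_pred0 // => B; apply/negbTE; rewrite neq_ltn; apply/orP; left.
  rewrite -[p]addn0 -sE /= ltnS -[X in (_ <= X)%N]card_ord; exact: max_card.
by rewrite ifT //; move/eqP: sE; rewrite addnS eqSS.
Qed.

Lemma bidegree_partE p q a : exterior a -> bidegree_part J p q a = bipart p q a.
Proof.
move=> ea; apply/funext => s; elim: s p q a ea => [|v s IH] p q a ea.
  rewrite /bidegree_part /= eq_sym addn_eq0 xpair_eqE; case: eqVneq => //= ->.
  case: eqVneq => // _; rewrite (big_pred1 finset.set0) => [|B].
    by rewrite (size0nil (_ : size [seq _ | i : 'I_0] = 0%N)) // size_map size_enum_ord.
  by rewrite cards_eq0.
rewrite bidegree_part_cons //=.
by case: p => [|p]; case: q => [|q]; rewrite ?IH //; apply: exterior_iota_type.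
Qed.

End Bidegree.

(** * Bidegree components under interior products and products with 1-forms *)

Section BidegreeParts.
Context {R : realType} {m : nat} (J : 'M[R]_m).
Hypothesis JJ : J *m J = - 1%:M.
Implicit Types (a b : cform R m) (u v x : 'rV[R]_m).

Local Notation iota10 := (iota_type J true).
Local Notation iota01 := (iota_type J false).
Local Notation bipart := (bipart J).

Lemma bipart_is_linear p q : linear (bipart p q).
Proof.
move=> k a b; apply/funext => s; rewrite form_addE form_scaleE.
elim: s p q a b => [|v s IH] p q a b /=.
  by case: ifP; rewrite ?mulr0 ?addr0.
case: p => [|p]; case: q => [|q]; rewrite ?iota_type_linear ?IH; ring.
Qed.

HB.instance Definition _ p q :=
  GRing.isLinear.Build R[i] (cform R m) (cform R m) *:%R (bipart p q)
    (bipart_is_linear p q).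

Lemma bipartD p q a b : bipart p q (a + b) = bipart p q a + bipart p q b.
Proof. exact: linearD. Qed.

Lemma bipartN p q a : bipart p q (- a) = - bipart p q a.
Proof. exact: linearN. Qed.

Lemma bipartZ p q (k : R[i]) a : bipart p q (k *: a) = k *: bipart p q a.
Proof. exact: linearZ. Qed.

Lemma iota_bipart v p q a : iota_form v (bipart p q a) =
  (if p is p'.+1 then bipart p' q (iota10 v a) else 0) +
  (if q is q'.+1 then bipart p q' (iota01 v a) else 0).
Proof. by apply/funext => s; rewrite form_addE; case: p; case: q. Qed.

Lemma homogeneous_bipart p q a : homogeneous (p + q) (bipart p q a).
Proof.
move=> s; elim: s p q a => [|v s IH] p q a /=; first by case: p; case: q.
case: p => [|p]; case: q => [|q]; rewrite ?addSn ?addnS ?eqSS ?addr0 ?add0r // => h.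
- by rewrite IH.
- by rewrite IH.
- by rewrite !IH ?addr0 // ?addSn ?addnS.
Qed.

Lemma vlinear_iota_type c a r u v : exterior a ->
  iota_type J c (r *: u + v) a = r%:C *: iota_type J c u a + iota_type J c v a.
Proof.
move=> [ml _]; rewrite /iota_type mulmxDl -scalemxAl !iota_linear //.
by apply/funext => t'; rewrite !(form_addE, form_oppE, form_scaleE, form_zeroE); ring.
Qed.

Lemma iota_typeC c c' u v a : exterior a ->
  iota_type J c u (iota_type J c' v a) = - iota_type J c' v (iota_type J c u a).
Proof.
move=> ea; rewrite /iota_type !(iota_formZ, iota_formD, iota_formN).
rewrite (iotaC u v) // (iotaC u (v *m J)) // (iotaC (u *m J) v) // (iotaC (u *m J) (v *m J)) //.
move: (iota_form _ _) (iota_form _ (iota_form (u *m J) a)) (iota_form (v *m J) (iota_form u a))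
  (iota_form (v *m J) (iota_form (u *m J) a)) => x y z t.
apply/funext => s; rewrite !(form_addE, form_oppE, form_scaleE); ring.
Qed.

Lemma iota_type_iota_type c u a : exterior a -> iota_type J c u (iota_type J c u a) = 0.
Proof.
move=> ea; move/eqP: (iota_typeC c c u u ea).
by rewrite -addr_eq0 -mulr2n -(scaler_nat 2 (iota_type J c u _)) scaler_eq0 pnatr_eq0 /= => /eqP.
Qed.

Lemma exterior_bipart p q a : exterior a -> exterior (bipart p q a).
Proof.
move=> ea; apply: exterior_adjacent.
  move=> s; elim: s p q a ea => [|x s IH] p q a ea t r u v.
    rewrite !cat0s -[LHS]/(iota_form (r *: u + v) (bipart p q a) t).
    rewrite -[bipart p q a (u :: t)]/(iota_form u (bipart p q a) t).
    rewrite -[bipart p q a (v :: t)]/(iota_form v (bipart p q a) t) -form_scaleE -form_addE.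
    congr (_ t); rewrite !iota_bipart.
    by case: p => [|p]; case: q => [|q]; rewrite ?vlinear_iota_type // ?bipartD ?bipartZ;
      apply/funext => t'; rewrite !(form_addE, form_oppE, form_scaleE, form_zeroE); ring.
  rewrite /=; case: p => [|p]; case: q => [|q];
    rewrite ?IH //; try exact: exterior_iota_type; ring.
move=> s; elim: s p q a ea => [|x s IH] p q a ea t u; last first.
  by rewrite /=; case: p => [|p]; case: q => [|q];
    rewrite ?IH ?addr0 //; exact: exterior_iota_type.
rewrite cat0s -[LHS]/(iota_form u (iota_form u (bipart p q a)) t).
rewrite iota_bipart; case: p => [|p]; case: q => [|q];
  rewrite ?iota_formD ?iota_bipart ?iota_type_iota_type // ?addr0 ?add0r ?linear0 //.
- by case: q => [|q]; rewrite ?iota_type_iota_type ?linear0 // ?addr0 ?add0r.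
- by case: p => [|p]; rewrite ?iota_type_iota_type ?linear0 // ?addr0 ?add0r.
(* The two contractions of mixed type are opposite; those of equal type vanish. *)
rewrite (iota_typeC true false) // bipartN.
case: p => [|p]; case: q => [|q];
  rewrite ?iota_type_iota_type ?linear0 // ?addr0 ?add0r ?addNr ?subrr //.
Qed.

Lemma exterior_deg_bipart p q a : exterior a -> exterior_deg (p + q) (bipart p q a).
Proof. by move=> ea; split; [exact: exterior_bipart | exact: homogeneous_bipart]. Qed.

Lemma bipart0_anti q a : exterior a -> antiholomorphic J (bipart 0 q a).
Proof.
move=> ea u; rewrite !iota_bipart !add0r; case: q => [|q]; first by rewrite scaler0.
by rewrite iota_typeJ // bipartZ.
Qed.

(** What keeps a (1, q)-form from being antiholomorphic is a contraction of type (0, q), with factor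
    i - (-i). Lambda will kill it in [lambda_bipart1_anti]. *)
Lemma iotaJ_bipart1 q a u : exterior a -> iota_form (u *m J) (bipart 1 q a) =
  - 'i%R *: iota_form u (bipart 1 q a) + ('i%R + 'i%R) *: bipart 0 q (iota10 u a).
Proof.
move=> ea; have E c p' q' : bipart p' q' (iota_type J c (u *m J) a) =
    (if c then 'i%R else - 'i%R) *: bipart p' q' (iota_type J c u a).
  by rewrite iota_typeJ // bipartZ.
by rewrite !iota_bipart /=; case: q => [|q]; rewrite !E /=;
  apply/funext => t'; rewrite !(form_addE, form_oppE, form_scaleE, form_zeroE); ring.
Qed.

Lemma anti_iota10 a u : antiholomorphic J a -> iota10 u a = 0.
Proof.
move=> h; rewrite /iota_type h scalerA mulrN -expr2 sqrCi opprK scale1r subrr scaler0 //.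
Qed.

Lemma anti_iota01 a u : antiholomorphic J a -> iota01 u a = iota_form u a.
Proof. by move=> h; rewrite [in RHS](iota_type_sum J) anti_iota10 // add0r. Qed.

Lemma anti_iota_form a x : exterior a -> antiholomorphic J a ->
  antiholomorphic J (iota_form x a).
Proof.
move=> ea h u; rewrite (iotaC _ x) // h iota_formZ -scalerN; congr (_ *: _).
by rewrite iotaC // opprK.
Qed.

Lemma bipart_anti p q k a : exterior_deg k a -> antiholomorphic J a ->
  bipart p q a = if (p, q) == (0, k)%N then a else 0.
Proof.
move=> [ea ha] aa; apply/funext => s; elim: s p q k a ea ha aa => [|v s IH] p q k a ea ha aa.
  rewrite /= !xpair_eqE; case: (eqVneq p 0%N) => //= _.
  have [->|k0] := eqVneq k 0%N; first by case: ifP.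
  rewrite ha; last by rewrite eq_sym.
  by rewrite if_same; case: ifP => // _; rewrite ha // eq_sym.
rewrite /= anti_iota10 // anti_iota01 //.
have -> : (if p is p'.+1 then bipart p' q 0 s else 0) = 0.
  by case: (p) => // p'; rewrite linear0.
rewrite add0r; case: q => [|q].
  case: k ha => [|k] ha; last by rewrite xpair_eqE andbF.
  by case: eqP => // _; rewrite ha.
case: k ha => [|k] ha.
  by rewrite xpair_eqE andbF (iota_homogeneous0 _ ha) linear0.
rewrite (IH _ _ k); first by rewrite !xpair_eqE eqSS; case: ifP.
- exact: exterior_iota.
- exact: iota_homogeneous.
- exact: anti_iota_form.
Qed.

(** All that the antiderivation rule needs to know of a 1-form with values [t]. *)
Definition one_form (t : 'rV[R]_m -> R[i]) (th : cform R m) :=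
  [/\ th [::] = 0, degree_sign th = - th & forall x, iota_form x th = t x *: @one_form0 R m].

Lemma iota_one_form t th b x : one_form t th ->
  iota_form x (rwedge th b) = t x *: b - rwedge th (iota_form x b).
Proof. by case=> _ h1 h2; rewrite iota_rwedge h1 h2 rwedgeZl rwedge1l rwedgeNl. Qed.

Lemma iota_type_one_form c t th b x : one_form t th ->
  iota_type J c x (rwedge th b) =
  (2^-1 * (t x - (if c then 'i%R else - 'i%R) * t (x *m J))) *: b
  - rwedge th (iota_type J c x b).
Proof.
move=> h; rewrite /iota_type !(iota_one_form _ _ h) rwedgeZr rwedgeDr rwedgeNr rwedgeZr.
apply/funext => s; rewrite !(form_addE, form_oppE, form_scaleE); ring.
Qed.

(** A factor of type (0, 1) is invisible to [iota10] and fully contracted by [iota01], so the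
    antiderivation rule reproduces the recursion of [bipart] with q shifted by one. Both claims go
    through one induction, since lowering q = 1 leads to the boundary case. *)
Lemma bipart_01 t th : one_form t th -> (forall x, t (x *m J) = - 'i%R * t x) ->
  forall p q b, bipart p q.+1 (rwedge th b) = rwedge th (bipart p q b)
    /\ bipart p 0 (rwedge th b) = 0.
Proof.
move=> h tJ p q b.
have i2 : 'i%R * 'i%R = -1 :> R[i] by rewrite -expr2 sqrCi.
have e10 x b' : iota10 x (rwedge th b') = - rwedge th (iota10 x b').
  rewrite (iota_type_one_form _ _ _ h) tJ mulNr mulrN opprK mulrA i2 mulN1r subrr.
  by rewrite mulr0 scale0r add0r.
have e01 x b' : iota01 x (rwedge th b') = t x *: b' - rwedge th (iota01 x b').
  rewrite (iota_type_one_form _ _ _ h) tJ; congr (_ *: _ - _).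
  have -> : t x - - 'i%R * (- 'i%R * t x) = t x - 'i%R * 'i%R * t x by ring.
  by rewrite i2; field.
have th0 : th [::] = 0 by case: h.
suff H s : forall p q b, bipart p q.+1 (rwedge th b) s = rwedge th (bipart p q b) s
    /\ bipart p 0 (rwedge th b) s = 0.
  by split; apply/funext => s; case: (H s p q b).
elim: s => [|x s IH] {}p {}q {}b.
  by rewrite /= th0 !mul0r xpair_eqE andbF if_same.
split; last first.
  rewrite /= addr0; case: p => // p; rewrite e10 bipartN form_oppE.
  by rewrite (proj2 (IH p 0%N _)) oppr0.
rewrite -[RHS]/(iota_form x (rwedge th (bipart p q b)) s) (iota_one_form _ _ h) iota_bipart.
rewrite rwedgeDr opprD !form_addE !form_oppE /= e01 bipartD bipartN bipartZ form_addE.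
have -> : (if p is p'.+1 then bipart p' q.+1 (iota10 x (rwedge th b)) s else 0) =
   - rwedge th (if p is p'.+1 then bipart p' q (iota10 x b) else 0) s.
  case: (p) => [|p']; first by rewrite rwedge0r form_zeroE oppr0.
  by rewrite e10 bipartN form_oppE (proj1 (IH _ _ _)).
rewrite addrCA; congr (_ + (_ + _)); rewrite form_oppE; congr (- _).
by case: q => [|q]; rewrite ?(proj1 (IH _ _ _)) // (proj2 (IH _ 0%N _)) rwedge0r.
Qed.

Lemma bipart_10 t th : one_form t th -> (forall x, t (x *m J) = 'i%R * t x) ->
  forall p q b, bipart p.+1 q (rwedge th b) = rwedge th (bipart p q b)
    /\ bipart 0 q (rwedge th b) = 0.
Proof.
move=> h tJ p q b.
have i2 : 'i%R * 'i%R = -1 :> R[i] by rewrite -expr2 sqrCi.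
have e01 x b' : iota01 x (rwedge th b') = - rwedge th (iota01 x b').
  rewrite (iota_type_one_form _ _ _ h) tJ mulNr opprK mulrA i2 mulN1r subrr.
  by rewrite mulr0 scale0r add0r.
have e10 x b' : iota10 x (rwedge th b') = t x *: b' - rwedge th (iota10 x b').
  rewrite (iota_type_one_form _ _ _ h) tJ; congr (_ *: _ - _).
  by rewrite mulrA i2; field.
have th0 : th [::] = 0 by case: h.
suff H s : forall p q b, bipart p.+1 q (rwedge th b) s = rwedge th (bipart p q b) s
    /\ bipart 0 q (rwedge th b) s = 0.
  by split; apply/funext => s; case: (H s p q b).
elim: s => [|x s IH] {}p {}q {}b.
  by rewrite /= th0 !mul0r xpair_eqE /= if_same.
split; last first.
  rewrite /= add0r; case: q => // q; rewrite e01 bipartN form_oppE.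
  by rewrite (proj2 (IH 0%N q _)) oppr0.
rewrite -[RHS]/(iota_form x (rwedge th (bipart p q b)) s) (iota_one_form _ _ h) iota_bipart.
rewrite rwedgeDr opprD !form_addE !form_oppE /= e10 bipartD bipartN bipartZ form_addE.
have -> : (if q is q'.+1 then bipart p.+1 q' (iota01 x (rwedge th b)) s else 0) =
   - rwedge th (if q is q'.+1 then bipart p q' (iota01 x b) else 0) s.
  case: (q) => [|q']; first by rewrite rwedge0r form_zeroE oppr0.
  by rewrite e01 bipartN form_oppE (proj1 (IH _ _ _)).
rewrite -addrA; congr (_ + (_ + _)); rewrite form_oppE; congr (- _).
by case: p => [|p]; rewrite ?(proj1 (IH _ _ _)) // (proj2 (IH 0%N _ _)) rwedge0r.
Qed.

End BidegreeParts.

(** * The metric and the Hodge star *)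

Section MetricTrace.
Context {R : realType} {m : nat} (G : 'M[R]_m).
Hypothesis Gsym : G^T = G.
Hypothesis Gunit : G \in unitmx.
Implicit Types (a b : cform R m) (u v x : 'rV[R]_m).

Definition metric u v : R[i] := ((u *m G *m v^T) 0 0)%:C.

Definition vlinear (F : 'rV[R]_m -> cform R m) :=
  forall r u v, F (r *: u + v) = r%:C *: F u + F v.

Lemma metricC u v : metric u v = metric v u.
Proof.
rewrite /metric -[in LHS](trmxK (u *m G *m v^T)) mxE !trmx_mul trmxK Gsym.
by rewrite mulmxA.
Qed.

Lemma metric_linear_l r u v x :
  metric (r *: u + v) x = r%:C * metric u x + metric v x.
Proof.
rewrite /metric !mulmxDl -!scalemxAl mxE [X in (X + _)%:C]mxE.
by rewrite rmorphD rmorphM.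
Qed.

Lemma metric_linear_r r u v x :
  metric x (r *: u + v) = r%:C * metric x u + metric x v.
Proof. by rewrite metricC metric_linear_l !(metricC x). Qed.

Definition basis_vec (i : 'I_m) : 'rV[R]_m := delta_mx 0 i.

(** Contraction with the inverse metric; it plays the role of a sum over an orthonormal basis. *)
Definition metric_trace (F : 'rV[R]_m -> 'rV[R]_m -> cform R m) : cform R m :=
  \sum_i \sum_j (invmx G i j)%:C *: F (basis_vec i) (basis_vec j).

Lemma eq_metric_trace F1 F2 :
  (forall u v, F1 u v = F2 u v) -> metric_trace F1 = metric_trace F2.
Proof.
by move=> h; apply: eq_bigr => i _; apply: eq_bigr => j _; rewrite h.
Qed.

Lemma metric_trace_op (f : {linear cform R m -> cform R m}) F :
  f (metric_trace F) = metric_trace (fun u v => f (F u v)).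
Proof.
rewrite linear_sum; apply: eq_bigr => i _; rewrite linear_sum.
by apply: eq_bigr => j _; rewrite linearZ.
Qed.

Lemma metric_traceD F1 F2 :
  metric_trace (fun u v => F1 u v + F2 u v) = metric_trace F1 + metric_trace F2.
Proof.
rewrite -big_split; apply: eq_bigr => i _; rewrite -big_split.
by apply: eq_bigr => j _; rewrite scalerDr.
Qed.

Lemma metric_traceZ k F :
  metric_trace (fun u v => k *: F u v) = k *: metric_trace F.
Proof.
rewrite scaler_sumr; apply: eq_bigr => i _; rewrite scaler_sumr.
by apply: eq_bigr => j _; rewrite !scalerA mulrC.
Qed.

Lemma metric_traceN F : metric_trace (fun u v => - F u v) = - metric_trace F.
Proof.
rewrite -scaleN1r -metric_traceZ; apply: eq_metric_trace => u v.
by rewrite scaleN1r.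
Qed.

Lemma metric_traceB F1 F2 :
  metric_trace (fun u v => F1 u v - F2 u v) = metric_trace F1 - metric_trace F2.
Proof. by rewrite metric_traceD metric_traceN. Qed.

Lemma invmx_sym : (invmx G)^T = invmx G.
Proof. by rewrite trmx_inv Gsym. Qed.

Lemma metric_trace_sym F :
  metric_trace (fun u v => F v u) = metric_trace F.
Proof.
rewrite /metric_trace exchange_big; apply: eq_bigr => i _; apply: eq_bigr => j _.
by rewrite -{1}invmx_sym mxE.
Qed.

Lemma vlinearD F u v : vlinear F -> F (u + v) = F u + F v.
Proof. by move=> h; rewrite -{1}[u]scale1r h scale1r. Qed.

Lemma vlinear0 F : vlinear F -> F 0 = 0.
Proof. by move=> h; apply: (addrI (F 0)); rewrite -vlinearD // !addr0. Qed.

Lemma vlinearZ F r u : vlinear F -> F (r *: u) = r%:C *: F u.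
Proof. by move=> h; rewrite -[r *: u]addr0 h vlinear0 // addr0. Qed.

Lemma vlinearN F u : vlinear F -> F (- u) = - F u.
Proof. by move=> h; rewrite -scaleN1r vlinearZ // rmorphN1 scaleN1r. Qed.

Lemma vlinear_expand F x :
  vlinear F -> F x = \sum_j (x 0 j)%:C *: F (basis_vec j).
Proof.
move=> h; rewrite {1}(row_sum_delta x).
rewrite (big_morph F (fun u v => vlinearD u v h) (vlinear0 h)).
by apply: eq_bigr => j _; rewrite vlinearZ.
Qed.

Lemma metric_basis_l i x : metric (basis_vec i) x = ((G *m x^T) i 0)%:C.
Proof. by rewrite /metric -mulmxA -rowE mxE. Qed.

(** Lowering an index and raising it again: \sum g^(ij) g(e_i, x) e_j = x. *)
Lemma metric_trace_repr F x : vlinear F ->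
  metric_trace (fun u v => metric u x *: F v) = F x.
Proof.
move=> h; rewrite [RHS]vlinear_expand // /metric_trace exchange_big /=.
apply: eq_bigr => j _; under eq_bigr => i _ do rewrite scalerA metric_basis_l -rmorphM.
rewrite -scaler_suml -rmorph_sum; congr ((_)%:C *: _).
transitivity ((invmx G *m (G *m x^T)) j 0).
  by rewrite mxE; apply: eq_bigr => i _; rewrite -{1}invmx_sym mxE.
by rewrite mulKmx // mxE.
Qed.

Lemma metric_trace_card a :
  metric_trace (fun u v => metric u v *: a) = m%:R *: a.
Proof.
have -> : m%:R = \sum_(i < m) 1 :> R[i] by rewrite sumr_const card_ord.
rewrite /metric_trace scaler_suml.
apply: eq_bigr => i _; under eq_bigr => j _ do rewrite scalerA metric_basis_l -rmorphM.
rewrite -scaler_suml -rmorph_sum; congr (_ *: _).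
transitivity (((invmx G *m G) i i)%:C : R[i]); last by rewrite mulVmx // mxE eqxx.
congr (_%:C); rewrite mxE; apply: eq_bigr => j _; congr (_ * _).
by rewrite /basis_vec trmx_delta -colE mxE -{1}Gsym mxE.
Qed.

(** An isometry J also preserves the inverse metric, J^T G^-1 J = G^-1; expanding both arguments in
    the basis turns this into invariance of the trace. *)
Lemma metric_trace_congr (J : 'M[R]_m) F :
  J *m G *m J^T = G ->
  (forall u, vlinear (F u)) -> (forall v, vlinear (F^~ v)) ->
  metric_trace (fun u v => F (u *m J) (v *m J)) = metric_trace F.
Proof.
move=> JG Fr Fl.
have JGi : J^T *m invmx G *m J = invmx G.
  have JGJ : J *m (G *m J^T *m invmx G) = 1%:M by rewrite !mulmxA JG mulmxV.
  have /(congr1 (mulmx (invmx G))) := mulmx1C JGJ.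
  by rewrite mulmx1 -!mulmxA mulKmx // !mulmxA.
have rowJ i : basis_vec i *m J = \row_k J i k.
  by apply/rowP => k; rewrite /basis_vec -rowE !mxE.
rewrite {1}/metric_trace.
transitivity (\sum_i \sum_j \sum_k \sum_l
  (invmx G i j * J i k * J j l)%:C *: F (basis_vec k) (basis_vec l)).
  apply: eq_bigr => i _; apply: eq_bigr => j _.
  rewrite (vlinear_expand _ (Fl _)) scaler_sumr; apply: eq_bigr => k _.
  rewrite (vlinear_expand _ (Fr _)) !scaler_sumr; apply: eq_bigr => l _.
  by rewrite !scalerA !rowJ !mxE !rmorphM.
under eq_bigr => i _ do rewrite exchange_big /=.
rewrite exchange_big /=; apply: eq_bigr => k _.
under eq_bigr => i _ do rewrite exchange_big /=.
rewrite exchange_big /=; apply: eq_bigr => l _.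
rewrite -[in RHS]JGi mxE rmorph_sum scaler_suml exchange_big /=.
apply: eq_bigr => j _; rewrite mxE mulr_suml rmorph_sum scaler_suml.
by apply: eq_bigr => i _; rewrite mxE (mulrC (J i k)).
Qed.

Definition flat u : cform R m := fun s => if s is [:: x] then metric x u else 0.

Lemma flat_linear : vlinear flat.
Proof.
move=> r u v; apply/funext => s; rewrite form_addE form_scaleE /flat.
by case: s => [|x [|y s]]; rewrite ?mulr0 ?addr0 // metric_linear_r.
Qed.

Lemma iota_flat x u : iota_form x (flat u) = metric x u *: @one_form0 R m.
Proof.
apply/funext => s; rewrite form_scaleE /iota_form /flat /one_form0.
by case: s => [|y s] /=; rewrite ?mulr1 ?mulr0.
Qed.

Lemma degree_sign_flat u : degree_sign (flat u) = - flat u.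
Proof.
apply/funext => s; rewrite form_oppE /degree_sign /flat.
by case: s => [|x [|y s]] /=; rewrite ?mulr0 ?oppr0 // expr1 mulN1r.
Qed.

Lemma iota_flat_rwedge x u b :
  iota_form x (rwedge (flat u) b) =
  metric x u *: b - rwedge (flat u) (iota_form x b).
Proof.
by rewrite iota_rwedge iota_flat degree_sign_flat rwedgeZl rwedge1l rwedgeNl.
Qed.

Lemma exterior_deg_flat u : exterior_deg 1 (flat u).
Proof.
split; last by move=> [|x [|]].
apply: exteriorP => [r v w|v|v]; rewrite !iota_flat.
- by rewrite metric_linear_l scalerDl scalerA.
- by rewrite linearZ /= iota_one scaler0.
- exact/exteriorZ/exterior_one.
Qed.

Lemma exterior_deg_flat_rwedge k u b :
  exterior_deg k b -> exterior_deg k.+1 (rwedge (flat u) b).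
Proof. by rewrite -add1n; apply: exterior_deg_rwedge; apply: exterior_deg_flat. Qed.

(** Each argument of b is counted once: contracting with x brings out one copy of iota_x b, and the
    induction hypothesis counts the remaining arguments. *)
Lemma number_operator k b : exterior_deg k b ->
  metric_trace (fun u v => rwedge (flat u) (iota_form v b)) = k%:R *: b.
Proof.
move=> [eb hb]; apply/funext => s; rewrite form_scaleE.
have [<-|sk] := eqVneq (size s) k; last first.
  rewrite [b s]hb // mulr0.
  have h : homogeneous k (metric_trace (fun u v => rwedge (flat u) (iota_form v b))).
    apply: homogeneous_sum => i _; apply: homogeneous_sum => j _; apply: homogeneousZ.
    case: k hb {sk} => [|k] hb; first by rewrite (iota_homogeneous0 _ hb) rwedge0r.
    rewrite -add1n; apply: rwedge_homogeneous; last exact: iota_homogeneous.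
    by case: (exterior_deg_flat (basis_vec i)).
  exact: h.
elim: s b eb {k hb} => [|x s IH] b eb.
  rewrite mul0r /metric_trace fct_sumE big1 // => i _; rewrite fct_sumE big1 // => j _.
  by rewrite form_scaleE /= mul0r mulr0.
transitivity (metric_trace (fun u v => metric u x *: iota_form v b) s +
   metric_trace (fun u v => rwedge (flat u) (iota_form v (iota_form x b))) s).
  rewrite -form_addE -metric_traceD -[LHS]/(iota_form x (metric_trace _) s).
  rewrite metric_trace_op; congr (_ s); apply: eq_metric_trace => u v /=.
  by rewrite iota_flat_rwedge metricC iotaC // rwedgeNr opprK.
rewrite (metric_trace_repr x (fun r u v => iota_linear r u v (exterior_multilinear eb))).
by rewrite IH; [rewrite /iota_form -{1}[b _]mul1r -mulrDl -natr1 addrC|exact: exterior_iota].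
Qed.

Lemma co_number_operator k b : exterior_deg k b ->
  metric_trace (fun u v => iota_form v (rwedge (flat u) b)) = (m%:R - k%:R) *: b.
Proof.
move=> eb; rewrite scalerBl -metric_trace_card -(number_operator eb) -metric_traceB.
by apply: eq_metric_trace => u v; rewrite iota_flat_rwedge metricC.
Qed.

(* If [b] is killed by the basis vectors in [X], the remaining ones contribute at
   most [m - #|X|] arguments. *)
Lemma exterior_vanish_above k b : exterior_deg k b -> (m < k)%N -> b = 0.
Proof.
move=> [eb hb] mk; apply/funext => s; rewrite form_zeroE.
have [sk|/hb//] := eqVneq (size s) k; rewrite -sk in mk.
suff: forall X : {set 'I_m}, (forall i, i \in X -> iota_form (basis_vec i) b = 0) ->
  (m - #|X| < size s)%N -> b s = 0.
  by move/(_ finset.set0); apply=> [i|]; rewrite ?inE // cards0 subn0.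
elim: s b eb {hb sk mk} => [|x s IH] b eb X hX // lt.
rewrite -[b _]/(iota_form x b s).
rewrite (vlinear_expand x (fun r u v => iota_linear r u v (exterior_multilinear eb))).
rewrite fct_sumE big1 // => j _; rewrite form_scaleE.
have [jX|jX] := boolP (j \in X); first by rewrite hX // form_zeroE mulr0.
rewrite (IH _ _ (j |: X)) ?mulr0 //; first exact: exterior_iota.
  move=> i; rewrite !inE => /orP[/eqP->|iX]; first exact: iota_iota.
  by rewrite iotaC // hX // !linear0.
have cX : (#|X| < m)%N.
  rewrite -[X in (_ < X)%N]card_ord; apply: proper_card.
  by apply/properP; split; [apply/fintype.subsetP | exists j].
by rewrite cardsU1 jX add1n; move: lt; rewrite /= ltnS subnS -(subnSK cX) /=; apply: leq_trans.
Qed.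

(** The trace in [co_number_operator] is multiplication by m - k, which is nonzero, and it vanishes
    if every product with a 1-form does. *)
Lemma flat_rwedge_inj k b : exterior_deg k b -> (k < m)%N ->
  (forall u, rwedge (flat u) b = 0) -> b = 0.
Proof.
move=> eb km h; have := co_number_operator eb.
have -> : metric_trace (fun u v => iota_form v (rwedge (flat u) b)) = 0.
  rewrite /metric_trace big1 // => i _; rewrite big1 // => j _.
  by rewrite h !linear0.
move/esym/eqP; rewrite scaler_eq0 -natrB ?(ltnW km) // pnatr_eq0 subn_eq0 leqNgt km /=.
by move/eqP.
Qed.

(** Test forms are built one 1-form at a time: products of [flat u] with a k-form test degree k + 1,
    and [flat_rwedge_inj] removes the 1-form. This gives uniqueness of the Hodge star. *)
Lemma rwedge_pairing_nondegenerate k l y : exterior_deg l y -> (k + l <= m)%N ->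
  (forall a, exterior_deg k a -> rwedge a y = 0) -> y = 0.
Proof.
move=> ey; elim: k => [|k IH] kl h.
  by rewrite -[y]rwedge1l; apply/h/exterior_deg_one.
apply: IH => [|a ea]; first exact: ltnW.
apply: (flat_rwedge_inj (exterior_deg_rwedge ea ey)) => [|u]; first by [].
by rewrite -rwedgeA; apply/h/exterior_deg_flat_rwedge.
Qed.

End MetricTrace.

(** * The Hodge star by recursion on the degree *)

Section Star.
Context {R : realType} {m : nat} (G : 'M[R]_m).
Hypothesis Gsym : G^T = G.
Hypothesis Gunit : G \in unitmx.
Implicit Types (a b : cform R m) (u v x : 'rV[R]_m).

Local Notation trace := (metric_trace G).

(** Separates the first entry of a multi-index, to expand [inner] one argument at a time. *)
Definition ffun_cons (T : finType) k (p : T * {ffun 'I_k -> T}) : {ffun 'I_k.+1 -> T} :=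
  [ffun l => oapp p.2 p.1 (unlift ord0 l)].

Lemma ffun_cons0 (T : finType) k (p : T * {ffun 'I_k -> T}) : ffun_cons p ord0 = p.1.
Proof. by rewrite ffunE unlift_none. Qed.

Lemma ffun_consS (T : finType) k (p : T * {ffun 'I_k -> T}) l :
  ffun_cons p (lift ord0 l) = p.2 l.
Proof. by rewrite ffunE liftK. Qed.

Lemma sum_ffunS (T : finType) (V : nmodType) k (F : {ffun 'I_k.+1 -> T} -> V) :
  \sum_I F I = \sum_i \sum_(I : {ffun 'I_k -> T}) F (ffun_cons (i, I)).
Proof.
rewrite pair_big /=.
pose g (I : {ffun 'I_k.+1 -> T}) : T * {ffun 'I_k -> T} :=
  (I ord0, [ffun l => I (lift ord0 l)]).
rewrite (reindex (@ffun_cons T k)) /=; last first.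
  exists g => [[i I] _|I _]; rewrite /g.
    by rewrite ffun_cons0; congr pair; apply/ffunP => l; rewrite ffunE ffun_consS.
  apply/ffunP => l; have [l'|] := unliftP ord0 l => ->.
    by rewrite ffun_consS ffunE.
  by rewrite ffun_cons0.
by apply: eq_bigr => -[].
Qed.

Lemma map_ffun_cons (T : finType) (U : Type) k (f : T -> U) (p : T * {ffun 'I_k -> T}) :
  [seq f (ffun_cons p l) | l : 'I_k.+1] = f p.1 :: [seq f (p.2 l) | l : 'I_k].
Proof.
rewrite /image_mem !enumT /= -!enumT enum_ordSl /= ffun_cons0; congr cons.
by rewrite -map_comp; apply: eq_map => l /=; rewrite ffun_consS.
Qed.

Lemma innerS k a b :
  inner k.+1 G a (conj_form b) = k.+1%:R^-1 *
  \sum_i \sum_j (invmx G i j)%:C *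
    inner k G (iota_form (basis_vec i) a) (conj_form (iota_form (basis_vec j) b)).
Proof.
rewrite /inner factS natrM invfM -mulrA; congr (_ * _).
rewrite sum_ffunS mulr_sumr; apply: eq_bigr => i _.
under eq_bigr => I _ do rewrite sum_ffunS.
rewrite exchange_big /= mulr_sumr; apply: eq_bigr => j _.
rewrite mulrCA; congr (_ * _); rewrite mulr_sumr; apply: eq_bigr => I _.
rewrite mulr_sumr; apply: eq_bigr => K _.
rewrite big_ord_recl !ffun_cons0 rmorphM /=.
under eq_bigr => l _ do rewrite !ffun_consS.
rewrite -!mulrA; do 2 congr (_ * _).
by rewrite !(map_ffun_cons (@basis_vec R m)).
Qed.

(* Since [k b = \sum_ij g^ij e_i^flat /\ iota_(e_j) b], the star of a form is
   determined by the rule [star_flat] and by its value on functions. *)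
Fixpoint star_rec (vol : cform R m) k b : cform R m :=
  if k is k'.+1 then
    ((-1) ^+ k' / k'.+1%:R) *:
      trace (fun u v => iota_form u (star_rec vol k' (iota_form v b)))
  else b [::] *: vol.

(* Sealed, as unification would otherwise unfold it. *)
Fact star_key : unit. Proof. exact: tt. Qed.

Definition star_op (vol : cform R m) := locked_with star_key (star_rec vol).

Variable vol : cform R m.
Hypothesis evol : exterior_deg m vol.

Local Notation star := (star_op vol).

Lemma star0 b : star 0 b = b [::] *: vol.
Proof. by rewrite /star_op unlock. Qed.

Lemma starS k b : star k.+1 b = ((-1) ^+ k / k.+1%:R) *:
  trace (fun u v => iota_form u (star k (iota_form v b))).
Proof. by rewrite /star_op unlock. Qed.

Lemma star_op_is_linear k : linear (star k).
Proof.
elim: k => [|k IH] c a b.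
  by rewrite !star0 form_addE form_scaleE scalerDl scalerA.
rewrite !starS; set t := _ / _.
have -> : trace (fun u v => iota_form u (star k (iota_form v (c *: a + b)))) =
    c *: trace (fun u v => iota_form u (star k (iota_form v a))) +
    trace (fun u v => iota_form u (star k (iota_form v b))).
  rewrite -metric_traceZ -metric_traceD; apply: eq_metric_trace => u v.
  by rewrite linearP IH linearP.
by rewrite scalerDr !scalerA (mulrC t).
Qed.

HB.instance Definition _ k :=
  GRing.isLinear.Build R[i] (cform R m) (cform R m) *:%R (star k)
    (star_op_is_linear k).

Lemma exterior_metric_trace F :
  (forall u v, exterior (F u v)) -> exterior (trace F).
Proof. by move=> h; do 2 (apply: exterior_sum => ? _); apply: exteriorZ. Qed.

Lemma exterior_deg_metric_trace k F :
  (forall u v, exterior_deg k (F u v)) -> exterior_deg k (trace F).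
Proof. by move=> h; do 2 (apply: exterior_deg_sum => ? _); apply: exterior_degZ. Qed.

Lemma exterior_star k b : exterior (star k b).
Proof.
elim: k b => [|k IH] b; first by rewrite star0; apply: exteriorZ; case: evol.
by rewrite starS; apply/exteriorZ/exterior_metric_trace => u v; apply: exterior_iota.
Qed.

Lemma exterior_deg_star k b : (k <= m)%N -> exterior_deg (m - k) (star k b).
Proof.
elim: k b => [|k IH] b km; first by rewrite star0 subn0; apply: exterior_degZ.
rewrite starS; apply/exterior_degZ/exterior_deg_metric_trace => u v; apply: exterior_iota_deg.
by rewrite subnSK //; apply/IH/ltnW.
Qed.

Lemma trace_star k b :
  trace (fun u v => iota_form u (star k (iota_form v b))) =
  ((-1) ^+ k * k.+1%:R) *: star k.+1 b.
Proof.
by rewrite starS scalerA mulrACA -expr2 sqrr_sign mulfV ?mul1r ?scale1r // pnatr_eq0.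
Qed.

Lemma iota_star_vlinear k b : vlinear (fun v => iota_form v (star k b)).
Proof. by move=> r u v; apply/iota_linear/exterior_multilinear/exterior_star. Qed.

(** In the recursion for degree k + 2, contracting [flat u] itself gives one copy of iota_u (star b)
    and the induction hypothesis k + 1 further ones; the total cancels the denominator k + 2. *)
Lemma star_flat k u b : exterior_deg k b ->
  star k.+1 (rwedge (flat G u) b) = (-1) ^+ k *: iota_form u (star k b).
Proof.
elim: k b => [|k IH] b eb.
  have -> : star 1 (rwedge (flat G u) b) =
      trace (fun x y => metric G y u *: iota_form x (star 0 b)).
    rewrite starS expr0 divr1 scale1r; apply: eq_metric_trace => x y; rewrite !star0.
    rewrite -linearZ /= scalerA; congr (iota_form _ (_ *: _)).
    rewrite iota_flat_rwedge form_addE form_oppE form_scaleE.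
    by case: eb => _ /iota_homogeneous0 ->; rewrite rwedge0r subr0.
  rewrite -(metric_trace_sym Gsym) (metric_trace_repr Gsym Gunit) ?scale1r //.
  exact: iota_star_vlinear.
have -> : star k.+2 (rwedge (flat G u) b) = ((-1) ^+ k.+1 / k.+2%:R) *:
    (trace (fun x y => metric G y u *: iota_form x (star k.+1 b))
     + (-1) ^+ k *: iota_form u (trace (fun x y => iota_form x (star k (iota_form y b))))).
  rewrite [LHS]starS [iota_form u _]metric_trace_op; congr (_ *: _).
  rewrite -metric_traceZ -metric_traceD.
  apply: eq_metric_trace => x y.
  rewrite iota_flat_rwedge linearB /= linearZ /= IH; last exact: exterior_iota_deg.
  rewrite iota_formD iota_formN !iota_formZ (iotaC x u); last exact: exterior_star.
  by rewrite scalerN opprK.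
rewrite -(metric_trace_sym Gsym) (metric_trace_repr Gsym Gunit); last exact: iota_star_vlinear.
rewrite trace_star iota_formZ (scalerA ((-1) ^+ k)) mulrA -expr2 sqrr_sign mul1r.
by rewrite -{1}[iota_form u _]scale1r -scalerDl nat1r scalerA divfK // pnatr_eq0.
Qed.

(** Companion of [star_flat]. By [key], moving [flat v] inside the recursion past the contraction
    costs one copy of star (iota_v b); the induction hypothesis turns the rest into further copies,
    and their number cancels the denominator. *)
Lemma star_iota k v b : exterior_deg k.+1 b ->
  star k (iota_form v b) = (-1) ^+ k *: rwedge (flat G v) (star k.+1 b).
Proof.
have key k' c : exterior c ->
    rwedge (flat G v) (star k'.+1 c) = ((-1) ^+ k' / k'.+1%:R) *:
    (star k' (iota_form v c) -
     trace (fun x y => iota_form x (rwedge (flat G v) (star k' (iota_form y c))))).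
  move=> ec; rewrite starS rwedgeZr metric_trace_op; congr (_ *: _).
  rewrite -(metric_trace_repr Gsym Gunit v (F := fun y => star k' (iota_form y c))); last first.
    by move=> r x y; rewrite iota_linear ?linearP //; exact: exterior_multilinear.
  rewrite -metric_traceB; apply: eq_metric_trace => x y.
  by rewrite iota_flat_rwedge opprB addrC subrK.
elim: k b => [|k IH] b eb.
  rewrite key; last by case: eb.
  (* In the base case the trace vanishes, [flat v] times the volume having degree m + 1. *)
  rewrite expr0 divr1 !scale1r [X in _ - X](_ : _ = 0) ?subr0 //.
  rewrite /metric_trace big1 // => i _; rewrite big1 // => j _.
  rewrite star0 rwedgeZr (@exterior_vanish_above _ _ m.+1 (rwedge _ vol)) ?linear0 //.
  exact: exterior_deg_flat_rwedge.
rewrite key; last by case: eb.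
have -> : trace (fun x y => iota_form x (rwedge (flat G v) (star k.+1 (iota_form y b))))
    = - ((-1) ^+ k *: trace (fun x y => iota_form x (star k (iota_form y (iota_form v b))))).
  rewrite -metric_traceZ -metric_traceN; apply: eq_metric_trace => x y.
  have := IH _ (exterior_iota_deg y eb).
  move/(congr1 (fun c => (-1) ^+ k *: c)); rewrite scalerA -expr2 sqrr_sign scale1r => <-.
  by rewrite iotaC ?linearN //; case: eb.
rewrite trace_star opprK scalerA mulrA -expr2 sqrr_sign mul1r.
rewrite -{2}[star k.+1 _]scale1r -scalerDl nat1r !scalerA.
by rewrite mulrA -expr2 sqrr_sign mul1r mulVf ?scale1r // pnatr_eq0.
Qed.

Lemma inner0 a b : inner 0 G a (conj_form b) = a [::] * b [::].
Proof.
have nilE (I : {ffun 'I_0 -> 'I_m}) : [seq (delta_mx 0 (I l) : 'rV[R]_m) | l : 'I_0] = [::].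
  by apply/size0nil; rewrite size_map size_enum_ord.
rewrite /inner fact0 invr1 mul1r.
have I0 : {ffun 'I_0 -> 'I_m} by apply: finfun; case.
have one (V : nmodType) (F : {ffun 'I_0 -> 'I_m} -> V) : \sum_I F I = F I0.
  by rewrite (big_pred1 I0) // => I; apply/esym/eqP/ffunP => -[].
by rewrite !one big_ord0 !nilE mul1r /conj_form conjcK.
Qed.

Lemma star_op_spec k b : (k <= m)%N -> exterior_deg k b ->
  hodge_spec k G vol b (star k b).
Proof.
move=> km eb; split; first exact: exterior_deg_star.
elim: k b km eb => [|k IH] b km eb a ea; (rewrite wedgeE;
  [ | by case: ea | exact: exterior_star]).
  rewrite inner0 star0 rwedgeZr mulrC -scalerA; congr (_ *: _).
  have -> : a = a [::] *: @one_form0 R m; last by rewrite rwedgeZl rwedge1l form_scaleE mulr1.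
  apply/funext => -[|x s]; rewrite form_scaleE ?mulr1 //= mulr0.
  by case: ea => _; apply.
rewrite starS rwedgeZr metric_trace_op innerS.
have -> : trace (fun u v => rwedge a (iota_form u (star k (iota_form v b)))) =
    (-1) ^+ k *: trace (fun u v => rwedge (iota_form u a) (star k (iota_form v b))).
  rewrite -metric_traceZ; apply: eq_metric_trace => u v.
  (* The product has degree m + 1, so it vanishes, and contracting it moves iota_u from one factor
     to the other. *)
  have : iota_form u (rwedge a (star k (iota_form v b))) = 0.
    rewrite (@exterior_vanish_above _ _ m.+1 (rwedge _ _)) //.
    have := exterior_deg_rwedge ea (exterior_deg_star (iota_form v b) (ltnW km)).
    by rewrite addSn subnKC // ltnW.
  rewrite iota_rwedge (degree_sign_homogeneous (proj2 ea)) rwedgeZl exprS mulN1r.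
  by rewrite scaleNr => /eqP; rewrite subr_eq0 => /eqP ->; rewrite scalerA -expr2 sqrr_sign scale1r.
rewrite scalerA mulrAC -expr2 sqrr_sign mul1r -[RHS]scalerA; congr (_ *: _).
rewrite scaler_suml; apply: eq_bigr => i _; rewrite scaler_suml; apply: eq_bigr => j _.
rewrite -scalerA; congr (_ *: _).
rewrite -(IH _ (ltnW km) (exterior_iota_deg _ eb)); last exact: exterior_iota_deg.
by rewrite wedgeE //; [apply: exterior_iota; case: ea | exact: exterior_star].
Qed.

Lemma hodge_spec_unique k c z z' : (k <= m)%N ->
  hodge_spec k G vol c z -> hodge_spec k G vol c z' -> z = z'.
Proof.
move=> km [ez hz] [ez' hz']; apply/eqP; rewrite -subr_eq0; apply/eqP.
apply: (rwedge_pairing_nondegenerate Gsym Gunit (k := k) (l := m - k)).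
- by apply: exterior_degD => //; apply: exterior_degN.
- by rewrite subnKC.
move=> a ea; rewrite rwedgeDr rwedgeNr.
have [[e1 _] [e2 _] [e3 _]] := And3 ea ez ez'.
by rewrite -!wedgeE // hz // hz' // subrr.
Qed.

Lemma component_homogeneous k l b : homogeneous k b ->
  component l b = if l == k then b else 0.
Proof.
move=> hb; apply/funext => s; rewrite /component.
have [->|lk] := eqVneq l k; first by case: eqVneq => // /hb ->.
by case: eqVneq => // sl; rewrite hb // sl.
Qed.

(** [hodge] makes a choice in each degree separately; [star_op_spec] and the nondegeneracy of the
    pairing identify it, and in the degrees where b has no component the choice is the star of 0. *)
Lemma hodge_star k b : exterior_deg k b -> hodge G vol b = star k b.
Proof.
move=> eb; apply/funext => s; rewrite /hodge; set l := (m - size s)%N.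
have lm : (l <= m)%N by rewrite leq_subr.
have xgetE c : exterior_deg l c -> xget 0 (hodge_spec l G vol c) = star l c.
  move=> ec; apply: xget_unique; first exact: star_op_spec.
  by move=> z hz; apply: (hodge_spec_unique lm hz); apply: star_op_spec.
rewrite (component_homogeneous _ (proj2 eb)).
have [lk|lk] := eqVneq l k; first by rewrite xgetE ?lk.
rewrite xgetE ?linear0; last exact: exterior_deg0.
have [km|km] := leqP k m; last by rewrite (exterior_vanish_above eb km) linear0.
have [_ ->//] := exterior_deg_star b km.
by apply: contra_neq lk => sk; rewrite /l sk subKn.
Qed.

End Star.

(** * The Lefschetz operators *)

Section Lefschetz.
Context {R : realType} {n : nat} (G J : 'M[R]_(2 * n)).
Hypothesis Gsym : G^T = G.
Hypothesis Gunit : G \in unitmx.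
Hypothesis JJ : J *m J = - 1%:M.
Hypothesis JG : J *m G *m J^T = G.
Local Notation form := (cform R (2 * n)).
Implicit Types (a b : form) (u v x : 'rV[R]_(2 * n)).

Local Notation trace := (metric_trace G).
Local Notation metric := (metric G).
Local Notation flat := (flat G).
Local Notation one := (@one_form0 R (2 * n)).

Lemma mulJJ u : u *m J *m J = - u.
Proof. by rewrite -mulmxA JJ mulmxN mulmx1. Qed.

Lemma metricJJ u v : metric (u *m J) (v *m J) = metric u v.
Proof. by rewrite /metric trmx_mul !mulmxA -[u *m J *m G]mulmxA -[u *m (J *m G) *m _]mulmxA JG. Qed.

Lemma metricN_r u v : metric u (- v) = - metric u v.
Proof. by rewrite /metric linearN mulmxN mxE rmorphN. Qed.

Lemma metricJ_skew u v : metric (u *m J) v = - metric u (v *m J).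
Proof. by rewrite -[in RHS](metricJJ u) mulJJ metricN_r opprK. Qed.

Lemma metricJ_diag u : metric u (u *m J) = 0.
Proof.
have := metricJ_skew u u; rewrite (metricC Gsym) => /eqP.
by rewrite -addr_eq0 -mulr2n mulrn_eq0 /= => /eqP.
Qed.

Definition fundamental_form : form :=
  fun s => if s is [:: u; v] then metric (u *m J) v else 0.

Lemma iota_fundamental x : iota_form x fundamental_form = flat (x *m J).
Proof.
apply/funext => -[|y [|z s]] //.
by rewrite /iota_form /fundamental_form /flat (metricC Gsym).
Qed.

Lemma vlinear_flatJ : vlinear (fun v => flat (v *m J)).
Proof. by move=> r u v; rewrite mulmxDl -scalemxAl (flat_linear Gsym). Qed.

Lemma exterior_deg_fundamental : exterior_deg 2 fundamental_form.
Proof.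
split; last by move=> [|u [|v [|w s]]].
apply: exteriorP => [r v w|v|v]; rewrite !iota_fundamental.
- exact: vlinear_flatJ.
- by rewrite iota_flat metricJ_diag scale0r.
- by case: (exterior_deg_flat G (v *m J)).
Qed.

Definition lefschetz b : form := rwedge fundamental_form b.
Local Notation L := lefschetz.

Lemma lefschetz_is_linear : linear L.
Proof. exact: rwedge_is_linear. Qed.

HB.instance Definition _ :=
  GRing.isLinear.Build R[i] form form *:%R L lefschetz_is_linear.

Lemma lefschetzZ (k : R[i]) b : L (k *: b) = k *: L b.
Proof. exact: linearZ. Qed.

Lemma lefschetzD a b : L (a + b) = L a + L b.
Proof. exact: linearD. Qed.

Lemma lefschetz_iterZ j (k : R[i]) b : iter j L (k *: b) = k *: iter j L b.
Proof. by elim: j => //= j ->; rewrite lefschetzZ. Qed.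

Lemma lefschetz_iter0 j : iter j L 0 = 0.
Proof. by elim: j => //= j ->; rewrite linear0. Qed.

Lemma lefschetzN b : L (- b) = - L b.
Proof. exact: linearN. Qed.

Lemma degree_sign_fundamental : degree_sign fundamental_form = fundamental_form.
Proof.
rewrite (degree_sign_homogeneous (proj2 exterior_deg_fundamental)).
by rewrite expr2 mulrNN mulr1 scale1r.
Qed.

Lemma iota_lefschetz x b :
  iota_form x (L b) = rwedge (flat (x *m J)) b + L (iota_form x b).
Proof. by rewrite /L iota_rwedge iota_fundamental degree_sign_fundamental. Qed.

Lemma exterior_deg_lefschetz k b : exterior_deg k b -> exterior_deg k.+2 (L b).
Proof.
rewrite -[k.+2]add2n; apply: exterior_deg_rwedge.
exact: exterior_deg_fundamental.
Qed.

Lemma exterior_deg_lefschetz_iter j k b :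
  exterior_deg k b -> exterior_deg (k + j.*2) (iter j L b).
Proof.
move=> eb; elim: j => [|j IH]; first by rewrite addn0.
by rewrite doubleS !addnS; apply: exterior_deg_lefschetz.
Qed.

(** The number operator on the 2-form omega writes it as half a trace of products of two 1-forms, to
    which the rules [star_flat] and [star_iota] apply. *)
Lemma lefschetz_trace b :
  L b = 2^-1 *: trace (fun u v => rwedge (flat u) (rwedge (flat (v *m J)) b)).
Proof.
have h := number_operator Gsym Gunit exterior_deg_fundamental.
rewrite /L -[fundamental_form](scalerK (_ : (2 : R[i]) != 0)) ?pnatr_eq0 // -h.
rewrite rwedgeZl -[rwedge (trace _) b]/(rwedge_by b (trace _)) metric_trace_op.
congr (_ *: _); apply: eq_metric_trace => u v.
by rewrite /= /rwedge_by rwedgeA iota_fundamental.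
Qed.

(** [lefschetz_trace] with each exterior product by a 1-form replaced by the interior product
    adjoint to it, in the opposite order. [LambdaE] identifies it with [Lambda]. *)
Definition lambda_op b : form :=
  2^-1 *: trace (fun u v => iota_form (v *m J) (iota_form u b)).
Local Notation Lam := lambda_op.

Lemma lambda_op_is_linear : linear Lam.
Proof.
move=> k a b; rewrite /Lam scalerA (mulrC k) -scalerA -scalerDr -metric_traceZ.
by rewrite -metric_traceD.
Qed.

HB.instance Definition _ :=
  GRing.isLinear.Build R[i] form form *:%R Lam lambda_op_is_linear.

Lemma lambda_opZ (k : R[i]) b : Lam (k *: b) = k *: Lam b.
Proof. exact: linearZ. Qed.

Lemma lambda_opD a b : Lam (a + b) = Lam a + Lam b.
Proof. exact: linearD. Qed.

Lemma lambda_iterZ j (k : R[i]) b : iter j Lam (k *: b) = k *: iter j Lam b.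
Proof. by elim: j => //= j ->; rewrite lambda_opZ. Qed.

Lemma exterior_deg_lambda k b : exterior_deg k.+2 b -> exterior_deg k (Lam b).
Proof.
move=> eb; apply/exterior_degZ/exterior_deg_metric_trace => u v.
by do 2 apply: exterior_iota_deg.
Qed.

Lemma lambda_low k b : (k < 2)%N -> homogeneous k b -> Lam b = 0.
Proof.
move=> k2 hb; rewrite /Lam /metric_trace big1 ?scaler0 // => i _; rewrite big1 // => j _.
case: k k2 hb => [|[|//]] _ hb; first by rewrite (iota_homogeneous0 _ hb) !linear0.
by rewrite (iota_homogeneous0 _ (iota_homogeneous _ hb)) linear0.
Qed.

Lemma iota_lambda x b : exterior b -> Lam (iota_form x b) = iota_form x (Lam b).
Proof.
move=> eb; rewrite /Lam iota_formZ [iota_form x (trace _)]metric_trace_op.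
congr (_ *: _); apply: eq_metric_trace => u v /=.
by rewrite (iotaC u x) // iota_formN (iotaC (v *m J) x) ?opprK //; apply: exterior_iota.
Qed.

Lemma trace_flatJ b k : exterior_deg k b ->
  trace (fun u v => rwedge (flat (u *m J)) (iota_form (v *m J) b)) = k%:R *: b.
Proof.
move=> eb; rewrite (@metric_trace_congr _ _ _ Gunit J
  (fun u v => rwedge (flat u) (iota_form v b)) JG) ?(number_operator Gsym Gunit eb) //.
  move=> u r v w; rewrite iota_linear ?rwedgeDr ?rwedgeZr //.
  by case: eb => -[].
by move=> v r u w; rewrite (flat_linear Gsym) rwedgeDl rwedgeZl.
Qed.

(** The coefficient is half of 2n - k - k: a full contraction of the metric and two number
    operators, one of them twisted by the isometry J. *)
Lemma lambda_lefschetz k b : exterior_deg k b ->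
  Lam (L b) = L (Lam b) + (n%:R - k%:R) *: b.
Proof.
move=> eb; rewrite /Lam.
have -> : trace (fun u v => iota_form (v *m J) (iota_form u (L b))) =
    trace (fun u v => metric u v *: b)
    - trace (fun u v => rwedge (flat (u *m J)) (iota_form (v *m J) b))
    - trace (fun u v => rwedge (flat v) (iota_form u b))
    + L (trace (fun u v => iota_form (v *m J) (iota_form u b))).
  rewrite [L (trace _)]metric_trace_op -!metric_traceB -metric_traceD.
  apply: eq_metric_trace => u v.
  rewrite iota_lefschetz iota_formD iota_flat_rwedge iota_lefschetz metricJJ.
  by rewrite mulJJ (vlinearN _ (flat_linear Gsym)) rwedgeNl !addrA (metricC Gsym).
rewrite (metric_trace_card Gsym Gunit) (trace_flatJ eb).
rewrite (metric_trace_sym Gsym (fun u v => rwedge (flat u) (iota_form v b))).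
rewrite (number_operator Gsym Gunit eb) scalerDr [RHS]addrC lefschetzZ; congr (_ + _).
rewrite -!scalerBl scalerA; congr (_ *: _); rewrite natrM.
by field.
Qed.

(** The coefficient is the sum of n - (k + 2i) over i < j, the commutator being applied once at each
    stage. *)
Lemma lambda_lefschetz_iter j k b : exterior_deg k b ->
  Lam (iter j L b) =
  iter j L (Lam b) + (j%:R * (n%:R - k%:R - j%:R + 1)) *: iter j.-1 L b.
Proof.
move=> eb; elim: j => [|j IH]; first by rewrite mul0r scale0r addr0.
rewrite iterS (lambda_lefschetz (exterior_deg_lefschetz_iter j eb)) IH.
rewrite lefschetzD lefschetzZ -addrA; congr (_ + _).
case: j {IH} => [|j] /=.
  by rewrite mul0r scale0r add0r addn0 mul1r subrK.
rewrite -scalerDl; congr (_ *: _); rewrite -muln2 natrD natrM -!natr1; ring.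
Qed.

Lemma lambda_lefschetz_primitive j k b : exterior_deg k b -> Lam b = 0 ->
  Lam (iter j.+1 L b) = (j.+1%:R * (n%:R - k%:R - j%:R)) *: iter j L b.
Proof.
move=> eb b0; rewrite (lambda_lefschetz_iter _ eb) b0.
by rewrite lefschetz_iter0 add0r -natr1; congr (_ *: _); ring.
Qed.

Lemma lefschetz_iter_vanish j k b : exterior_deg k b -> (2 * n < k + j.*2)%N ->
  iter j L b = 0.
Proof. by move=> /(exterior_deg_lefschetz_iter j); apply: exterior_vanish_above. Qed.

(** L^n b vanishes for reasons of degree, and Lambda removes one L at a time: the coefficients (j +
    1)(n - k - j) are nonzero because k > n. *)
Lemma lambda_inj_above k b : exterior_deg k b -> (n < k)%N -> Lam b = 0 -> b = 0.
Proof.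
move=> eb nk b0.
suff h j : iter j L b = 0 -> b = 0.
  apply: (h n); apply: (lefschetz_iter_vanish eb).
  by rewrite -muln2 mulnC -[X in (X < _)%N]add0n ltn_add2r (leq_ltn_trans _ nk).
elim: j => [//|j IH] /(congr1 Lam); rewrite (lambda_lefschetz_primitive _ eb b0) linear0.
move/eqP; rewrite scaler_eq0 mulf_eq0 pnatr_eq0 /= -addrA -opprD -natrD subr_eq0 eqr_nat.
case/orP => [/eqP nE|/eqP//]; exfalso; move: nk; rewrite ltnNge => /negP; apply.
by rewrite nE leq_addr.
Qed.

Lemma rwedge1r a : rwedge a one = a.
Proof.
apply/funext => s; elim: s a => [|v s IH] a /=; first by rewrite mulr1.
by rewrite iota_one rwedge0r IH addr0.
Qed.

Lemma form_eq a b : a [::] = b [::] -> (forall x, iota_form x a = iota_form x b) -> a = b.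
Proof.
move=> h0 h; apply/funext => -[//|x s].
by have /(congr1 (@^~ s)) := h x.
Qed.

Lemma flat_anticomm u v : rwedge (flat u) (flat v) = - rwedge (flat v) (flat u).
Proof.
apply: form_eq => [|x]; first by rewrite /= mul0r form_oppE /= mul0r oppr0.
rewrite iota_formN !iota_flat_rwedge !iota_flat !rwedgeZr !rwedge1r opprB.
by rewrite addrC -[RHS]addrC addrC.
Qed.

Lemma flat_comm u b : rwedge (flat u) b = rwedge (degree_sign b) (flat u).
Proof.
apply/funext => s; elim: s b => [|x s IH] b; first by rewrite /= mul0r mulr0.
rewrite -[LHS]/(iota_form x (rwedge (flat u) b) s) iota_flat_rwedge form_addE form_oppE IH.
rewrite -[RHS]/((rwedge (iota_form x (degree_sign b)) (flat u)
  + rwedge (degree_sign (degree_sign b)) (iota_form x (flat u))) s).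
by rewrite iota_degree_sign degree_signK rwedgeNl iota_flat rwedgeZr rwedge1r addrC.
Qed.

Lemma fundamental_comm b : rwedge fundamental_form b = rwedge b fundamental_form.
Proof.
apply/funext => s; elim: s b => [|x s IH] b; first by rewrite /= mul0r mulr0.
rewrite -[LHS]/(iota_form x (L b) s) iota_lefschetz flat_comm form_addE /lefschetz IH.
by rewrite -[RHS]/(iota_form x (rwedge b fundamental_form) s) iota_rwedge iota_fundamental addrC.
Qed.

Lemma lefschetz_rwedge a b : L (rwedge a b) = rwedge a (L b).
Proof. by rewrite /L -!rwedgeA fundamental_comm. Qed.

Lemma iota_lefschetz_iter x j b :
  iota_form x (iter j L b) =
  iter j L (iota_form x b) + j%:R *: rwedge (flat (x *m J)) (iter j.-1 L b).
Proof.
elim: j => [|j IH]; first by rewrite scale0r addr0.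
rewrite iterS iota_lefschetz IH lefschetzD lefschetzZ lefschetz_rwedge addrCA; congr (_ + _).
case: j {IH} => [|j] /=; first by rewrite scale0r addr0 scale1r.
by rewrite -{1}[rwedge _ _]scale1r -scalerDl nat1r.
Qed.


Definition lefschetz_volume : form := (n`!%:R)^-1 *: iter n L one.
Local Notation vol := lefschetz_volume.

Lemma exterior_deg_volume : exterior_deg (2 * n) vol.
Proof.
apply: exterior_degZ.
have := exterior_deg_lefschetz_iter n (@exterior_deg_one R (2 * n)).
by rewrite add0n -muln2 [(n * 2)%N]mulnC.
Qed.

Local Notation star := (star_op G vol).

Let evol := exterior_deg_volume.

(** Lambda sends L^(j+1) 1 to (j + 1)(n - j) L^j 1, and this is nonzero for j < n; so L^n 1 = 0
    would descend to 1 = 0. *)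
Lemma volume_neq0 : vol != 0.
Proof.
rewrite scaler_eq0 invr_eq0 pnatr_eq0 negb_or -lt0n fact_gt0 /=.
have one0 : one <> 0 by move/(congr1 (@^~ [::]))/eqP; rewrite oner_eq0.
have h j : (j <= n)%N -> iter j L one = 0 -> one = 0.
  elim: j => [//|j IH] jn /(congr1 Lam).
  rewrite (lambda_lefschetz_primitive _ (@exterior_deg_one _ _)); last first.
    exact: (lambda_low (k := 0)) (@homogeneous_one _ _).
  rewrite (linear0 lambda_op) subr0 => /eqP; rewrite scaler_eq0 mulf_eq0 pnatr_eq0 /=.
  rewrite subr_eq0 eqr_nat gtn_eqF //= => /eqP; apply: IH; exact: ltnW.
by apply/eqP => /(h n (leqnn n)).
Qed.

(** By [star_iota], the star of every contraction of b vanishes too; the descent ends in degree 0,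
    where the volume form is nonzero. *)
Lemma star_injective k b : exterior_deg k b -> star k b = 0 -> b = 0.
Proof.
elim: k b => [|k IH] b eb h.
  move/eqP: h; rewrite (star0 G vol) scaler_eq0 (negPf volume_neq0) orbF => /eqP h.
  apply/funext => -[//|x s]; by case: eb => _; apply.
have ib v : iota_form v b = 0.
  apply: IH; first exact: exterior_iota_deg.
  by rewrite (star_iota Gsym Gunit evol) // h rwedge0r scaler0.
apply: form_eq => [|x]; last by rewrite ib.
by case: eb => _; apply.
Qed.

(** [star_flat] twice has total sign -1, which the exchange of the two interior products undoes. *)
Lemma star_lefschetz k b : exterior_deg k b -> star k.+2 (L b) = Lam (star k b).
Proof.
move=> eb; rewrite lefschetz_trace linearZ /= metric_trace_op; congr (_ *: _).
apply: eq_metric_trace => u v.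
rewrite /= (star_flat Gsym Gunit evol (k := k.+1)); last exact: exterior_deg_flat_rwedge.
rewrite (star_flat Gsym Gunit evol) //.
rewrite iota_formZ scalerA exprS mulN1r mulNr -expr2 sqrr_sign scaleN1r iotaC ?opprK //.
exact: exterior_star.
Qed.

Lemma lefschetz_star k b : exterior_deg k.+2 b -> L (star k.+2 b) = star k (Lam b).
Proof.
move=> eb; rewrite lefschetz_trace /lambda_op linearZ /= [star k (trace _)]metric_trace_op.
congr (_ *: _); apply: eq_metric_trace => u v /=.
rewrite (star_iota Gsym Gunit evol); last exact: exterior_iota_deg.
rewrite (star_iota Gsym Gunit evol) // rwedgeZr scalerA exprS mulN1r mulrN -expr2.
by rewrite sqrr_sign scaleN1r -!rwedgeA flat_anticomm rwedgeNl.
Qed.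

Lemma lefschetz_star_low k b : (k < 2)%N -> exterior_deg k b -> L (star k b) = 0.
Proof.
move=> k2 eb; have [kn|nk] := leqP k (2 * n); last first.
  by rewrite (exterior_vanish_above eb nk) !linear0.
apply: (exterior_vanish_above (exterior_deg_lefschetz (exterior_deg_star G evol b kn))).
lia.
Qed.

Lemma star_lefschetz_iter j k b :
  exterior_deg k b -> star (k + j.*2) (iter j L b) = iter j Lam (star k b).
Proof.
move=> eb; elim: j => [|j IH]; first by rewrite addn0.
rewrite doubleS !addnS iterS star_lefschetz ?IH //.
exact: exterior_deg_lefschetz_iter.
Qed.

(** A symmetric metric is contracted with an alternating pair of arguments. *)
Lemma trace_iota_iota a : exterior a ->
  trace (fun u v => iota_form v (iota_form u a)) = 0.
Proof.
move=> ea; set t := trace _.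
have : t = - t.
  rewrite {1}/t -(metric_trace_sym Gsym) -metric_traceN; apply: eq_metric_trace => u v.
  by rewrite iotaC.
move/eqP; rewrite -addr_eq0 -mulr2n -scaler_nat scaler_eq0 pnatr_eq0 /=.
by move/eqP.
Qed.

(** On such forms J acts in an argument as the scalar -i, which leaves the trace of
    [trace_iota_iota]. *)
Lemma lambda_anti a : exterior a -> antiholomorphic J a -> Lam a = 0.
Proof.
move=> ea h; have := trace_iota_iota ea.
move/(congr1 (fun c => - 'i%R *: c)); rewrite scaler0 -metric_traceZ => t0.
rewrite /Lam -[trace _]/(metric_trace _ _) [X in _ *: X](_ : _ = 0) ?scaler0 //.
by rewrite -t0; apply: eq_metric_trace => u v; apply: anti_iota_form.
Qed.

(** The unit i^q (-1)^(q(q-1)/2): at each step the sign comes from [starS] and the i from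
    [trace_flatJ_anti]. *)
Fixpoint star_sign q : R[i] := if q is q'.+1 then 'i%R * (-1) ^+ q' * star_sign q' else 1.

Lemma star_sign_sqr q : star_sign q ^+ 2 = (-1) ^+ q.
Proof.
elim: q => [|q IH] /=; first by rewrite expr1n.
by rewrite !exprMn sqrr_sign IH sqrCi mulr1 exprS.
Qed.

Lemma trace_flatJ_anti q a : exterior_deg q a -> antiholomorphic J a ->
  trace (fun u v => rwedge (flat (u *m J)) (iota_form v a)) = ('i%R * q%:R) *: a.
Proof.
move=> ea h; rewrite -scalerA -(trace_flatJ ea) -metric_traceZ.
apply: eq_metric_trace => u v; rewrite h rwedgeZr scalerA mulrN -expr2 sqrCi.
by rewrite opprK scale1r.
Qed.

(* Induction on [q]: as [u - i J u] kills [a], [iota_u] acts on [L^N (iota_v a)]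
   through [iota_u omega] only, which turns [iota_u] back into an exterior product. *)
Lemma star_anti q a : exterior_deg q a -> antiholomorphic J a ->
  star q a = if (q <= n)%N then (star_sign q / (n - q)`!%:R) *: iter (n - q) L a else 0.
Proof.
elim: q a => [|q IH] a ea ha.
  rewrite star0 subn0 leq0n /= div1r.
  have {2}-> : a = a [::] *: one.
    apply/funext => -[|x s]; rewrite form_scaleE ?mulr1 //= mulr0.
    by case: ea => _; apply.
  by rewrite lefschetz_iterZ scalerA mulrC -scalerA.
have eia v : exterior_deg q (iota_form v a) by apply: exterior_iota_deg.
have hia v : antiholomorphic J (iota_form v a) by apply: anti_iota_form => //; case: ea.
rewrite starS.
have [qn|nq] := leqP q n; last first.
  rewrite ltnNge (ltnW nq) /= /metric_trace big1 ?scaler0 // => i _.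
  by rewrite big1 // => j _; rewrite IH // leqNgt nq !linear0.
set N := (n - q)%N.
have -> : trace (fun u v => iota_form u (star q (iota_form v a))) =
    (star_sign q / N`!%:R) *: (iter N L (trace (fun u v => iota_form u (iota_form v a)))
    + N%:R *: iter N.-1 L (trace (fun u v => rwedge (flat (u *m J)) (iota_form v a)))).
  have iterop j F : iter j L (trace F) = trace (fun u v => iter j L (F u v)).
    by elim: j => //= j ->; rewrite metric_trace_op.
  rewrite !iterop -metric_traceZ -metric_traceD -metric_traceZ.
  apply: eq_metric_trace => u v; rewrite IH // qn iota_formZ iota_lefschetz_iter.
  congr (_ *: (_ + _ *: _)); rewrite -/N; elim: N.-1 => //= j <-.
  by rewrite lefschetz_rwedge.
rewrite (metric_trace_sym Gsym (fun v u => iota_form u (iota_form v a))).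
rewrite trace_iota_iota; last by case: ea.
rewrite (trace_flatJ_anti ea ha).
rewrite lefschetz_iter0 add0r lefschetz_iterZ !scalerA subnS -/N.
(* For q = n no omega is left to contract and the star vanishes, in accordance with q + 1 > n. *)
have [N0|N0] := posnP N.
  by rewrite N0 mulr0 mul0r scale0r ltnNge -subn_eq0 -/N N0.
rewrite -subn_gt0 -/N N0; congr (_ *: _).
rewrite /= -[in LHS](prednK N0) factS natrM; field.
by rewrite !nat1r !pnatr_eq0 -lt0n fact_gt0.
Qed.

Lemma anti_vanish q a : exterior_deg q a -> antiholomorphic J a -> (n < q)%N -> a = 0.
Proof.
by move=> ea ha nq; apply: (star_injective ea); rewrite star_anti // leqNgt nq.
Qed.

(** The coefficient is the product of (i + 1)(n - q - i) over i < j. *)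
Lemma lambda_lefschetz_iter_anti j q a : exterior_deg q a -> antiholomorphic J a ->
  (q <= n)%N -> iter j Lam (iter j L a) = (j`! * (n - q) ^_ j)%:R *: a.
Proof.
move=> ea ha qn; have a0 : Lam a = 0 by apply: lambda_anti => //; case: ea.
elim: j => [|j IH]; first by rewrite scale1r.
rewrite iterSr (lambda_lefschetz_primitive _ ea a0) lambda_iterZ IH scalerA; congr (_ *: _).
have [jN|Nj] := leqP j (n - q).
  by rewrite ffactnSr factS !natrM !natrB //; ring.
by rewrite (ffact_small Nj) (ffact_small (leqW Nj)) !muln0 mulr0.
Qed.

(** With N = n - q, Lambda^N L^N multiplies by N! N!, which cancels the denominators of the two uses
    of [star_anti] and leaves [star_sign q ^+ 2]. *)
Lemma star_star_anti q a : exterior_deg q a -> antiholomorphic J a -> (q <= n)%N ->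
  star (q + (n - q).*2) (star q a) = (-1) ^+ q *: a.
Proof.
move=> ea ha qn; rewrite [star q a]star_anti // qn linearZ /= star_lefschetz_iter //.
rewrite star_anti // qn lambda_iterZ (lambda_lefschetz_iter_anti _ ea ha qn) ffactnn.
rewrite !scalerA -star_sign_sqr; congr (_ *: _).
by rewrite natrM; field; rewrite pnatr_eq0 -lt0n fact_gt0.
Qed.

(* The difference of the two sides has degree above [n] and is killed by [Lam]. *)
Lemma lefschetz_iter_lambda q g : exterior_deg q.+2 g -> Lam (Lam g) = 0 -> (q < n)%N ->
  iter (n - q.+1) L g = (n - q)%:R^-1 *: iter (n - q) L (Lam g).
Proof.
move=> eg gg qn; set N := (n - q.+1)%N.
have NS : (n - q)%N = N.+1 by rewrite subnSK.
have eLg : exterior_deg q (Lam g) by apply: exterior_deg_lambda.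
have nE : n%:R = N%:R + q%:R + 1 :> R[i].
  by rewrite -addrA natr1 -natrD /N subnK.
apply/eqP; rewrite -subr_eq0; apply/eqP.
apply: (@lambda_inj_above (q.+2 + N.*2)).
- apply: exterior_degD; first exact: exterior_deg_lefschetz_iter.
  apply/exterior_degN/exterior_degZ; rewrite NS.
  by have := exterior_deg_lefschetz_iter N.+1 eLg; rewrite doubleS !addnS !addSn.
- by rewrite /N; lia.
rewrite lambda_opD -scaleN1r lambda_opZ lambda_opZ NS (lambda_lefschetz_primitive _ eLg gg).
rewrite (lambda_lefschetz_iter _ eg) scalerA.
(* For g of degree q + 2, N = n - q - 1 is the exponent at which the commutator of Lambda and L^N
   vanishes. *)
have -> : N%:R * (n%:R - q.+2%:R - N%:R + 1) = 0 :> R[i].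
  by rewrite nE -!natr1; ring.
rewrite scale0r addr0 !scalerA -{1}[iter N L _]scale1r -scalerDl.
have -> : n%:R - q%:R - N%:R = 1 :> R[i] by rewrite nE; ring.
by rewrite mulr1 divfK ?pnatr_eq0 // subrr scale0r.
Qed.

Lemma star_sign_neq0 q : star_sign q != 0.
Proof. by rewrite -sqrf_eq0 star_sign_sqr signr_eq0. Qed.

(** [lefschetz_iter_lambda] turns L^(n-q) g into a multiple of L^(n-q+1) Lambda g. By [star_anti]
    this is a multiple of the star of Lambda g, and a second star gives Lambda g back. *)
Lemma lambda_as_star q g : (q <= n)%N -> exterior_deg q.+1 g ->
  antiholomorphic J (Lam g) ->
  Lam g = - ('i%R * (star_sign q / (n - q)`!%:R)) *:
    star (q.+1 + (n - q).*2) (iter (n - q) L g).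
Proof.
case: q => [|q] qn eg ag.
  (* For q = 0 both sides vanish: g has degree 1 and L^n g has degree 2n + 1. *)
  rewrite (lambda_low _ (proj2 eg)) // (lefschetz_iter_vanish eg) ?linear0 //.
  by rewrite subn0; lia.
have eb := exterior_deg_lambda eg.
rewrite (lefschetz_iter_lambda eg) //; last by apply: lambda_anti => //; case: eb.
move: (Lam g) eb ag => b eb ab.
set N := (n - q.+1)%N; have NE : (n - q)%N = N.+1 by rewrite subnSK.
have dE : (q.+2 + N.*2)%N = (q + (n - q).*2)%N by rewrite NE doubleS !addnS !addSn.
have -> : iter (n - q) L b = ((n - q)`!%:R / star_sign q) *: star q b.
  rewrite star_anti // (ltnW qn) scalerA -[LHS]scale1r; congr (_ *: _).
  by field; rewrite star_sign_neq0 pnatr_eq0 -lt0n fact_gt0.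
rewrite dE [star _ (_ *: _)]linearZ /= [star _ (_ *: _)]linearZ /=.
rewrite star_star_anti //; last exact: ltnW.
rewrite NE !scalerA -[LHS]scale1r; congr (_ *: _).
have i2 : 'i%R * 'i%R = -1 :> R[i] by rewrite -expr2 sqrCi.
rewrite factS natrM /=; have := star_sign_neq0 q; move: (star_sign q) => c c0.
have N1 : N.+1%:R != 0 :> R[i] by rewrite pnatr_eq0.
have N2 : N`!%:R != 0 :> R[i] by rewrite pnatr_eq0 -lt0n fact_gt0.
move: N1 N2; move: (N.+1%:R : R[i]) (N`!%:R : R[i]) => x y x0 y0.
have := sqrr_sign R[i] q; move: ((-1) ^+ q) => e ee.
(* The factor i (-1)^q by which [star_sign q.+1] exceeds [star_sign q] meets -i and the sign (-1)^q
   of the double star. *)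
have -> : - ('i%R * ('i%R * e * c / y)) * (x^-1 * (x * y / c)) * e = - ('i%R * 'i%R) * e ^+ 2.
  by field; rewrite c0 x0 y0.
by rewrite i2 ee opprK mulr1.
Qed.

End Lefschetz.

(** * Bidegree of the Lefschetz operators *)

Section LefschetzBidegree.
Context {R : realType} {n : nat} (G J : 'M[R]_(2 * n)).
Hypothesis Gsym : G^T = G.
Hypothesis JJ : J *m J = - 1%:M.
Hypothesis JG : J *m G *m J^T = G.
Local Notation form := (cform R (2 * n)).
Implicit Types (a b : form) (u v x : 'rV[R]_(2 * n)).

Local Notation metric := (metric G).
Local Notation flat := (flat G).
Local Notation L := (lefschetz G J).
Local Notation bipart := (bipart J).

(* The components of types (0,1) ([c = false]) and (1,0) ([c = true]) of [iota_v omega]. *)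
Definition flat_type (c : bool) v : form :=
  2^-1 *: (flat (v *m J) + (if c then - 'i%R else 'i%R) *: flat v).

Lemma flat_typeE v : flat (v *m J) = flat_type true v + flat_type false v.
Proof.
by apply/funext => s; rewrite /flat_type /= !(form_addE, form_scaleE); field.
Qed.

Lemma flat_type_one_form c v :
  one_form (fun x => 2^-1 * (metric x (v *m J) + (if c then - 'i%R else 'i%R) * metric x v))
    (flat_type c v).
Proof.
split.
- by rewrite /flat_type form_scaleE form_addE form_scaleE /flat /= mulr0 addr0 mulr0.
- rewrite /flat_type linearZ /= linearD /= linearZ /= !degree_sign_flat.
  by rewrite scalerN -opprD scalerN.
- move=> x; rewrite /flat_type iota_formZ iota_formD iota_formZ !iota_flat.
  by rewrite scalerA -scalerDl scalerA.
Qed.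

Lemma flat_typeJ c v x :
  2^-1 * (metric (x *m J) (v *m J) + (if c then - 'i%R else 'i%R) * metric (x *m J) v) =
  (if c then 'i%R else - 'i%R) *
    (2^-1 * (metric x (v *m J) + (if c then - 'i%R else 'i%R) * metric x v)).
Proof.
rewrite metricJJ // metricJ_skew //.
have i2 : 'i%R * 'i%R = -1 :> R[i] by rewrite -expr2 sqrCi.
move: (metric x (v *m J)) (metric x v) => z y.
have -> : (if c then 'i%R else - 'i%R) * (2^-1 * (z + (if c then - 'i%R else 'i%R) * y)) =
   2^-1 * ((if c then 'i%R else - 'i%R) * z - 'i%R * 'i%R * y) :> R[i] by case: c; ring.
by rewrite i2; case: c; ring.
Qed.

Lemma bipart_flat10 p q v b :
  bipart p.+1 q (rwedge (flat_type true v) b) = rwedge (flat_type true v) (bipart p q b)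
  /\ bipart 0 q (rwedge (flat_type true v) b) = 0.
Proof. apply: (bipart_10 (flat_type_one_form true v)); exact: (flat_typeJ true). Qed.

Lemma bipart_flat01 p q v b :
  bipart p q.+1 (rwedge (flat_type false v) b) = rwedge (flat_type false v) (bipart p q b)
  /\ bipart p 0 (rwedge (flat_type false v) b) = 0.
Proof. apply: (bipart_01 (flat_type_one_form false v)); exact: (flat_typeJ false). Qed.

Lemma iota_type_lefschetz c v b :
  iota_type J c v (L b) = rwedge (flat_type (~~ c) v) b + L (iota_type J c v b).
Proof.
rewrite /iota_type !iota_lefschetz // lefschetzZ lefschetzD lefschetzN lefschetzZ.
rewrite mulJJ // (vlinearN _ (flat_linear Gsym)) /flat_type rwedgeZl rwedgeDl rwedgeZl rwedgeNl.
by case: c; apply/funext => s; rewrite !(form_addE, form_oppE, form_scaleE); ring.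
Qed.

(** omega has type (1, 1): a contraction of one type leaves a 1-form of the other type, which shifts
    the bidegree by [bipart_flat10] or [bipart_flat01]. The cases p = 0 and q = 0 belong to the same
    induction, as contractions lower the indices to them. *)
Lemma bipart_lefschetz_pointwise s : forall p q b,
  [/\ bipart p.+1 q.+1 (L b) s = L (bipart p q b) s,
      bipart 0 q (L b) s = 0 & bipart p 0 (L b) s = 0].
Proof.
elim: s => [|v s IH] p q b.
  by rewrite /lefschetz /= !mul0r xpair_eqE /= !if_same.
split; last first.
- rewrite /= addr0; case: p => // p; rewrite iota_type_lefschetz bipartD form_addE.
  by case: (IH p 0%N (iota_type J true v b)) => _ _ ->; rewrite (proj2 (bipart_flat01 p 0 v b)) addr0.
- rewrite /= add0r; case: q => // q; rewrite iota_type_lefschetz bipartD form_addE.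
  by case: (IH 0%N q (iota_type J false v b)) => _ -> _; rewrite (proj2 (bipart_flat10 0 q v b)) addr0.
rewrite -[RHS]/(iota_form v (L (bipart p q b)) s) iota_lefschetz // iota_bipart.
rewrite flat_typeE rwedgeDl lefschetzD !form_addE.
rewrite -[LHS]/(bipart p q.+1 (iota_type J true v (L b)) s + bipart p.+1 q (iota_type J false v (L b)) s).
rewrite !iota_type_lefschetz /= !bipartD !form_addE.
rewrite (proj1 (bipart_flat10 _ _ _ _)) (proj1 (bipart_flat01 _ _ _ _)).
have -> : bipart p q.+1 (L (iota_type J true v b)) s =
    L (if p is p'.+1 then bipart p' q (iota_type J true v b) else 0) s.
  case: (p) => [|p']; last by case: (IH p' q (iota_type J true v b)).
  by case: (IH 0%N q.+1 (iota_type J true v b)) => _ -> _; rewrite linear0.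
have -> : bipart p.+1 q (L (iota_type J false v b)) s =
    L (if q is q'.+1 then bipart p q' (iota_type J false v b) else 0) s.
  case: (q) => [|q']; last by case: (IH p q' (iota_type J false v b)).
  by case: (IH p.+1 0%N (iota_type J false v b)) => _ _ ->; rewrite linear0.
ring.
Qed.

Lemma bipart_lefschetz p q b : bipart p.+1 q.+1 (L b) = L (bipart p q b).
Proof. by apply/funext => s; case: (bipart_lefschetz_pointwise s p q b). Qed.

Lemma bipart_lefschetz0l q b : bipart 0 q (L b) = 0.
Proof. by apply/funext => s; case: (bipart_lefschetz_pointwise s 0 q b). Qed.

Lemma bipart_lefschetz0r p b : bipart p 0 (L b) = 0.
Proof. by apply/funext => s; case: (bipart_lefschetz_pointwise s p 0 b). Qed.

Lemma bipart_lefschetz_iter j p q b :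
  bipart (p + j) (q + j) (iter j L b) = iter j L (bipart p q b).
Proof. by elim: j => [|j IH]; rewrite ?addn0 // !addnS iterS bipart_lefschetz IH. Qed.

Lemma bipart_lefschetz_iter_anti j p q k a : exterior_deg k a -> antiholomorphic J a ->
  bipart p q (iter j L a) = if (p, q) == (j, k + j)%N then iter j L a else 0.
Proof.
move=> ea aa; elim: j p q => [|j IH] p q; first by rewrite addn0 (bipart_anti _ _ ea aa).
rewrite iterS; case: p => [|p]; first by rewrite bipart_lefschetz0l.
case: q => [|q]; first by rewrite bipart_lefschetz0r xpair_eqE addnS andbF.
rewrite bipart_lefschetz IH !xpair_eqE addnS !eqSS.
by case: ifP => // _; rewrite linear0.
Qed.

(** Lambda commutes with interior products and kills the (0, q)-form by which [iotaJ_bipart1]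
    deviates from antiholomorphy. *)
Lemma lambda_bipart1_anti q b : exterior b ->
  antiholomorphic J (lambda_op G J (bipart 1 q b)).
Proof.
move=> eb u; have e1 : exterior (bipart 1 q b) by apply: exterior_bipart.
rewrite -!iota_lambda // iotaJ_bipart1 // lambda_opD !lambda_opZ.
rewrite (lambda_anti Gsym (a := bipart 0 q _)) ?scaler0 ?addr0 //.
- exact/exterior_bipart/exterior_iota_type.
- exact/bipart0_anti/exterior_iota_type.
Qed.

End LefschetzBidegree.

(** * The inverse of the Hodge star and the operator Lambda *)

Section HodgeInverse.
Context {R : realType} {n : nat} (G J : 'M[R]_(2 * n)).
Hypothesis Gsym : G^T = G.
Hypothesis Gunit : G \in unitmx.
Hypothesis JJ : J *m J = - 1%:M.
Hypothesis JG : J *m G *m J^T = G.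
Local Notation form := (cform R (2 * n)).
Implicit Types (a b : form).

Local Notation vol := (lefschetz_volume G J).
Local Notation star := (star_op G vol).
Let evol := exterior_deg_volume Gsym JJ JG.

Lemma exterior_deg_component k b : exterior b -> exterior_deg k (component k b).
Proof.
move=> [ml al]; split; last by move=> s /negPf; rewrite /component => ->.
split=> [s t r u v|s t w u]; rewrite /component; last by rewrite al if_same.
rewrite !size_cat /= ml; case: ifP => // _.
by rewrite mulr0 addr0.
Qed.

Lemma hodge_component k b s : exterior b ->
  hodge G vol (component k b) s = if (2 * n - size s == k)%N then hodge G vol b s else 0.
Proof.
move=> eb; rewrite /hodge; set l := (2 * n - size s)%N.
have -> : component l (component k b) = if l == k then component l b else 0.
  apply/funext => t; rewrite /component; case: (eqVneq l k) => [->|lk].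
    by case: ifP => // ->.
  by case: ifP => // /eqP ->; rewrite (negPf lk).
case: ifP => // _.
have := hodge_star Gsym Gunit evol (@exterior_deg0 R (2 * n) l).
rewrite linear0 => /(congr1 (@^~ s)); rewrite /hodge -/l.
by rewrite (component_homogeneous _ (@homogeneous_zero _ _ l)) eqxx.
Qed.

(** [hodge_inv] chooses among all exterior forms, also inhomogeneous ones, so injectivity has to be
    deduced from [star_injective] degree by degree. *)
Lemma hodge_injective a b : exterior a -> exterior b ->
  hodge G vol a = hodge G vol b -> a = b.
Proof.
move=> ea eb ab.
have cE k : component k a = component k b.
  have [eca ecb] := (exterior_deg_component k ea, exterior_deg_component k eb).
  apply/eqP; rewrite -subr_eq0; apply/eqP.
  apply: (star_injective Gsym Gunit JJ JG (k := k)).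
    by apply: exterior_degD => //; apply: exterior_degN.
  rewrite linearB /= -(hodge_star Gsym Gunit evol eca) -(hodge_star Gsym Gunit evol ecb).
  apply/eqP; rewrite subr_eq0; apply/eqP/funext => s.
  by rewrite !hodge_component // ab.
apply/funext => s; have := cE (size s) => /(congr1 (@^~ s)).
by rewrite /component eqxx.
Qed.

(** [lefschetz_star] shows that the contraction is a preimage, and injectivity that it is the one
    chosen. For k < 2 both sides vanish, L (star b) being of degree above 2n. *)
Lemma hodge_inv_lefschetz k b : exterior_deg k b ->
  hodge_inv G vol (lefschetz G J (hodge G vol b)) = lambda_op G J b.
Proof.
move=> eb.
have el : exterior (lambda_op G J b).
  by do ?[apply/exteriorZ/exterior_metric_trace => u v]; do 2 apply: exterior_iota; case: eb.
have hl : hodge G vol (lambda_op G J b) = lefschetz G J (hodge G vol b).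
  rewrite (hodge_star Gsym Gunit evol eb).
  have [k2|] := ltnP k 2; last first.
    case: k eb => [|[|k]] // eb _; rewrite lefschetz_star //.
    exact/(hodge_star Gsym Gunit evol)/exterior_deg_lambda.
  rewrite lefschetz_star_low // (lambda_low _ _ k2); last by case: eb.
  by rewrite (hodge_star Gsym Gunit evol (@exterior_deg0 R (2 * n) 0)) linear0.
apply: xget_unique => [//|a [ea ha]].
by apply: hodge_injective => //; rewrite ha.
Qed.

End HodgeInverse.

(** * Exterior derivative in a chart *)

Section Gateaux.
Context {R : realType} {m : nat}.
Implicit Types (u v x y : 'rV[R]_m).

(* Unlike [differentiable], this notion comes with a library lemma for functions
   that agree near [x]. *)
Definition gateaux (f : 'rV[R]_m -> R) x :=
  (forall v, derivable f x v) /\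
  (forall (r : R) u v, 'D_(r *: u + v) f x = r * 'D_u f x + 'D_v f x).

Lemma differentiable_gateaux (f : 'rV[R]_m -> R) x : differentiable f x -> gateaux f x.
Proof.
move=> df; split=> [v|r u v]; first exact: diff_derivable.
by rewrite !deriveE // linearP.
Qed.

Lemma gateaux_cst (k : R) x : gateaux (fun=> k) x.
Proof.
split=> [v|r u v]; first exact: derivable_cst.
by rewrite !derive_cst mulr0 addr0.
Qed.

Lemma gateauxD f g x : gateaux f x -> gateaux g x -> gateaux (fun y => f y + g y) x.
Proof.
move=> [df lf] [dg lg]; split=> [v|r u v]; first exact: derivableD.
rewrite !(@deriveD _ _ _ f g) // lf lg.
by rewrite mulrDr addrACA.
Qed.

Lemma gateauxN f x : gateaux f x -> gateaux (fun y => - f y) x.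
Proof.
move=> [df lf]; split=> [v|r u v]; first exact: derivableN.
by rewrite !(@deriveN _ _ _ f) // lf; ring.
Qed.

Lemma gateauxM f g x : gateaux f x -> gateaux g x -> gateaux (fun y => f y * g y) x.
Proof.
move=> [df lf] [dg lg]; split=> [v|r u v]; first exact: derivableM.
rewrite !(@deriveM _ _ f g) // lf lg.
move: (f x) (g x) ('D_u f x) ('D_v f x) ('D_u g x) ('D_v g x) => a b c d e h.
by rewrite /GRing.scale /=; ring.
Qed.

Lemma gateaux_near f g x : (\near x, f x = g x) -> gateaux f x -> gateaux g x.
Proof.
move=> fg [df lf]; split=> [v|r u v]; first exact: near_eq_derivable (df v).
by rewrite -!(near_eq_derive _ fg).
Qed.

Lemma gateaux_sum (I : Type) (r : seq I) (F : I -> 'rV[R]_m -> R) x :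
  (forall i, gateaux (F i) x) -> gateaux (fun y => \sum_(i <- r) F i y) x.
Proof.
move=> h; elim: r => [|i r IH].
  by rewrite (_ : (fun _ => _) = (fun=> 0)); [exact: gateaux_cst | apply/funext => y; rewrite big_nil].
rewrite (_ : (fun _ => _) = (fun y => F i y + \sum_(j <- r) F j y)); first exact: gateauxD.
by apply/funext => y; rewrite big_cons.
Qed.

Definition cgateaux (f : 'rV[R]_m -> R[i]) x :=
  gateaux (fun y => complex.Re (f y)) x /\ gateaux (fun y => complex.Im (f y)) x.

Lemma cgateaux_cst (k : R[i]) x : cgateaux (fun=> k) x.
Proof. by split; apply: gateaux_cst. Qed.

Lemma cgateauxD f g x : cgateaux f x -> cgateaux g x -> cgateaux (fun y => f y + g y) x.
Proof.
move=> [f1 f2] [g1 g2]; split.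
  rewrite (_ : (fun _ => _) = (fun y => complex.Re (f y) + complex.Re (g y))); first exact: gateauxD.
  by apply/funext => y; case: (f y) (g y) => ? ? [].
rewrite (_ : (fun _ => _) = (fun y => complex.Im (f y) + complex.Im (g y))); first exact: gateauxD.
by apply/funext => y; case: (f y) (g y) => ? ? [].
Qed.

Lemma cgateauxM f g x : cgateaux f x -> cgateaux g x -> cgateaux (fun y => f y * g y) x.
Proof.
move=> [f1 f2] [g1 g2]; split.
  rewrite (_ : (fun _ => _) = (fun y => complex.Re (f y) * complex.Re (g y)
     + - (complex.Im (f y) * complex.Im (g y)))).
    by apply: gateauxD; [exact: gateauxM | apply/gateauxN/gateauxM].
  by apply/funext => y; case: (f y) (g y) => ? ? [].
rewrite (_ : (fun _ => _) = (fun y => complex.Re (f y) * complex.Im (g y)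
     + complex.Im (f y) * complex.Re (g y))).
  by apply: gateauxD; exact: gateauxM.
by apply/funext => y; case: (f y) (g y) => ? ? [].
Qed.

Lemma deriveC_near f g x v : (\near x, f x = g x) -> deriveC f x v = deriveC g x v.
Proof.
move=> fg; rewrite /deriveC; congr (_ +i* _); apply: near_eq_derive;
  by near=> y; congr (_ _); near: y.
Unshelve. all: by end_near. Qed.

Lemma deriveC_cst (k : R[i]) x v : deriveC (fun=> k) x v = 0.
Proof. by rewrite /deriveC !derive_cst. Qed.

Lemma deriveCD f g x v : cgateaux f x -> cgateaux g x ->
  deriveC (fun y => f y + g y) x v = deriveC f x v + deriveC g x v.
Proof.
move=> [[f1 _] [f2 _]] [[g1 _] [g2 _]]; rewrite /deriveC.
rewrite (_ : (fun y => complex.Re (f y + g y)) =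
  (fun y => complex.Re (f y)) + (fun y => complex.Re (g y))); last first.
  by apply/funext => y /=; rewrite fctE; case: (f y) (g y) => ? ? [].
rewrite (_ : (fun y => complex.Im (f y + g y)) =
  (fun y => complex.Im (f y)) + (fun y => complex.Im (g y))); last first.
  by apply/funext => y /=; rewrite fctE; case: (f y) (g y) => ? ? [].
by rewrite !deriveD.
Qed.

Lemma deriveCM f g x v : cgateaux f x -> cgateaux g x ->
  deriveC (fun y => f y * g y) x v = deriveC f x v * g x + f x * deriveC g x v.
Proof.
move=> [[f1 _] [f2 _]] [[g1 _] [g2 _]]; rewrite /deriveC.
rewrite (_ : (fun y => complex.Re (f y * g y)) =
  ((fun y => complex.Re (f y)) * (fun y => complex.Re (g y)))
  - ((fun y => complex.Im (f y)) * (fun y => complex.Im (g y)))); last first.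
  by apply/funext => y /=; rewrite !fctE; case: (f y) (g y) => ? ? [].
rewrite (_ : (fun y => complex.Im (f y * g y)) =
  ((fun y => complex.Re (f y)) * (fun y => complex.Im (g y)))
  + ((fun y => complex.Im (f y)) * (fun y => complex.Re (g y)))); last first.
  by apply/funext => y /=; rewrite !fctE; case: (f y) (g y) => ? ? [].
rewrite deriveB ?deriveD ?deriveM //; try exact: derivableM.
case: (f x) (g x) => a b [c d] /=.
move: ('D_v _ x) ('D_v _ x) ('D_v _ x) ('D_v _ x) => a' c' b' d'; rewrite /GRing.scale /=.
by apply/eqP; rewrite eq_complex /=; apply/andP; split; apply/eqP; ring.
Qed.

Lemma deriveCZ (k : R[i]) f x v : cgateaux f x ->
  deriveC (fun y => k * f y) x v = k * deriveC f x v.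
Proof.
move=> df; rewrite (@deriveCM (fun=> k)) //; last exact: cgateaux_cst.
by rewrite deriveC_cst mul0r add0r.
Qed.

Lemma deriveC_linear f x (r : R) u v : cgateaux f x ->
  deriveC f x (r *: u + v) = r%:C * deriveC f x u + deriveC f x v.
Proof.
move=> [[_ f1] [_ f2]]; rewrite /deriveC f1 f2.
move: ('D_u _ x) ('D_u _ x) ('D_v _ x) ('D_v _ x) => a b c d.
by apply/eqP; rewrite eq_complex /= !mul0r subr0 addr0 !eqxx.
Qed.

End Gateaux.

(** * The exterior derivative on coordinate space and its Leibniz rule *)

Section ExteriorDerivative.
Context {R : realType} {m : nat}.
Implicit Types (u v x y : 'rV[R]_m) (F H : 'rV[R]_m -> cform R m).

Definition local_dext F x : cform R m := fun s =>
  \sum_(i < size s) (-1) ^+ i *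
    deriveC (fun y => F y (take i s ++ drop i.+1 s)) x s`_i.

Definition form_derive F x v : cform R m := fun s => deriveC (fun y => F y s) x v.

Definition form_gateaux F x := forall s, cgateaux (fun y => F y s) x.

Lemma local_dext_nil F x : local_dext F x [::] = 0.
Proof. by rewrite /local_dext big_ord0. Qed.

(** Cartan's formula for a constant vector field; it allows recursion on the arguments for d as
    well. *)
Lemma iota_local_dext v F x :
  iota_form v (local_dext F x) =
  form_derive F x v - local_dext (fun y => iota_form v (F y)) x.
Proof.
apply/funext => s; rewrite form_addE form_oppE /iota_form /local_dext big_ord_recl.
rewrite mul1r /= drop0; congr (_ + _); rewrite -sumrN; apply: eq_bigr => i _.
by rewrite exprS mulN1r mulNr.
Qed.

Lemma form_gateaux_iota v F x : form_gateaux F x -> form_gateaux (fun y => iota_form v (F y)) x.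
Proof. by move=> h s; apply: h. Qed.

Lemma form_gateauxZ (k : R[i]) F x : form_gateaux F x -> form_gateaux (fun y => k *: F y) x.
Proof. by move=> h s; apply: cgateauxM; [exact: cgateaux_cst | exact: h]. Qed.

Lemma form_gateaux_degree_sign F x :
  form_gateaux F x -> form_gateaux (fun y => degree_sign (F y)) x.
Proof. by move=> h s; apply: cgateauxM; [exact: cgateaux_cst | exact: h]. Qed.

Lemma form_gateaux_rwedge F H x : form_gateaux F x -> form_gateaux H x ->
  form_gateaux (fun y => rwedge (F y) (H y)) x.
Proof.
move=> hF hH s; elim: s F H hF hH => [|v s IH] F H hF hH; first exact: cgateauxM.
apply: cgateauxD.
  by apply: IH => //; apply: form_gateaux_iota.
by apply: IH; [exact: form_gateaux_degree_sign | exact: form_gateaux_iota].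
Qed.

Lemma form_derive_degree_sign F x v : form_gateaux F x ->
  form_derive (fun y => degree_sign (F y)) x v = degree_sign (form_derive F x v).
Proof. by move=> h; apply/funext => s; apply: deriveCZ. Qed.

Lemma form_derive_rwedge F H x v : form_gateaux F x -> form_gateaux H x ->
  form_derive (fun y => rwedge (F y) (H y)) x v =
  rwedge (form_derive F x v) (H x) + rwedge (F x) (form_derive H x v).
Proof.
move=> hF hH; apply/funext => s; rewrite form_addE.
rewrite -[LHS]/(deriveC (fun y => rwedge (F y) (H y) s) x v).
elim: s F H hF hH => [|w s IH] F H hF hH; first exact: deriveCM.
have [iF iH] := (form_gateaux_iota w hF, form_gateaux_iota w hH).
have sF := form_gateaux_degree_sign hF.
transitivity (deriveC (fun y => rwedge (iota_form w (F y)) (H y) s) x v +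
              deriveC (fun y => rwedge (degree_sign (F y)) (iota_form w (H y)) s) x v).
  by apply: deriveCD; exact: form_gateaux_rwedge.
by rewrite !IH // (form_derive_degree_sign _ hF) addrACA.
Qed.

Lemma local_dextD F H x : form_gateaux F x -> form_gateaux H x ->
  local_dext (fun y => F y + H y) x = local_dext F x + local_dext H x.
Proof.
move=> hF hH; apply/funext => s; rewrite form_addE /local_dext -big_split /=.
by apply: eq_bigr => i _; rewrite -mulrDr deriveCD.
Qed.

Lemma local_dextZ (k : R[i]) F x : form_gateaux F x ->
  local_dext (fun y => k *: F y) x = k *: local_dext F x.
Proof.
move=> hF; apply/funext => s; rewrite form_scaleE /local_dext mulr_sumr.
by apply: eq_bigr => i _; rewrite mulrCA deriveCZ.
Qed.

Lemma local_dext_near F H x : (forall s, \near x, F x s = H x s) ->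
  local_dext F x = local_dext H x.
Proof.
by move=> h; apply/funext => s; apply: eq_bigr => i _; congr (_ * _); apply: deriveC_near.
Qed.

Lemma local_dext0 x : local_dext (fun=> 0) x = 0.
Proof.
apply/funext => s; rewrite /local_dext big1 // => i _.
by rewrite deriveC_cst mulr0.
Qed.

Lemma local_dext_degree_sign F x : form_gateaux F x ->
  local_dext (fun y => degree_sign (F y)) x = - degree_sign (local_dext F x).
Proof.
move=> hF; apply/funext => s; rewrite form_oppE /degree_sign /local_dext mulr_sumr -sumrN.
apply: eq_bigr => i _; rewrite deriveCZ // mulrCA; case: s i => [[]|v s i] //.
rewrite size_cat size_drop size_take ltn_ord /=.
have -> : (i + (size s - i))%N = size s by rewrite subnKC // -ltnS.
by rewrite [in RHS]exprS mulN1r mulNr opprK.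
Qed.

(** Cartan's formula reduces the claim on w :: s to the product rules of iota_w and of the
    derivative along w, and to the claim on s for the contracted forms. *)
Lemma local_dext_rwedge F H x : form_gateaux F x -> form_gateaux H x ->
  local_dext (fun y => rwedge (F y) (H y)) x =
  rwedge (local_dext F x) (H x) + rwedge (degree_sign (F x)) (local_dext H x).
Proof.
move=> hF hH; apply/funext => s; elim: s F H hF hH => [|w s IH] F H hF hH.
  by rewrite form_addE /= !local_dext_nil mul0r mulr0 addr0.
have [iF iH] := (form_gateaux_iota w hF, form_gateaux_iota w hH).
have sF := form_gateaux_degree_sign hF.
rewrite -[LHS]/(iota_form w (local_dext (fun y => rwedge (F y) (H y)) x) s).
rewrite iota_local_dext form_derive_rwedge // form_addE form_oppE.
have -> : local_dext (fun y => iota_form w (rwedge (F y) (H y))) x s =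
    local_dext (fun y => rwedge (iota_form w (F y)) (H y)) x s +
    local_dext (fun y => rwedge (degree_sign (F y)) (iota_form w (H y))) x s.
  by rewrite -form_addE -local_dextD //; apply: form_gateaux_rwedge.
rewrite !IH // local_dext_degree_sign // degree_signK.
rewrite -[RHS]/(rwedge (iota_form w (local_dext F x)) (H x) s +
   rwedge (degree_sign (local_dext F x)) (iota_form w (H x)) s +
  (rwedge (iota_form w (degree_sign (F x))) (local_dext H x) s +
   rwedge (degree_sign (degree_sign (F x))) (iota_form w (local_dext H x)) s)).
rewrite degree_signK iota_degree_sign !iota_local_dext.
rewrite !(rwedgeDl, rwedgeDr, rwedgeNl, rwedgeNr) !(form_addE, form_oppE).
move: (rwedge _ _ s) (rwedge _ _ s) (rwedge _ _ s) (rwedge _ _ s) (rwedge _ _ s) (rwedge _ _ s).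
by move=> a b c d e f; ring.
Qed.

(** The hypothesis is local because [local_form] is known to be exterior on the image of the chart
    only. *)
Lemma exterior_local_dext F x : form_gateaux F x -> (\near x, exterior (F x)) ->
  exterior (local_dext F x).
Proof.
move=> hF eF.
have iE F' v : (\near x, exterior (F' x)) -> \near x, exterior (iota_form v (F' x)).
  by move=> h; near=> y; apply: exterior_iota; near: y.
apply: exterior_adjacent.
  move=> s; elim: s F hF eF => [|w s IH] F hF eF t r u v.
    rewrite !cat0s -[LHS]/(iota_form (r *: u + v) (local_dext F x) t).
    rewrite -[local_dext F x (u :: t)]/(iota_form u (local_dext F x) t).
    rewrite -[local_dext F x (v :: t)]/(iota_form v (local_dext F x) t).
    rewrite !iota_local_dext !form_addE !form_oppE.
    have -> : local_dext (fun y => iota_form (r *: u + v) (F y)) x =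
        r%:C *: local_dext (fun y => iota_form u (F y)) x
        + local_dext (fun y => iota_form v (F y)) x.
      rewrite -local_dextZ; last exact: form_gateaux_iota.
      rewrite -local_dextD; [|exact/form_gateauxZ/form_gateaux_iota|exact: form_gateaux_iota].
      apply: local_dext_near => s; near=> y; rewrite iota_linear //.
      by apply: exterior_multilinear; near: y.
    rewrite form_addE form_scaleE /form_derive deriveC_linear //.
    move: (deriveC _ x u) (deriveC _ x v) (local_dext _ x t) (local_dext _ x t) => a b c d.
    by ring.
  rewrite !cat_cons -![local_dext F x (w :: _)]/(iota_form w (local_dext F x) _).
  rewrite !iota_local_dext !form_addE !form_oppE IH; [|exact: form_gateaux_iota|exact: iE].
  have -> : form_derive F x w (s ++ r *: u + v :: t) =
      r%:C * form_derive F x w (s ++ u :: t) + form_derive F x w (s ++ v :: t).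
    rewrite -deriveCZ // -deriveCD //; last by apply: cgateauxM => //; exact: cgateaux_cst.
    by apply: deriveC_near; near=> y; apply: exterior_multilinear; near: y.
  move: (form_derive _ _ _ _) (form_derive _ _ _ _) (local_dext _ x _) (local_dext _ x _) => a b c d.
  by ring.
move=> s; elim: s F hF eF => [|w s IH] F hF eF t u.
  (* By Cartan's formula used twice, the derivatives along u cancel and d (iota_u iota_u F) = 0
     remains. *)
  rewrite cat0s -[LHS]/(iota_form u (iota_form u (local_dext F x)) t).
  rewrite iota_local_dext iota_formD iota_formN iota_local_dext.
  rewrite opprB addrCA -[iota_form u (form_derive F x u)]/(form_derive (fun y => iota_form u (F y)) x u).
  rewrite subrr addr0 (_ : local_dext _ x = 0) // -(local_dext0 x).
  apply: local_dext_near => s; near=> y; rewrite iota_iota //.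
  by near: y.
rewrite cat_cons -[LHS]/(iota_form w (local_dext F x) _) iota_local_dext form_addE form_oppE.
rewrite IH ?oppr0 ?addr0; [|exact: form_gateaux_iota|exact: iE].
rewrite /form_derive (deriveC_near (g := fun=> 0)) ?deriveC_cst //.
near=> y; apply: exterior_alternating; near: y; exact: eF.
Unshelve. all: by end_near. Qed.

Definition pullback_form (f : 'rV[R]_m -> 'rV[R]_m) (a : cform R m) : cform R m :=
  fun s => a (map f s).

Lemma pullback_rwedge f a b :
  pullback_form f (rwedge a b) = rwedge (pullback_form f a) (pullback_form f b).
Proof.
apply/funext => s; elim: s a b => [//|v s IH] a b.
rewrite -[LHS]/(pullback_form f (rwedge (iota_form (f v) a) b) s +
  pullback_form f (rwedge (degree_sign a) (iota_form (f v) b)) s) !IH /=.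
congr (_ + rwedge _ _ s); apply/funext => t.
by rewrite /degree_sign /pullback_form size_map.
Qed.

Lemma exterior_pullback f a : (forall r u v, f (r *: u + v) = r *: f u + f v) ->
  exterior a -> exterior (pullback_form f a).
Proof.
move=> lf [ml al]; split=> [s t r u v|s t w u]; rewrite /pullback_form !map_cat /=.
  by rewrite lf ml.
by rewrite map_cat /= al.
Qed.

End ExteriorDerivative.

(** * Forms and tangent vectors in charts *)

Section Charts.
Context {R : realType} {m : nat} (M : smooth_manifold R m).
Implicit Types (c : chart R m M) (p : M) (u v : 'rV[R]_m).

Lemma differentiable_rV (k : nat) (f : 'rV[R]_m -> 'rV[R]_k) x :
  (forall j, differentiable (fun y => f y 0 j) x) -> differentiable f x.
Proof.
move=> h.
have -> : f = \sum_(j < k) (fun y => f y 0 j *: (delta_mx 0 j : 'rV[R]_k)).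
  by apply/funext => y; rewrite fct_sumE {1}(row_sum_delta (f y)).
by apply: differentiable_sum => j; apply: differentiableZl.
Qed.

Lemma smooth_on_differentiable (U : set 'rV[R]_m) f x : smooth_on U f -> U x -> differentiable f x.
Proof. by move=> h Ux; apply: (h [::]). Qed.

Lemma cinvK c y : cimg c y -> cmap c (cinv c y) = y.
Proof. by case=> p dp <-; rewrite cmapK. Qed.

Lemma cinv_dom c y : cimg c y -> cdom c (cinv c y).
Proof. by case=> p dp <-; rewrite cmapK. Qed.

Lemma cimg_cmap c p : cdom c p -> cimg c (cmap c p).
Proof. by move=> dp; exists p. Qed.

Lemma near_cimg c y : cimg c y -> \near y, cimg c y.
Proof. by move=> cy; apply: open_nbhs_nbhs; split => //; apply: cimg_open. Qed.

Lemma near_cinv_dom c c' p : cdom c p -> cdom c' p ->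
  \forall y \near cmap c p, cdom c' (cinv c y).
Proof.
move=> dp dp'; have := @cinv_continuous _ _ _ c.
rewrite continuous_open_subspace; last exact: cimg_open.
move=> /(_ (cmap c p)) h; apply: h; first by apply/mem_set/cimg_cmap.
by rewrite cmapK //; apply: open_nbhs_nbhs; split => //; apply: cdom_open.
Qed.

Lemma transition_differentiable c c' p : atlas c -> atlas c' -> cdom c p -> cdom c' p ->
  differentiable (cmap c' \o cinv c) (cmap c p).
Proof.
move=> ac ac' dp dp'; apply: differentiable_rV => j.
by apply: (smooth_on_differentiable (atlas_smooth ac ac' j)); exists p.
Qed.

Lemma tchange_linear c c' p r u v : atlas c -> atlas c' -> cdom c p -> cdom c' p ->
  tchange c c' p (r *: u + v) = r *: tchange c c' p u + tchange c c' p v.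
Proof.
move=> ac ac' dp dp'; have df := transition_differentiable ac ac' dp dp'.
by rewrite /tchange !deriveE // linearP.
Qed.

Lemma tchange_id c p v : cdom c p -> tchange c c p v = v.
Proof.
move=> dp; rewrite /tchange -[RHS](derive_id (cmap c p)); apply: near_eq_derive.
have := near_cimg (cimg_cmap dp); apply: filterS => y; exact: cinvK.
Qed.

Lemma tchangeK c c' p v : atlas c -> atlas c' -> cdom c p -> cdom c' p ->
  tchange c c' p (tchange c' c p v) = v.
Proof.
move=> ac ac' dp dp'; rewrite /tchange.
have df := transition_differentiable ac ac' dp dp'.
have dg := transition_differentiable ac' ac dp' dp.
have ge : (cmap c \o cinv c') (cmap c' p) = cmap c p by rewrite /= cmapK.
rewrite -ge in df *; rewrite (deriveE _ df) (deriveE _ dg).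
rewrite -[LHS]/(('d (cmap c' \o cinv c) ((cmap c \o cinv c') (cmap c' p)) \o
  'd (cmap c \o cinv c') (cmap c' p)) v).
rewrite -(diff_comp dg df) -deriveE; last exact: differentiable_comp.
rewrite -[RHS](derive_id (cmap c' p)); apply: near_eq_derive.
have n1 := near_cimg (cimg_cmap dp'); have n2 := near_cinv_dom dp' dp.
near=> y; rewrite /= cmapK; last by near: y.
by apply: cinvK; near: y.
Unshelve. all: by end_near. Qed.

(** [local_coef] as a form-valued function on coordinate space; [dext] at p is by definition
    [local_dext] of it. *)
Definition local_form (a : dform M) c (y : 'rV[R]_m) : cform R m :=
  pullback_form (of_coord c (cinv c y)) (a (cinv c y)).

Lemma dext_local a p s : dext a p s = local_dext (local_form a (chart_at p)) (cmap (chart_at p) p) s.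
Proof. by []. Qed.

Lemma local_form_base a p : local_form a (chart_at p) (cmap (chart_at p) p) = a p.
Proof.
rewrite /local_form cmapK; last exact: chart_at_dom.
apply/funext => s; rewrite /pullback_form -[in RHS](map_id s); congr (a p _).
by apply: eq_map => v; apply: tchange_id; apply: chart_at_dom.
Qed.

Lemma of_coord_linear c p r u v : atlas c -> cdom c p ->
  of_coord c p (r *: u + v) = r *: of_coord c p u + of_coord c p v.
Proof.
move=> ac dp; apply: tchange_linear => //; [exact: chart_at_atlas | exact: chart_at_dom].
Qed.

Lemma of_coordK c p v : atlas c -> cdom c p -> of_coord c p (to_coord c p v) = v.
Proof.
move=> ac dp; apply: tchangeK => //; [exact: chart_at_atlas | exact: chart_at_dom].
Qed.

Lemma exterior_local_form a c y : atlas c -> cimg c y -> exterior (a (cinv c y)) ->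
  exterior (local_form a c y).
Proof.
move=> ac cy; apply: exterior_pullback => r u v; apply: of_coord_linear => //.
exact: cinv_dom.
Qed.

Lemma smooth_form_gateaux a c y : smooth_form a -> atlas c -> cimg c y ->
  form_gateaux (local_form a c) y.
Proof.
move=> sa ac cy s; have [h1 h2] := sa c ac s.
by split; apply: differentiable_gateaux;
  [apply: (smooth_on_differentiable h1) | apply: (smooth_on_differentiable h2)].
Qed.

End Charts.

Section AlmostHermitianCharts.
Context {R : realType} {n : nat} (M : almost_hermitian R n).

(** Smoothness of J and of g is given on constant coordinate vectors, so omega(u, v) is expanded as
    \sum_j (J u)^j g(e_j, v). The expansion holds over the domain of the chart, whence
    [gateaux_near]. *)
Lemma omega_gateaux c y : atlas c -> cimg c y ->
  form_gateaux (local_form (omega M) c) y.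
Proof.
move=> ac cy s.
have [[u [v ->]]|hs] : (exists u v, s = [:: u; v]) \/ (forall y, local_form (omega M) c y s = 0).
  case: s => [|u [|v [|w s]]]; [by right|by right|by left; exists u, v|by right].
2: by rewrite (_ : (fun _ => _) = (fun=> 0)); [exact: cgateaux_cst | apply/funext].
pose W z (j : 'I_(2 * n)) := let p := cinv c z in
  to_coord c p (of_coord c p u *m ahJ p) 0 j.
pose g z (j : 'I_(2 * n)) := let p := cinv c z in
  (of_coord c p (delta_mx 0 j) *m ahG p *m (of_coord c p v)^T) 0 0.
split; last first.
  by rewrite (_ : (fun _ => _) = (fun=> 0)); [exact: gateaux_cst | apply/funext].
apply: (@gateaux_near _ _ (fun z => \sum_j W z j * g z j)); last first.
  apply: gateaux_sum => j; apply: gateauxM; apply: differentiable_gateaux.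
    exact: (smooth_on_differentiable (ahJ_smooth ac u j)).
  exact: (smooth_on_differentiable (ahG_smooth ac (delta_mx 0 j) v)).
have := near_cimg cy; apply: filterS => z cz.
rewrite /local_form /pullback_form /omega /= /W /g; set p := cinv c z.
have dp : cdom c p by apply: cinv_dom.
rewrite -[in RHS](of_coordK (of_coord c p u *m ahJ p) ac dp).
move: (to_coord c p _) => w; set w' := of_coord c p v.
have -> : of_coord c p w = \sum_j w 0 j *: of_coord c p (delta_mx 0 j).
  have lin r a b : of_coord c p (r *: a + b) = r *: of_coord c p a + of_coord c p b.
    exact: of_coord_linear.
  have lD a b : of_coord c p (a + b) = of_coord c p a + of_coord c p b.
    by rewrite -{1}[a]scale1r lin scale1r.
  have l0 : of_coord c p 0 = 0 by apply: (addrI (of_coord c p 0)); rewrite -lD !addr0.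
  rewrite {1}(row_sum_delta w) (big_morph _ lD l0); apply: eq_bigr => j _.
  by rewrite -[_ *: _ in LHS]addr0 lin l0 addr0.
rewrite !mulmx_suml summxE; apply: eq_bigr => j _.
by rewrite -scalemxAl -scalemxAl [in RHS]mxE.
Qed.

End AlmostHermitianCharts.

(** * The identity on an almost Hermitian manifold *)

Section Assembly.
Context {R : realType} {n : nat} (M : almost_hermitian R n).
Implicit Types (x : M) (a b : dform M).

Local Notation G x := (ahG x).
Local Notation J x := (ahJ x).
Local Notation LL x := (lefschetz (G x) (J x)).
Local Notation vol x := (lefschetz_volume (G x) (J x)).

Lemma ahG_unit x : G x \in unitmx.
Proof.
rewrite -row_free_unit -kermx_eq0; apply/rowV0P => u /sub_kermxP uG.
apply/eqP; apply/negPn/negP => u0; have := ahG_pos x u0.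
by rewrite uG mul0mx mxE ltxx.
Qed.

Lemma ahJ_isometry x : J x *m G x *m (J x)^T = G x.
Proof.
have entry (A : 'M[R]_(2 * n)) i j :
    ((delta_mx 0 i : 'rV[R]_(2 * n)) *m A *m
      (delta_mx 0 j : 'rV[R]_(2 * n))^T) 0 0 = A i j.
  by rewrite -rowE trmx_delta -colE !mxE.
apply/matrixP => i j; have := ahG_compat x (delta_mx 0 i) (delta_mx 0 j).
by rewrite entry => <-; rewrite -[LHS]entry trmx_mul !mulmxA.
Qed.

Lemma omegaE x : omega M x = fundamental_form (G x) (J x). Proof. by []. Qed.

Lemma exterior_omega x : exterior (omega M x).
Proof.
rewrite omegaE; have [] // := exterior_deg_fundamental (ahG_sym x) (ahJ_square x) (ahJ_isometry x).
Qed.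

Lemma volumeE x : volume M x = vol x.
Proof.
rewrite /volume /lefschetz_volume /wedge_exp; congr (_ *: _).
suff h j : iter j (wedge (omega M x)) (@one_form0 R (2 * n)) =
    iter j (LL x) (@one_form0 R (2 * n)) by exact: h.
elim: j => [//|j IH]; rewrite !iterS IH wedgeE //; first exact: exterior_omega.
by have [] := exterior_deg_lefschetz_iter (ahG_sym x) (ahJ_square x) (ahJ_isometry x) j
  (@exterior_deg_one R (2 * n)).
Qed.

Lemma LopE a x : exterior (a x) -> Lop a x = LL x (a x).
Proof. by move=> ea; rewrite /Lop wedgeE //; exact: exterior_omega. Qed.

Lemma starE k a x : exterior_deg k (a x) -> star a x = star_op (G x) (vol x) k (a x).
Proof.
move=> ea; rewrite /star volumeE.
apply: hodge_star => //; [exact: ahG_sym | exact: ahG_unit |].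
exact: (exterior_deg_volume (ahG_sym x) (ahJ_square x) (ahJ_isometry x)).
Qed.

Lemma LambdaE k a x : exterior_deg k (a x) -> Lambda a x = lambda_op (G x) (J x) (a x).
Proof.
move=> ea; rewrite /Lambda /star_inv LopE; last first.
  rewrite (starE ea); apply: exterior_star.
  exact: (exterior_deg_volume (ahG_sym x) (ahJ_square x) (ahJ_isometry x)).
rewrite /star volumeE; apply: hodge_inv_lefschetz ea => //.
- exact: ahG_sym.
- exact: ahG_unit.
- exact: ahJ_square.
- exact: ahJ_isometry.
Qed.

(** Iterates of [lefschetz] rather than [Lop]: the recursive product has its rules without a
    hypothesis that the forms are exterior. *)
Definition Lpow j a : dform M := fun x => iter j (LL x) (a x).

Lemma local_form_Lpow j a c y :
  local_form (Lpow j a) c y =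
  iter j (rwedge (local_form (omega M) c y)) (local_form a c y).
Proof.
elim: j => [//|j IH]; rewrite iterS -IH -pullback_rwedge //.
Qed.

Lemma form_gateaux_Lpow j a c y : smooth_form a -> atlas c -> cimg c y ->
  form_gateaux (local_form (Lpow j a) c) y.
Proof.
move=> sa ac cy; elim: j => [|j IH]; first exact: smooth_form_gateaux.
have -> : local_form (Lpow j.+1 a) c =
    (fun z => rwedge (local_form (omega M) c z) (local_form (Lpow j a) c z)).
  by apply/funext => z; rewrite !local_form_Lpow.
by apply: form_gateaux_rwedge => //; exact: omega_gateaux.
Qed.

Lemma dext_Lpow j a x : smooth_form a ->
  dext (Lpow j a) x =
  j%:R *: rwedge (dext (omega M) x) (iter j.-1 (LL x) (a x)) + iter j (LL x) (dext a x).
Proof.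
move=> sa; have ac := chart_at_atlas x; have cx := cimg_cmap (chart_at_dom x).
have dE b : dext b x = local_dext (local_form b (chart_at x)) (cmap (chart_at x) x).
  by apply/funext => s; rewrite dext_local.
elim: j => [|j IH]; first by rewrite scale0r add0r.
have -> : dext (Lpow j.+1 a) x =
    rwedge (dext (omega M) x) (iter j (LL x) (a x)) + LL x (dext (Lpow j a) x).
  rewrite !dE (_ : local_form (Lpow j.+1 a) (chart_at x) = (fun z => rwedge
      (local_form (omega M) (chart_at x) z) (local_form (Lpow j a) (chart_at x) z))).
    rewrite local_dext_rwedge; [|exact: omega_gateaux|exact: form_gateaux_Lpow].
    have os : degree_sign (omega M x) = omega M x.
      exact: (degree_sign_fundamental (ahG_sym x) (ahJ_square x) (ahJ_isometry x)).
    by rewrite !local_form_base os.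
  by apply/funext => z; rewrite !local_form_Lpow.
rewrite IH lefschetzD lefschetzZ addrA; congr (_ + _).
case: j {IH} => [|j]; first by rewrite scale0r addr0 scale1r.
rewrite (lefschetz_rwedge (ahG_sym x) (ahJ_square x) (ahJ_isometry x)).
by rewrite -{1}[rwedge _ _]scale1r -scalerDl nat1r.
Qed.

Lemma exterior_dext_Lpow j a x : smooth_form a -> (forall y, exterior (a y)) ->
  exterior (dext (Lpow j a) x).
Proof.
move=> sa ea; have ac := chart_at_atlas x; have cx := cimg_cmap (chart_at_dom x).
have -> : dext (Lpow j a) x = local_dext (local_form (Lpow j a) (chart_at x)) (cmap (chart_at x) x).
  by apply/funext => s; rewrite dext_local.
apply: exterior_local_dext; first exact: form_gateaux_Lpow.
have := near_cimg cx; apply: filterS => y cy.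
apply: exterior_local_form => //; rewrite /Lpow.
elim: j => [|j IH]; first exact: ea.
rewrite iterS; apply: exterior_rwedge => //; exact: exterior_omega.
Qed.

Lemma dext0 x : dext (0 : dform M) x = 0.
Proof.
apply/funext => s; rewrite dext_local -[RHS](congr1 (@^~ s) (local_dext0 (cmap (chart_at x) x))).
by [].
Qed.

Lemma dextZ (k : R[i]) j a x : smooth_form a ->
  dext (fun y => k *: Lpow j a y) x = k *: dext (Lpow j a) x.
Proof.
move=> sa; have ac := chart_at_atlas x; have cx := cimg_cmap (chart_at_dom x).
apply/funext => s; rewrite form_scaleE !dext_local -form_scaleE -local_dextZ //.
exact: form_gateaux_Lpow.
Qed.

(** For a form of a single bidegree one term of the sum in [del] survives; the others project d 0,
    or have the wrong degree. *)
Lemma delE (p q : nat) a x : exterior (dext a x) ->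
  (forall p' q', form_part p' q' a = if (p', q') == (p, q) then a else 0) ->
  del a x = bipart (J x) p.+1 q (dext a x).
Proof.
move=> ea ha; apply/funext => s; rewrite /del.
have part0 p' q' : form_part p' q' (dext (0 : dform M)) x = 0.
  have -> : dext (0 : dform M) = 0 by apply/funext => y; exact: dext0.
  rewrite /form_part bidegree_partE; last exact: exterior_zero.
  exact: linear0.
have hom : homogeneous (p.+1 + q) (bipart (J x) p.+1 q (dext a x)).
  exact: homogeneous_bipart.
have [sE|sN] := eqVneq (size s) (p.+1 + q)%N; last first.
  rewrite [RHS]hom // big1 // => i _; rewrite ha.
  case: eqP => [[ip iq]|_]; last by rewrite part0.
  by move: sN; rewrite -iq -ip subnKC ?eqxx // ltn_ord.
have ps : (p < size s)%N by rewrite sE leq_addr.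
rewrite (bigD1 (Ordinal ps)) //= big1 ?addr0 => [|i ip].
  by rewrite ha sE addKn eqxx /form_part bidegree_partE // sE addKn.
rewrite ha; case: eqP => [[ip' _]|_]; last by rewrite part0.
by move: ip; rewrite -val_eqE /= ip' eqxx.
Qed.

(** * The identity for a fixed form of bidegree (0, q) *)

Section ZeroQForms.
Variables (q : nat) (alpha : dform M).
Hypothesis Halpha : Apq M 0 q alpha.

Let smooth_alpha : smooth_form alpha. Proof. by case: Halpha. Qed.

Let deg_alpha x : exterior_deg q (alpha x).
Proof. by case: Halpha => _ /(_ x) /(pure_form_anti (ahJ_square x)) []. Qed.

Let anti_alpha x : antiholomorphic (J x) (alpha x).
Proof. by case: Halpha => _ /(_ x) /(pure_form_anti (ahJ_square x)) []. Qed.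

Let ext_alpha x : exterior (alpha x). Proof. by case: (deg_alpha x). Qed.

Local Notation evol x := (exterior_deg_volume (ahG_sym x) (ahJ_square x) (ahJ_isometry x)).

(** del (L^j alpha), as L^j alpha has bidegree (j, q + j); see [del_Lpow]. *)
Definition delL j : dform M := fun x => bipart (J x) j.+1 (q + j) (dext (Lpow j alpha) x).

Lemma exterior_deg_Lpow j x : exterior_deg (q + j.*2) (Lpow j alpha x).
Proof.
exact: (exterior_deg_lefschetz_iter (ahG_sym x) (ahJ_square x) (ahJ_isometry x) j (deg_alpha x)).
Qed.

Lemma exterior_deg_delL j x : exterior_deg (j.+1 + (q + j)) (delL j x).
Proof. by apply: exterior_deg_bipart; apply: exterior_dext_Lpow. Qed.

Lemma del_Lpow (k : R[i]) j : del (fun x => k *: Lpow j alpha x) = (fun x => k *: delL j x).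
Proof.
apply/funext => x; rewrite (@delE j (q + j)); first last.
- move=> p' q'; apply/funext => y; rewrite /form_part bidegree_partE; last first.
    by apply: exteriorZ; case: (exterior_deg_Lpow j y).
  rewrite bipartZ (bipart_lefschetz_iter_anti (ahG_sym y) (ahJ_square y) (ahJ_isometry y) _ _ _
    (deg_alpha y) (anti_alpha y)).
  by case: ifP => // _; rewrite scaler0.
- by rewrite dextZ //; apply: exteriorZ; apply: exterior_dext_Lpow.
by rewrite dextZ // bipartZ.
Qed.

(* The terms in [d omega] cancel because [d omega /\ _] commutes with [L]. *)
Lemma delL_combination N x :
  (1 - N%:R) *: delL N x + N%:R *: LL x (delL N.-1 x) = iter N (LL x) (delL 0 x).
Proof.
have bl p' q' (b : cform R (2 * n)) : LL x (bipart (J x) p' q' b) = bipart (J x) p'.+1 q'.+1 (LL x b).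
  by rewrite (bipart_lefschetz (ahG_sym x) (ahJ_square x) (ahJ_isometry x)).
rewrite /delL; case: N => [|N]; first by rewrite subr0 scale1r scale0r addr0.
rewrite -(bipart_lefschetz_iter (ahG_sym x) (ahJ_square x) (ahJ_isometry x) N.+1 1 (q + 0)).
rewrite /= bl !addn0 addnS add1n -!bipartZ -bipartD; congr (bipart _ _ _ _).
rewrite !dext_Lpow //= scale0r add0r lefschetzD lefschetzZ.
rewrite (lefschetz_rwedge (ahG_sym x) (ahJ_square x) (ahJ_isometry x)).
(* With exponent N + 1, the coefficient of the d omega term is - N (N + 1) + (N + 1) N = 0 and that
   of L^(N+1) d alpha is - N + (N + 1) = 1. The case N = 0 is separate because of the predecessor in
   [dext_Lpow]. *)
case: N => [|N]; apply/funext => s; rewrite !(form_addE, form_scaleE) /=.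
  by ring.
rewrite -[LL x (iter N _ _)]/(iter N.+1 (LL x) (alpha x)).
move: (rwedge _ _ s) (LL x _ s) => y z; rewrite -!natr1.
by ring.
Qed.

Section Low.
Hypothesis qn : (q <= n)%N.
Let N := (n - q)%N.
Let k : R[i] := star_sign q / N`!%:R.

Lemma star_alpha : star alpha = fun x => k *: Lpow N alpha x.
Proof.
apply/funext => x; rewrite (starE (deg_alpha x)).
by rewrite (star_anti (ahG_sym x) (ahG_unit x) (ahJ_square x) (ahJ_isometry x)) // qn.
Qed.

(** For N = n - q the general coefficient N (n - q - N + 1) reduces to N. *)
Lemma lambda_Lalpha x : lambda_op (G x) (J x) (Lpow N alpha x) = N%:R *: Lpow N.-1 alpha x.
Proof.
rewrite /Lpow (lambda_lefschetz_iter (ahG_sym x) (ahG_unit x) (ahJ_square x) (ahJ_isometry x) N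
  (deg_alpha x)).
rewrite (lambda_anti (ahG_sym x) (ext_alpha x) (anti_alpha x)) lefschetz_iter0 add0r.
congr (_ *: _); rewrite /N natrB //; ring.
Qed.

Lemma star_Lalpha : star (Lop alpha) = fun x => (k * N%:R) *: Lpow N.-1 alpha x.
Proof.
apply/funext => x.
have -> : star (Lop alpha) x = star (fun y => LL y (alpha y)) x.
  by rewrite /star LopE.
rewrite (@starE q.+2); last first.
  exact: (exterior_deg_lefschetz (ahG_sym x) (ahJ_square x) (ahJ_isometry x) (deg_alpha x)).
rewrite (star_lefschetz (ahG_sym x) (ahG_unit x) (ahJ_square x) (ahJ_isometry x) (deg_alpha x)).
rewrite -(starE (deg_alpha x)) star_alpha lambda_opZ lambda_Lalpha.
by rewrite scalerA.
Qed.

Lemma starZ (c : R[i]) K a x : exterior_deg K (a x) ->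
  star (fun y => c *: a y) x = c *: star_op (G x) (vol x) K (a x).
Proof.
by move=> ea; rewrite (@starE K) ?linearZ //; apply: exterior_degZ.
Qed.

Lemma delbar_adj_alpha x :
  delbar_adj alpha x = - (k *: star_op (G x) (vol x) (q.+1 + N.*2) (delL N x)).
Proof.
rewrite /delbar_adj star_alpha del_Lpow -[LHS]/(- star _ x); congr (- _).
rewrite (@starZ _ (q.+1 + N.*2)) //.
by have := exterior_deg_delL N x; congr (exterior_deg _ _); rewrite -addnn; lia.
Qed.

Lemma delbar_adj_Lalpha :
  delbar_adj (Lop alpha) = fun x => - ((k * N%:R) *:
    star_op (G x) (vol x) (N.-1.+1 + (q + N.-1)) (delL N.-1 x)).
Proof.
rewrite /delbar_adj star_Lalpha del_Lpow; apply/funext => x.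
rewrite -[LHS]/(- star _ x); congr (- _).
by rewrite (@starZ _ (N.-1.+1 + (q + N.-1))) //; apply: exterior_deg_delL.
Qed.

Lemma exterior_deg_star_any K (b : cform R (2 * n)) x :
  exterior_deg K b -> exterior_deg (2 * n - K) (star_op (G x) (vol x) K b).
Proof.
move=> eb; have [Kn|Kn] := leqP K (2 * n).
  by apply: exterior_deg_star => //; exact: (evol x).
by rewrite (exterior_vanish_above eb Kn) linear0; exact: exterior_deg0.
Qed.

Lemma Lambda_delbar_adj_Lalpha x :
  Lambda (delbar_adj (Lop alpha)) x =
  - ((k * N%:R) *: star_op (G x) (vol x) (q.+1 + N.*2) (LL x (delL N.-1 x))).
Proof.
have ed := exterior_deg_delL N.-1 x.
rewrite delbar_adj_Lalpha (@LambdaE (2 * n - (N.-1.+1 + (q + N.-1)))); last first.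
  exact/exterior_degN/exterior_degZ/exterior_deg_star_any.
rewrite -scaleN1r lambda_opZ scaleN1r lambda_opZ; congr (- _).
rewrite -(star_lefschetz (ahG_sym x) (ahG_unit x) (ahJ_square x) (ahJ_isometry x) ed).
(* For N = 0 the degrees of the two stars differ, as 0.-1 = 0, but the coefficient is zero. *)
have [N0|N0] := posnP N; first by rewrite N0 mulr0 !scale0r.
congr (_ *: star_op _ _ _ _); rewrite -addnn; lia.
Qed.

Lemma Lambda_Lalpha : Lambda (Lop alpha) = fun x => N%:R *: alpha x.
Proof.
apply/funext => x; have el : exterior_deg q.+2 (Lop alpha x).
  rewrite LopE //.
  exact: (exterior_deg_lefschetz (ahG_sym x) (ahJ_square x) (ahJ_isometry x) (deg_alpha x)).
rewrite (LambdaE el) LopE //.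
rewrite (lambda_lefschetz (ahG_sym x) (ahG_unit x) (ahJ_square x) (ahJ_isometry x) (deg_alpha x)).
rewrite (lambda_anti (ahG_sym x) (ext_alpha x) (anti_alpha x)) linear0 add0r.
by rewrite /N natrB.
Qed.

Lemma delbar_adj_Lambda_Lalpha x :
  delbar_adj (Lambda (Lop alpha)) x =
  - ((k * N%:R) *: star_op (G x) (vol x) (q.+1 + N.*2) (delL N x)).
Proof.
have -> : delbar_adj (Lambda (Lop alpha)) x = N%:R *: delbar_adj alpha x.
  rewrite Lambda_Lalpha /delbar_adj.
  have -> : star (fun y => N%:R *: alpha y) = fun y => (N%:R * k) *: Lpow N alpha y.
    apply/funext => y; rewrite (starZ _ (deg_alpha y)) -(starE (deg_alpha y)) star_alpha.
    by rewrite scalerA.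
  rewrite star_alpha !del_Lpow -[LHS]/(- star _ x) -[X in _ = _ *: X]/(- star _ x).
  have ed := exterior_deg_delL N x.
  by rewrite !(starZ _ ed) -scalerA scalerN.
by rewrite delbar_adj_alpha scalerN scalerA mulrC.
Qed.

(** del alpha has bidegree (1, q), so [lambda_bipart1_anti] provides the hypothesis of
    [lambda_as_star]. *)
Lemma Lambda_del_alpha x : Lambda (del alpha) x =
  - ('i%R * k) *: star_op (G x) (vol x) (q.+1 + N.*2) (iter N (LL x) (delL 0 x)).
Proof.
have dE : del alpha = delL 0.
  have := del_Lpow 1 0; rewrite (_ : (fun y => 1 *: _) = alpha) => [->|].
    by apply/funext => y; rewrite scale1r.
  by apply/funext => y; rewrite scale1r.
have ed : exterior_deg q.+1 (delL 0 x).
  by have := exterior_deg_delL 0 x; rewrite add1n addn0.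
rewrite dE (LambdaE ed).
apply: (lambda_as_star (ahG_sym x) (ahG_unit x) (ahJ_square x) (ahJ_isometry x)) => //.
apply: (lambda_bipart1_anti (ahG_sym x) (ahJ_square x)); exact: exterior_dext_Lpow.
Qed.

Lemma lambda_del_low_degree :
  Lambda (del alpha) =
    'i%R *: delbar_adj alpha
    + 'i%R *: commutator Lambda delbar_adj (Lop alpha).
Proof.
apply/funext => x.
rewrite -[RHS]/('i%R *: delbar_adj alpha x + 'i%R *:
  (Lambda (delbar_adj (Lop alpha)) x - delbar_adj (Lambda (Lop alpha)) x)).
rewrite delbar_adj_alpha Lambda_delbar_adj_Lalpha delbar_adj_Lambda_Lalpha Lambda_del_alpha.
(* Read backwards, [delL_combination] splits L^N del alpha into the two forms whose stars stand on
   the right-hand side. *)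
rewrite -delL_combination; move: (delL N x) (LL x _) => y z.
have -> : star_op (G x) (vol x) (q.+1 + N.*2) ((1 - N%:R) *: y + N%:R *: z) =
    (1 - N%:R) *: star_op (G x) (vol x) (q.+1 + N.*2) y +
    N%:R *: star_op (G x) (vol x) (q.+1 + N.*2) z.
  by rewrite linearD linearZ linearZ.
move: (star_op _ _ _ _) (star_op _ _ _ _) k => {}y {}z k'.
by apply/funext => s; rewrite !(form_addE, form_oppE, form_scaleE); ring.
Qed.

End Low.

Lemma lambda_del_high_degree : (n < q)%N ->
  Lambda (del alpha) =
    'i%R *: delbar_adj alpha
    + 'i%R *: commutator Lambda delbar_adj (Lop alpha).
Proof.
move=> nq; have a0 : alpha = 0.
  apply/funext => x.
  exact: (anti_vanish (ahG_sym x) (ahG_unit x) (ahJ_square x) (ahJ_isometry x)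
    (deg_alpha x) (anti_alpha x) nq).
have L0 : Lop (0 : dform M) = 0.
  by apply/funext => x; rewrite LopE ?linear0 //; exact: exterior_zero.
have s0 : star (0 : dform M) = 0.
  apply/funext => x; rewrite (@starE 0) ?linear0 //; exact: exterior_deg0.
have La0 : Lambda (0 : dform M) = 0.
  apply/funext => x; rewrite (@LambdaE 0) ?linear0 //; exact: exterior_deg0.
have d0 : del (0 : dform M) = 0.
  (* del 0 = 0 is the case of scalar 0 in [del_Lpow]. *)
  have := del_Lpow 0 0; rewrite a0 (_ : (fun y => 0 *: _) = 0) => [->|].
    by apply/funext => y; rewrite scale0r.
  by apply/funext => y; rewrite scale0r.
have b0 : delbar_adj (0 : dform M) = 0 by rewrite /delbar_adj s0 d0 s0 oppr0.
by rewrite a0 L0 /commutator b0 d0 La0 b0 subrr !scaler0 addr0.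
Qed.

End ZeroQForms.

End Assembly.

Theorem proposition4p1 (R : realType) (n : nat) (M : almost_hermitian R n)
    (q : nat) (alpha : dform M) (Halpha : Apq M 0 q alpha) :
  Lambda (del alpha) =
    'i%R *: delbar_adj alpha
    + 'i%R *: commutator Lambda delbar_adj (Lop alpha).
Proof.
have [qn|nq] := leqP q n; first exact: (lambda_del_low_degree Halpha).
exact: (lambda_del_high_degree Halpha).
Qed.
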